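(* Suppose $0\le i\le n$, $0\le j\le n-1$, and $\lambda,\nu\in\mathbb{C}$. Put $\tilde i:=n-i$, $\tilde j:=n-1-j$. (1) There are natural bijections $$\mathrm{Diff}_{SO_0(n,1)}(I(i,\lambda),J(j,\nu))\simeq\mathrm{Diff}_{SO_0(n,1)}(I(\tilde i,\lambda),J(j,\nu))\simeq\mathrm{Diff}_{SO_0(n,1)}(I(i,\lambda),J(\tilde j,\nu))\simeq\mathrm{Diff}_{SO_0(n,1)}(I(\tilde i,\lambda),J(\tilde j,\nu)).$$ (2) The space $\mathrm{Diff}_{SO_0(n,1)}(I(i,\lambda),J(j,\nu))$ is nonzero only when $\nu-\lambda\in\mathbb{N}$. Assume now $\nu-\lambda\in\mathbb{N}$. Fix $\alpha\in\mathbb{Z}/2\mathbb{Z}$ and set $\beta:=\alpha+\nu-\lambda\bmod2$. Then $$\mathrm{Diff}_{SO_0(n,1)}(I(i,\lambda),J(j,\nu))\simeq\mathrm{Diff}_{O(n,1)}(I(i,\lambda)_\alpha,J(j,\nu)_\beta)\oplus\mathrm{Diff}_{O(n,1)}(I(\tilde i,\lambda)_\alpha,J(j,\nu)_\beta)$$ $$\simeq\mathrm{Diff}_{O(n,1)}(I(i,\lambda)_\alpha,J(j,\nu)_\beta)\oplus\mathrm{Diff}_{O(n,1)}(I(i,\lambda)_\alpha,J(\tilde j,\nu)_\beta).$$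
   Context: $n\ge2$, $\mathbb{N}=\{0,1,2,\dots\}$. Let $G=O(n+1,1)$ be the isometry group of $x_0^2+\dots+x_n^2-x_{n+1}^2$ on $\mathbb{R}^{n+2}$ (standard basis $e_0,\dots,e_{n+1}$, matrix units $E_{pq}$), $P\subset G$ the stabilizer of the line $\mathbb{R}\,{}^t(1,0,\dots,0,1)$. Then $P=MAN_+$ with $A=\{e^{tH_0}\}$, $H_0=E_{0,n+1}+E_{n+1,0}$, $M=\{\mathrm{diag}(b,B,b):B\in O(n),b\in\{\pm1\}\}\simeq O(n)\times O(1)$, and $N_+=\exp\mathfrak{n}_+(\mathbb{R})$, $\mathfrak{n}_+(\mathbb{R})$ the $(+1)$-eigenspace of $\mathrm{ad}(H_0)$. For $0\le i\le n$, $\lambda\in\mathbb{C}$, $\alpha\in\mathbb{Z}/2\mathbb{Z}$, let $\sigma^{(i)}_{\lambda,\alpha}$ be the representation of $P$ on $\bigwedge^i(\mathbb{C}^n)$ with $N_+$ trivial and $\mathrm{diag}(b,B,b)e^{tH_0}\mapsto b^\alpha e^{\lambda t}\bigwedge^iB$. $I(i,\lambda)_\alpha$ is the (unnormalized) principal series $\mathrm{Ind}_P^G(\sigma^{(i)}_{\lambda,\alpha})=\{f\in C^\infty(G,\bigwedge^i\mathbb{C}^n):f(gp)=\sigma^{(i)}_{\lambda,\alpha}(p)^{-1}f(g)\ \forall p\in P\}$, with $G$ acting by left translation. $G'=O(n,1)$ is the stabilizer of $e_n$ in $G$, $P'=P\cap G'=M'AN_+'$, $M'\simeq O(n-1)\times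 O(1)$; $J(j,\nu)_\beta$ is the analogous principal series of $G'$ induced from $\bigwedge^j(\mathbb{C}^{n-1})\boxtimes(-1)^\beta\boxtimes\mathbb{C}_\nu$. $G_0=SO_0(n+1,1)$ and $G_0'=SO_0(n,1)$ are the identity components; $P_0=P\cap G_0$, $P'_0=P'\cap G_0'$. $I(i,\lambda)=\mathrm{Ind}_{P_0}^{G_0}(\bigwedge^i(\mathbb{C}^n)\boxtimes\mathbb{C}_\lambda)$ and $J(j,\nu)=\mathrm{Ind}_{P'_0}^{G'_0}(\bigwedge^j(\mathbb{C}^{n-1})\boxtimes\mathbb{C}_\nu)$ (unnormalized, smooth), which are the restrictions of $I(i,\lambda)_\alpha$, $J(j,\nu)_\beta$ to $G_0$, $G'_0$. Elements of these representations are smooth sections of vector bundles over $G/P\simeq S^n$ and $G'/P'\simeq S^{n-1}=\{\omega\in S^n:\omega_n=0\}$. $\mathrm{Diff}_H(I,J)$ is the space of $H$-intertwining continuous linear maps $T:I\to J$ that are differential operators, i.e. $\mathrm{Supp}(Tf)\subset\mathrm{Supp}(f)$ for all $f$ (via $S^{n-1}\subset S^n$). *)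

(* Defs.v *)
From HB Require Import structures.
From mathcomp Require Import all_boot all_order all_algebra.
From mathcomp Require Import fingroup perm complex.
From mathcomp Require Import all_classical all_reals all_analysis.

Set Implicit Arguments.
Unset Strict Implicit.
Unset Printing Implicit Defensive.

Import Order.TTheory GRing.Theory Num.Theory.
Import numFieldNormedType.Exports.

Local Open Scope classical_set_scope.
Local Open Scope ring_scope.
Local Open Scope complex_scope.

(* i-fold tensors over C^m, in coordinates *)
Notation tensor R m i := {ffun {ffun 'I_i -> 'I_m} -> R[i]^o}.

(* [extpow R m i] is the i-th exterior power of C^m, realized as the space of
   alternating tensors. *)
Section ExteriorPower.
Variables (R : realType) (m i : nat).
Local Notation T := (tensor R m i).

Definition alternating : {pred T} := fun u =>
  [forall s : 'S_i, forall k : {ffun 'I_i -> 'I_m},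
     u [ffun a => k (s a)] == (-1) ^+ s * u k].

Lemma alternatingP (u : T) :
  reflect (forall (s : 'S_i) (k : {ffun 'I_i -> 'I_m}),
             u [ffun a => k (s a)] = (-1) ^+ s * u k)
          (u \in alternating).
Proof.
apply: (iffP forallP) => [h s k|h s]; first exact/eqP/(forallP (h s)).
by apply/forallP => k; apply/eqP.
Qed.

Lemma alternating_submod_closed : submod_closed alternating.
Proof.
split=> [|a u v /alternatingP hu /alternatingP hv].
  by apply/alternatingP => s k; rewrite !ffunE mulr0.
apply/alternatingP => s k; rewrite !ffunE hu hv mulrDr; congr (_ + _).
by rewrite /GRing.scale /= mulrCA.
Qed.

HB.instance Definition _ :=
  GRing.isSubmodClosed.Build _ _ alternating alternating_submod_closed.

Record extpow := Extpow {
  extpow_val :> T;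
  extpow_alt : extpow_val \in alternating }.

HB.instance Definition _ := [isSub for extpow_val].
HB.instance Definition _ := [Choice of extpow by <:].
HB.instance Definition _ := [SubChoice_isSubLmodule of extpow by <:].

Definition tensor_map (B : 'M[R]_m) (u : T) : T :=
  [ffun k : {ffun 'I_i -> 'I_m} => \sum_(l : {ffun 'I_i -> 'I_m})
               (\prod_(a < i) (B (k a) (l a))%:C) * u l].

Lemma tensor_map_alt B u :
  u \in alternating -> tensor_map B u \in alternating.
Proof.
move=> /alternatingP hu; apply/alternatingP => s k; rewrite !ffunE mulr_sumr.
pose h (l : {ffun 'I_i -> 'I_m}) := [ffun a => l (s a)].
pose h' (l : {ffun 'I_i -> 'I_m}) := [ffun a => l (s^-1%g a)].
have hK : cancel h h' by move=> l; apply/ffunP=> a; rewrite !ffunE permKV.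
have hK' : cancel h' h by move=> l; apply/ffunP=> a; rewrite !ffunE permK.
rewrite (reindex h) /=; last by exists h' => l _; [exact: hK|exact: hK'].
apply: eq_bigr => l _; rewrite hu mulrCA; congr (_ * (_ * _)).
rewrite [RHS](reindex_inj (@perm_inj _ s)) /=.
by apply: eq_bigr => a _; rewrite !ffunE.
Qed.

Definition extpow_map (B : 'M[R]_m) (u : extpow) : extpow :=
  Extpow (tensor_map_alt B (extpow_alt u)).

Lemma extpow_mapP B a (u v : extpow) :
  extpow_map B (a *: u + v) = a *: extpow_map B u + extpow_map B v.
Proof.
apply/val_inj/ffunP => k; rewrite !ffunE scaler_sumr -big_split /=.
by apply: eq_bigr => l _; rewrite !ffunE mulrDr /GRing.scale /= mulrCA.
Qed.

End ExteriorPower.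

Lemma near_eq_differentiable (R : numFieldType) (V W : normedModType R)
    (f g : V -> W) (x : V) :
  (\near x, f x = g x) -> differentiable f x -> differentiable g x.
Proof.
move=> fg df; have fgx : f x = g x by apply: nbhs_singleton fg.
have -> : g = f + (g - f) by rewrite addrC subrK.
apply: differentiableD => //.
have h0 : (g - f) \o shift x = cst ((g - f) x) + (\0 : {linear V -> W}) +o_ 0 id.
  apply/eqaddoP => e e0.
  have : \forall y \near (0 : V), f (y + x) = g (y + x).
    by move: fg; rewrite (near_shift 0) /= subr0.
  apply: filterS => y fgy /=.
  rewrite !fctE /= fgy fgx !subrr addr0 subr0 normr0.
  by rewrite mulr_ge0 // ltW.
have c0 : continuous ((\0 : {linear V -> W}) : V -> W) by exact: cst_continuous.
by apply/diff_locallyP; rewrite (diff_unique c0 h0).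
Qed.

Section Smooth.
Variables (R : realType) (N : nat).
Local Notation M := 'M[R]_N.+1.

Definition iter_deriv (vs : seq M) (F : M -> R) : M -> R :=
  foldr (fun v h x => 'D_v h x) F vs.

Definition smooth_on (U : set M) (F : M -> R) : Prop :=
  forall (vs : seq M) x, U x -> differentiable (iter_deriv vs F) x.

(* Smoothness on a submanifold [H]: locally the restriction of a smooth
   function on an open set of matrices. *)
Definition smooth_on_group (H : set M) (phi : M -> R) : Prop :=
  forall g, H g -> exists U, exists F : M -> R,
    [/\ open U, U g, smooth_on U F & forall h, U h -> H h -> F h = phi h].

Lemma iter_deriv_lin (U : set M) (F G : M -> R) (a b : R) vs :
  open U -> smooth_on U F -> smooth_on U G ->
  forall x, U x -> iter_deriv vs (a *: F + b *: G) x
                   = (a *: iter_deriv vs F + b *: iter_deriv vs G) x.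
Proof.
move=> oU sF sG; elim: vs => [//|v vs IH] x Ux.
have dF : derivable (iter_deriv vs F) x v
  by apply: diff_derivable; exact: sF.
have dG : derivable (iter_deriv vs G) x v
  by apply: diff_derivable; exact: sG.
have nU : \near x, iter_deriv vs (a *: F + b *: G) x
   = (a *: iter_deriv vs F + b *: iter_deriv vs G) x.
  by near=> y; apply: IH; near: y; exact: open_nbhs_nbhs.
rewrite /= (near_eq_derive _ nU) // deriveD; [|exact: derivableZ..].
by rewrite !deriveZ.
Unshelve. all: by end_near. Qed.

Lemma smooth_on_lin (U : set M) (F G : M -> R) (a b : R) :
  open U -> smooth_on U F -> smooth_on U G -> smooth_on U (a *: F + b *: G).
Proof.
move=> oU sF sG vs x Ux.
apply: (@near_eq_differentiable _ _ _ (a *: iter_deriv vs F + b *: iter_deriv vs G)).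
  near=> y; apply/esym/(iter_deriv_lin _ _ _ oU) => //.
  by near: y; exact: open_nbhs_nbhs.
by apply: differentiableD; apply: differentiableZ; [exact: sF|exact: sG].
Unshelve. all: by end_near. Qed.

Lemma smooth_on_sub (U V : set M) F : U `<=` V -> smooth_on V F -> smooth_on U F.
Proof. by move=> UV sF vs x /UV; exact: sF. Qed.

Lemma smooth_on_group_lin (H : set M) (phi psi : M -> R) (a b : R) :
  smooth_on_group H phi -> smooth_on_group H psi ->
  smooth_on_group H (a *: phi + b *: psi).
Proof.
move=> sp sq g Hg.
have [U [F [oU Ug sF FE]]] := sp g Hg.
have [V [G [oV Vg sG GE]]] := sq g Hg.
exists (U `&` V), (a *: F + b *: G); split => //; first exact: openI.
  by apply: smooth_on_lin; [exact: openI|apply: smooth_on_sub sF|apply: smooth_on_sub sG].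
by move=> h [Uh Vh] Hh; rewrite !fctE /= FE // GE.
Qed.

End Smooth.

Section Groups.
Variables (R : realType) (n : nat).
Local Notation M := 'M[R]_n.+2.

Definition basis_vec (p : 'I_n.+2) : 'cV[R]_n.+2 := delta_mx p ord0.

Definition qform (x : 'cV[R]_n.+2) : R :=
  (\sum_(p < n.+1) x (widen_ord (leqnSn n.+1) p) ord0 ^+ 2)
  - x ord_max ord0 ^+ 2.

(* G = O(n+1,1) *)
Definition lorentz : set M := [set g | forall x, qform (g *m x) = qform x].

(* G' = O(n,1), the stabilizer of e_n *)
Definition lorentz_stab : set M :=
  [set g | lorentz g /\ g *m basis_vec (inord n) = basis_vec (inord n)].

(* G_0 = SO_0(n+1,1) and G_0' = SO_0(n,1) *)
Definition lorentz0 : set M := connected_component lorentz 1%:M.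
Definition lorentz_stab0 : set M := connected_component lorentz_stab 1%:M.

Definition expm (X : M) : M :=
  lim (series (fun k => (k`!%:R)^-1 *: X ^+ k) @ \oo).

Definition lie (H : set M) : set M := [set X | forall t : R, H (expm (t *: X))].

Definition H0 : M := delta_mx ord0 ord_max + delta_mx ord_max ord0.

Definition n_plus : set M :=
  [set X | lie lorentz X /\ H0 *m X - X *m H0 = X].

(* diag(b, B, b) *)
Definition diag3 (b : R) (B : 'M[R]_n) : M :=
  let mid (k : 'I_n) : 'I_n.+2 := lift ord0 (widen_ord (leqnSn n) k) in
  b *: (delta_mx ord0 ord0 + delta_mx ord_max ord_max)
  + \sum_(k < n) \sum_(l < n) B k l *: delta_mx (mid k) (mid l).

(* The upper left block B' of B, so that B = diag(B', 1) when diag(b, B, b)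
   fixes e_n. *)
Definition lead (B : 'M[R]_n) : 'M[R]_n.-1 :=
  mxsub (widen_ord (leq_pred n)) (widen_ord (leq_pred n)) B.

(* G / P -> S^n, gP |-> omega, where g maps the line spanned by
   e_0 + e_(n+1) to the line spanned by (omega, 1) *)
Definition sphere_pt (g : M) : 'rV[R]_n.+1 :=
  let x := g *m (basis_vec ord0 + basis_vec ord_max) in
  \row_(p < n.+1) (x (widen_ord (leqnSn n.+1) p) ord0 / x ord_max ord0).

End Groups.

Definition cexp (R : realType) (z : R[i]) : R[i] :=
  (expR (complex.Re z) * cos (complex.Im z))
  +i* (expR (complex.Re z) * sin (complex.Im z)).

Section PrincipalSeries.
Variables (R : realType) (n : nat).
Local Notation M := 'M[R]_n.+2.
Variables (H : set M) (m : nat) (r : 'M[R]_n -> 'M[R]_m).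
Variables (i : nat) (lam : R[i]) (alpha : 'Z_2).
Local Notation V := (extpow R m i).

Definition real_coord (f : M -> V) (s : {ffun 'I_i -> 'I_m}) (c : bool) : M -> R :=
  fun g => if c then complex.Re (extpow_val (f g) s)
           else complex.Im (extpow_val (f g) s).

(* diag(b, B, b) e^(t H0) |-> b^alpha e^(lam t) (i-th exterior power of B) *)
Definition sigma (b : R) (B : 'M[R]_m) (t : R) (v : V) : V :=
  ((b%:C) ^+ alpha * cexp (lam * t%:C)) *: extpow_map B v.

(* Functions on [H] are encoded as functions on matrices vanishing outside
   [H]. The elements of P are the man with m = diag(b, B, b), a = e^(t H0) and
   n = e^X, X in n_+; such an element acts on the fibre through [r B] (the
   matrix B itself for G, its block [lead B] for G'), and sigma(man)^-1 is
   sigma at (b^-1, (r B)^-1, -t). *)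
Definition is_section (f : M -> V) : Prop :=
  [/\ forall g, ~ H g -> f g = 0,
      forall s c, smooth_on_group H (real_coord f s c)
    & forall (g : M) (b : R) (B : 'M[R]_n) (t : R) (X : M), H g ->
        b = 1 \/ b = -1 -> B *m B^T = 1%:M -> n_plus X ->
        let p := diag3 b B *m expm (t *: H0 R n) *m expm X in
        H p -> f (g *m p) = sigma b^-1 (invmx (r B)) (- t) (f g)].

Definition sections : {pred M -> V} := mem [set f | is_section f].

Lemma real_coord_lin a f g s c :
  real_coord (a *: f + g) s c =
  if c then (complex.Re a *: real_coord f s true
             + - complex.Im a *: real_coord f s false)
            + 1 *: real_coord g s true
  else (complex.Re a *: real_coord f s false
        + complex.Im a *: real_coord f s true)
       + 1 *: real_coord g s false.
Proof.
apply/funext => x; case: c.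
- rewrite -[RHS]/(complex.Re a * complex.Re (f x s)
    + - complex.Im a * complex.Im (f x s) + 1 * complex.Re (g x s)).
  rewrite /real_coord !ffunE /=; case: (extpow_val (f x) s) => p q.
  case: (extpow_val (g x) s) => p' q'; case: a => u v.
  by rewrite -[LHS]/(u * p - v * q + p') /= mul1r mulNr.
- rewrite -[RHS]/(complex.Re a * complex.Im (f x s)
    + complex.Im a * complex.Re (f x s) + 1 * complex.Im (g x s)).
  rewrite /real_coord !ffunE /=; case: (extpow_val (f x) s) => p q.
  case: (extpow_val (g x) s) => p' q'; case: a => u v.
  by rewrite -[LHS]/(u * q + v * p + q') /= mul1r.
Qed.

Lemma sigma_lin b B t a u v :
  sigma b B t (a *: u + v) = a *: sigma b B t u + sigma b B t v.
Proof.
by rewrite /sigma extpow_mapP scalerDr !scalerA mulrC.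
Qed.

Lemma sections_submod_closed : submod_closed sections.
Proof.
have s0 : is_section 0.
  split => [//|s c|g b B t X *].
    have -> : real_coord 0 s c = fun=> 0 :> R.
      by apply/funext => g; rewrite /real_coord !ffunE; case: c.
    move=> g Hg; exists setT, (fun=> 0); split => //; first exact: openT.
    have D0 vs : iter_deriv vs (fun=> 0) = (fun=> 0) :> (M -> R).
      elim: vs => [//|v vs IH] /=; rewrite IH; apply/funext => x.
      exact: derive_cst.
    by move=> vs x _; rewrite D0; exact: differentiable_cst.
  by have := sigma_lin b^-1 (invmx (r B)) (- t) (-1) 0 0;
    rewrite scaler0 addr0 scaleN1r addNr.
split=> [|a f g]; rewrite !inE //= => -[f0 fs fe] [g0 gs ge].
split => [x Hx|s c|x b B t X Hx hb hB hX p Hp].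
- by rewrite -[LHS]/(a *: f x + g x) f0 // g0 // scaler0 addr0.
- by rewrite real_coord_lin; case: c;
    rewrite -[X in X + _]scale1r; apply: smooth_on_group_lin => //;
    exact: smooth_on_group_lin.
- rewrite -[LHS]/(a *: f (x *m p) + g (x *m p)) fe // ge //.
  by rewrite -sigma_lin.
Qed.

HB.instance Definition _ :=
  GRing.isSubmodClosed.Build _ _ sections sections_submod_closed.

Record principal_series := PrincipalSeries {
  ps_fun :> M -> V;
  ps_sec : ps_fun \in sections }.

HB.instance Definition _ := [isSub for ps_fun].
HB.instance Definition _ := [Choice of principal_series by <:].
HB.instance Definition _ := [SubChoice_isSubLmodule of principal_series by <:].

Definition translate (x : M) (f : M -> V) : M -> V := fun g => f (invmx x *m g).

Definition supp (f : M -> V) : set 'rV[R]_n.+1 :=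
  closure [set sphere_pt g | g in [set g | f g <> 0]].

(* X_1 ... X_k phi, for X_j the left invariant vector fields *)
Definition lie_deriv (Xs : seq M) (phi : M -> R) : M -> R :=
  foldr (fun X h g => 'D_1 (fun t : R => h (g *m expm (t *: X))) 0) phi Xs.

(* The basic neighbourhoods of 0 for the topology of C^oo(H, V): uniform
   convergence on compact sets of all derivatives. *)
Definition near0 (K : set M) (Xss : seq (seq M)) (e : R) (f : M -> V) : Prop :=
  forall g Xs s c, K g -> Xs \in Xss -> `|lie_deriv Xs (real_coord f s c) g| < e.

Definition seminorm_index (K : set M) (Xss : seq (seq M)) : Prop :=
  [/\ compact K, K `<=` H
    & forall (Xs : seq M) (X : M), Xs \in Xss -> X \in Xs -> lie H X].

End PrincipalSeries.

Arguments lorentz {R} n.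
Arguments lorentz_stab {R} n.
Arguments lorentz0 {R} n.
Arguments lorentz_stab0 {R} n.

Section Operators.
Variables (R : realType) (n : nat).
Local Notation M := 'M[R]_n.+2.
Variables (H1 : set M) (m1 : nat) (r1 : 'M[R]_n -> 'M[R]_m1).
Variables (i1 : nat) (lam1 : R[i]) (alpha1 : 'Z_2).
Variables (H2 : set M) (m2 : nat) (r2 : 'M[R]_n -> 'M[R]_m2).
Variables (i2 : nat) (lam2 : R[i]) (alpha2 : 'Z_2).
Local Notation I := (principal_series H1 r1 i1 lam1 alpha1).
Local Notation J := (principal_series H2 r2 i2 lam2 alpha2).

(* for linear [T], continuity at 0 *)
Definition continuous_op (T : I -> J) : Prop :=
  forall K Xss (e : R), seminorm_index H2 K Xss -> 0 < e ->
  exists K' Xss' (d : R), [/\ seminorm_index H1 K' Xss', 0 < d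
    & forall f : I, near0 K' Xss' d f -> near0 K Xss e (T f)].

(* [f'] is the left translate x.f *)
Definition equivariant (H : set M) (T : I -> J) : Prop :=
  forall x, H x -> forall f f' : I,
    ps_fun f' = translate x f -> ps_fun (T f') = translate x (T f).

Definition intertwining (H : set M) (T : I -> J) : Prop :=
  [/\ linear T, equivariant H T & continuous_op T].

(* Diff_H(I, J) *)
Definition diff_ops (H : set M) : set (I -> J) :=
  [set T | intertwining H T /\ forall f : I, supp (T f) `<=` supp f].

End Operators.

Arguments diff_ops {R n H1 m1 r1 i1 lam1 alpha1 H2 m2 r2 i2 lam2 alpha2} H.

(* mutually inverse isomorphisms of H-representations *)
Definition rep_iso (R : realType) (n : nat) (H : set 'M[R]_n.+2)
    (H1 : set 'M[R]_n.+2) m1 (r1 : 'M[R]_n -> 'M[R]_m1) i1 lam1 alpha1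
    (H2 : set 'M[R]_n.+2) m2 (r2 : 'M[R]_n -> 'M[R]_m2) i2 lam2 alpha2
    (S : principal_series H1 r1 i1 lam1 alpha1 ->
         principal_series H2 r2 i2 lam2 alpha2) S' : Prop :=
  [/\ intertwining H S, intertwining H S', cancel S S' & cancel S' S].

(* [Phi] restricts to a linear isomorphism of the subspace [A] onto [B] *)
Definition lin_bij (K : pzRingType) (U V : lmodType K) (A : set U) (B : set V)
    (Phi : U -> V) : Prop :=
  set_bij A B Phi /\
  forall a x y, A x -> A y -> Phi (a *: x + y) = a *: Phi x + Phi y.

Definition lin_iso (K : pzRingType) (U V : lmodType K) (A : set U) (B : set V) :=
  exists Phi : U -> V, lin_bij A B Phi.

Section Representations.
Variables (R : realType) (n i : nat) (lam : R[i]).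

(* I(i, lam)_alpha and J(i, lam)_alpha *)
Definition I_ (alpha : 'Z_2) : Type := principal_series (lorentz n) id i lam alpha.
Definition J_ (alpha : 'Z_2) : Type :=
  principal_series (lorentz_stab n) (@lead R n) i lam alpha.

(* I(i, lam) and J(i, lam): as b = 1 on P_0 and P_0', the parity is
   irrelevant and set to 0 *)
Definition I0 : Type := principal_series (lorentz0 n) id i lam 0.
Definition J0 : Type := principal_series (lorentz_stab0 n) (@lead R n) i lam 0.

End Representations.

Arguments I_ {R} n i lam alpha.
Arguments J_ {R} n i lam alpha.
Arguments I0 {R} n i lam.
Arguments J0 {R} n i lam.

(* Diff_(SO_0(n,1))(I(i, lam), J(j, nu)) *)
Definition Diff_SO0 (R : realType) n i (lam : R[i]) j (nu : R[i])
  : set (I0 n i lam -> J0 n j nu) := diff_ops (lorentz_stab0 n).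

(* Diff_(O(n,1))(I(i, lam)_alpha, J(j, nu)_beta) *)
Definition Diff_O (R : realType) n i (lam : R[i]) alpha j (nu : R[i]) beta
  : set (I_ n i lam alpha -> J_ n j nu beta) := diff_ops (lorentz_stab n).

Arguments Diff_SO0 {R} n i lam j nu _.
Arguments Diff_O {R} n i lam alpha j nu beta _.

(* Main.v *)
Require Import Defs.
From HB Require Import structures.
From mathcomp Require Import all_boot all_order all_algebra.
From mathcomp Require Import fingroup perm complex.
From mathcomp Require Import all_classical all_reals all_analysis.
From mathcomp Require Import ring lra.

(** Why the theorem holds.

    The bijections. For an orthogonal matrix B the Hodge star satisfies
    star (B u) = det B * B (star u) [star_map]. Hence (S f) g = det g * star (f g)
    maps sections for i to sections for n - i, and S (x f) = det x * x (S f) for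
    every x in the group [twist_exists, twisted_translate]. On the identity
    components det x = 1, so S is an isomorphism of representations, and so is
    its analogue for the subgroup; composing with them gives all the bijections
    [star_bijections].

    The passage to the full groups. O(n+1,1) and O(n,1) have four components,
    each with a representative in M [component_sign]. As the representatives
    belong to P, a section over the identity component extends uniquely to the
    whole group once the parity is chosen, and extension is inverse to
    restriction [ext_exists, res_ext, ext_res]. Therefore Diff_SO0 is the space
    of differential operators T from I(i,lam)_alpha to J(j,nu)_beta which commute
    with the identity component of O(n,1).

    The natural number nu - lam. Let L f be a coordinate of T f at the base
    point. By locality L f depends on f near the base point only [value_cut], so
    one may cut f off to the big cell N_- P, a copy of R^n on which M A acts by
    dilations and rotations. The family f_s (g) = chi (g) f (s . g), with s the
    dilation and chi the cutoff, is smooth in s and g, through s = 0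
    [smooth_contraction], and for s = b e^t with b = 1 or -1 it is, up to the
    scalar b^alpha e^(- lam t) and a cutoff, the translate of f by
    diag (b, 1, b) e^(t H0) [dilate_translate]. Since T commutes with A, this
    gives L f_s = s^(nu - lam) L f for s > 0. But L is continuous and f_s is
    smooth at s = 0, so L f_s has a Taylor expansion there, and nu - lam has to
    be a natural number k unless L = 0 [value_nat]. The expansion is used through
    finite difference operators which annihilate polynomials [iter_diff_taylor,
    family_taylor].

    The parity. If nu - lam = k, then L f_s is a multiple of s^k on both sides of
    0; comparing s with -s shows how L changes under m = diag (-1, 1, ..., 1, -1),
    and the result is that T commutes with m when beta = alpha + k
    [value_parity, diff_op_parity].

    The decomposition. O(n,1) is generated by its identity component, by m, and
    by a reflection rho of determinant -1. So the operators T as above are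
    O(n,1)-intertwining if and only if they commute with rho [diff_ops_full]. In
    general T is the sum of an operator that commutes and one that anticommutes
    with rho. As S anticommutes with rho as well, the second one corresponds to
    an intertwining operator on I(n - i,lam)_alpha [Diff_SO0_decomposition].
    Composing this operator with star operators on both sides gives the last
    isomorphism [Diff_O_star_bijection]. *)

Set Implicit Arguments.
Unset Strict Implicit.
Unset Printing Implicit Defensive.

Import Order.TTheory GRing.Theory Num.Theory.
Import numFieldNormedType.Exports.

Local Open Scope classical_set_scope.
Local Open Scope ring_scope.
Local Open Scope complex_scope.

(** * The matrix exponential *)

Section MatrixLimits.
Variable R : realType.

Lemma cvg_mx T (F : set_system T) {FF : Filter F} m n (u : T -> 'M[R]_(m, n)) (L : 'M[R]_(m, n)) :
  (forall i j, u x i j @[x --> F] --> L i j) -> u @ F --> L.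
Proof.
move=> h A [P PL PA]; apply: filterS PA _.
apply: filter_forall => i; apply: filter_forall => j.
exact: h i j _ (PL i j).
Qed.

Lemma cvg_mx_coord T (F : set_system T) {FF : Filter F} m n (u : T -> 'M[R]_(m, n)) (L : 'M[R]_(m, n)) i j :
  u @ F --> L -> u x i j @[x --> F] --> L i j.
Proof.
move=> h; apply: (cvg_comp u (fun M : 'M[R]_(m, n) => M i j) h).
exact: coord_continuous.
Qed.

Lemma cvg_mulmx T (F : set_system T) {FF : Filter F} m n p
    (u : T -> 'M[R]_(m, n)) (v : T -> 'M[R]_(n, p)) (L : 'M[R]_(m, n)) (K : 'M[R]_(n, p)) :
  u @ F --> L -> v @ F --> K -> u x *m v x @[x --> F] --> L *m K.
Proof.
move=> uL vK; apply: cvg_mx => i j; rewrite mxE.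
under eq_fun do rewrite mxE.
apply: cvg_big => [|k _]; first exact: add_continuous.
by apply: cvgM; exact: cvg_mx_coord.
Qed.

End MatrixLimits.

Section Expm.
Variables (R : realType) (n : nat).
Local Notation M := 'M[R]_n.+2.
Implicit Types (X Y : M) (t : R).

Let expm_seq X : nat -> M := series (fun k => (k`!%:R)^-1 *: X ^+ k).

(* Bounds of this form pass to the coefficients of the derived series, so the
   entries can be differentiated term by term. *)
Let exp_bounded (c : R^nat) := exists D K : R, forall k, `|c k| <= D * K ^+ k / k`!%:R.

Let exp_bounded_cvg c t : exp_bounded c -> cvgn (pseries c t).
Proof.
move=> [D [K h]]; apply: normed_cvg => /=.
apply: (@series_le_cvg _ _ (fun k => D * exp_coeff (K * `|t|) k)).
- by move=> k; exact: normr_ge0.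
- move=> k; rewrite /exp_coeff /= exprMn mulrAC mulrA mulr_ge0 ?exprn_ge0 //.
  by rewrite mulrA (le_trans (normr_ge0 _) (h k)).
- move=> k; rewrite [leLHS]/= normrM normrX /exp_coeff /= exprMn.
  have := ler_wpM2r (exprn_ge0 k (normr_ge0 t)) (h k).
  by rewrite -!mulrA (mulrC (k`!%:R^-1)).
- have -> : series (fun k => D * exp_coeff (K * `|t|) k)
     = D *: series (exp_coeff (K * `|t|)).
    by apply/funext => k; rewrite -[RHS]/(D * \sum_(0 <= l < k) exp_coeff (K * `|t|) l) mulr_sumr.
  by apply: is_cvgZr; exact: is_cvg_series_exp_coeff.
Qed.

Let exp_bounded_diffs c : exp_bounded c -> exp_bounded (pseries_diffs c).
Proof.
move=> [D [K h]]; exists (D * K), K => k.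
rewrite /pseries_diffs normrM ger0_norm //.
apply: (le_trans (ler_wpM2l _ (h k.+1))) => //.
rewrite factS natrM exprS invfM.
rewrite [leLHS](_ : _ = D * K * K ^+ k / k`!%:R) //.
have k0 : (k.+1%:R : R) != 0 by [].
have f0 : (k`!%:R : R) != 0 by rewrite pnatr_eq0 -lt0n fact_gt0.
by rewrite -nat1r in k0 *; field; rewrite k0 f0.
Qed.

Let coef X p q : R^nat := fun k => (k`!%:R)^-1 * (X ^+ k) p q.

Let coef_bounded X p q : exp_bounded (coef X p q).
Proof.
exists 1, (n.+2%:R * `|X|) => k; rewrite mul1r /coef normrM mulrC.
rewrite (@ger0_norm _ (k`!%:R^-1)) ?invr_ge0 //.
apply: ler_wpM2r; first by rewrite invr_ge0.
elim: k p q => [|k IH] p q.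
  by rewrite !expr0 mxE; case: (p == q); rewrite ?normr1 ?normr0.
rewrite exprS mxE (le_trans (ler_norm_sum _ _ _)) //.
rewrite exprS; set c : R := _ ^+ k in IH; rewrite -/c.
have -> : n.+2%:R * `|X| * c = \sum_(l < n.+2) `|X| * c.
  by rewrite sumr_const card_ord -mulrA mulr_natl.
apply: ler_sum => l _; rewrite normrM; apply: ler_pM => //.
by rewrite [leRHS]/Num.Def.normr /= mx_normrE; exact: (le_bigmax _ _ (p, l)).
Qed.

Let expm_seq_entry X t k p q :
  expm_seq (t *: X) k p q = pseries (coef X p q) t k.
Proof.
rewrite /expm_seq /pseries /series /= summxE; apply: eq_bigr => i _.
by rewrite mxE exprZn mxE /coef mulrCA mulrC.
Qed.

(** Entrywise the partial sums are those of a power series whose coefficients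
    are bounded by K ^ k / k!, for K the size of the matrix times its norm. *)
Lemma expm_cvg X : expm_seq X @ \oo --> expm X.
Proof.
suff : exists L : M, expm_seq X @ \oo --> L by move=> h; apply/cvg_ex.
exists (\matrix_(p, q) limn (pseries (coef X p q) 1)).
apply: cvg_mx => p q; rewrite mxE -[X in expm_seq X]scale1r.
under eq_fun do rewrite expm_seq_entry.
exact: exp_bounded_cvg (coef_bounded _ _ _).
Qed.

Lemma expm_lim X L : expm_seq X @ \oo --> L -> expm X = L.
Proof. by move=> h; apply: (cvg_unique _ (@expm_cvg X) h). Qed.

Let expm_entry X t p q : expm (t *: X) p q = limn (pseries (coef X p q) t).
Proof.
apply/esym/cvg_lim => //.
have h : expm_seq (t *: X) k p q @[k --> \oo] --> expm (t *: X) p q.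
  by apply: cvg_mx_coord; exact: expm_cvg.
have -> // : pseries (coef X p q) t = fun k => expm_seq (t *: X) k p q.
by apply/funext => k; rewrite expm_seq_entry.
Qed.

Lemma derivable_expm X t : derivable (fun t => expm (t *: X)) t 1.
Proof.
apply/derivable_mxP => p q; under eq_fun do rewrite expm_entry.
have cb := coef_bounded X p q; apply: ex_derive.
apply: (pseries_snd_diffs (K := `|t| + 1)); last first.
  by rewrite [ltRHS]ger0_norm ?addr_ge0 // ltrDl.
all: by apply: exp_bounded_cvg; do ?apply: exp_bounded_diffs.
Qed.

Let limn_pseries0 (c : R^nat) : limn (pseries c 0) = c 0%N.
Proof.
apply: lim_near_cst => //; near=> k.
have -> : k = k.-1.+1 by rewrite prednK //; near: k; exact: nbhs_infty_gt.
rewrite /pseries /series /= big_nat_recl // expr0 mulr1 big1 ?addr0 // => i _.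
by rewrite expr0n mulr0.
Unshelve. all: by end_near. Qed.

Lemma expm0 : expm (0 : M) = 1%:M.
Proof.
apply/matrixP => p q; rewrite -(scale0r 0) expm_entry limn_pseries0.
by rewrite /coef fact0 invr1 mul1r expr0.
Qed.

Lemma derive_expm0 X : 'D_1 (fun t => expm (t *: X)) 0 = X.
Proof.
rewrite derive_mx; last exact: derivable_expm.
apply/matrixP => p q; rewrite mxE.
under eq_fun do rewrite expm_entry.
have cb := coef_bounded X p q.
have H : is_derive 0 (1 : R) (fun t => limn (pseries (coef X p q) t))
     (limn (pseries (pseries_diffs (coef X p q)) 0)).
  apply: (pseries_snd_diffs (K := 1)); last by rewrite normr0 normr1.
  - exact: exp_bounded_cvg.
  - by apply: exp_bounded_cvg; exact: exp_bounded_diffs.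
  - by apply: exp_bounded_cvg; do 2 apply: exp_bounded_diffs.
by rewrite derive_val limn_pseries0 /pseries_diffs /coef (_ : 1`! = 1)%N // invr1 !mul1r.
Qed.

Lemma continuous_expm X : continuous (fun t => expm (t *: X)).
Proof.
by move=> t; apply/differentiable_continuous/derivable1_diffP/derivable_expm.
Qed.

Lemma expm_conj (g h : M) X : g *m h = 1%:M ->
  expm (g *m X *m h) = g *m expm X *m h.
Proof.
move=> gh; apply: expm_lim.
have -> : expm_seq (g *m X *m h) = fun k => g *m expm_seq X k *m h.
  apply/funext => k; rewrite /expm_seq /series /= mulmx_sumr mulmx_suml.
  apply: eq_bigr => i _; rewrite -scalemxAr -scalemxAl; congr (_ *: _).
  elim: i => [|i IH]; first by rewrite !expr0 mulmx1.
  rewrite !exprS IH -[LHS]/(g *m X *m h *m (g *m X ^+ i *m h)).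
  rewrite -[X * X ^+ i]/(X *m X ^+ i) -!mulmxA (mulmxA h) (mulmx1C gh) mul1mx.
  by [].
apply: cvg_mulmx; last exact: cvg_cst.
by apply: cvg_mulmx; [exact: cvg_cst|exact: expm_cvg].
Qed.

(** With a matrix v instead of a vector: v is then a family of eigenvectors for
    a common eigenvalue, such as the whole middle block below. *)
Lemma expm_eigen m X c (v : 'M[R]_(n.+2, m)) :
  X *m v = c *: v -> expm X *m v = expR c *: v.
Proof.
move=> Xv; have h : expm_seq X k *m v @[k --> \oo] --> expm X *m v.
  by apply: cvg_mulmx; [exact: expm_cvg|exact: cvg_cst].
apply: (cvg_unique _ h) => //.
have -> : (fun k => expm_seq X k *m v) = fun k => series (exp_coeff c) k *: v.
  apply/funext => k; rewrite /expm_seq /series /= mulmx_suml scaler_suml.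
  apply: eq_bigr => i _; rewrite -scalemxAl /exp_coeff /= mulrC -scalerA.
  congr (_ *: _); elim: i => [|i IH]; first by rewrite !expr0 mul1mx scale1r.
  by rewrite exprSr -[X ^+ i * X]/(X ^+ i *m X) -mulmxA Xv -scalemxAr IH scalerA exprS.
by apply: cvgZl; exact: is_cvg_series_exp_coeff.
Qed.

(** Elements of n_+ have this property, and their exponentials are computed with it. *)
Lemma expm_cube0 X : X *m X *m X = 0 -> expm X = 1%:M + X + 2^-1 *: (X *m X).
Proof.
move=> X3; apply: expm_lim; apply: cvg_near_cst; near=> k.
have k3 : (3 <= k)%N by near: k; exact: nbhs_infty_ge.
rewrite -(subnK k3) addn3.
rewrite /expm_seq /series /= !big_nat_recl // big1 ?addr0 => [|i _].
  rewrite expr0 expr1 expr2 !fact0 /= invr1 !scale1r addrA.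
  by rewrite (_ : 2`! = 2)%N.
have X3' : X ^+ 3 = 0 by rewrite exprSr expr2; exact: X3.
by rewrite -addn3 exprD X3' mulr0 scaler0.
Unshelve. all: by end_near. Qed.

End Expm.

(** * Smooth functions on normed spaces *)

Section Smoothness.
Variable R : realType.
Implicit Types V W : normedModType R.

(** The notion of smoothness on an open set of matrices, over an arbitrary
    normed space: below it is applied to R * M, where the real parameter of a
    family of functions on the group is a variable among others. *)
Definition smooth V (U : set V) (F : V -> R) : Prop :=
  forall (vs : seq V) x, U x ->
    differentiable (foldr (fun v h x => 'D_v h x) F vs) x.

(** Smoothness is the conjunction of all these conditions, and they are the form
    in which products and composites are treated by induction on the order. *)
Fixpoint Ck (k : nat) V (U : set V) (F : V -> R) : Prop :=
  if k is k'.+1 then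
    (forall x, U x -> differentiable F x) /\ (forall v, Ck k' U (fun x => 'D_v F x))
  else forall x, U x -> differentiable F x.

Lemma Ck_diff k V (U : set V) F x : Ck k U F -> U x -> differentiable F x.
Proof. by case: k => [h|k [h _]]; exact: h. Qed.

Lemma CkS k V (U : set V) F : Ck k.+1 U F -> Ck k U F.
Proof.
elim: k F => [|k IH] F; first by case.
by move=> [h hD]; split=> // v; apply: IH; exact: hD.
Qed.

Lemma smoothP V (U : set V) F : smooth U F <-> forall k, Ck k U F.
Proof.
split=> [h k|h vs].
  elim: k F h => [|k IH] F h; first exact: (h [::]).
  split=> [|v]; first exact: (h [::]).
  by apply: IH => vs x Ux; have := h (rcons vs v) x Ux; rewrite foldr_rcons.
elim/last_ind: vs F h => [|vs v IH] F h x Ux; first exact: Ck_diff (h 0%N) Ux.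
by rewrite foldr_rcons; apply: IH => // k; exact: (h k.+1).2.
Qed.

Lemma near_open V (U : set V) (P : V -> Prop) x :
  open U -> U x -> (forall y, U y -> P y) -> \near x, P x.
Proof.
by move=> oU Ux h; apply: filterS (h) _; exact: open_nbhs_nbhs.
Qed.

Lemma Ck_ext k V (U : set V) F G : open U -> (forall x, U x -> F x = G x) ->
  Ck k U F -> Ck k U G.
Proof.
move=> oU; elim: k F G => [|k IH] F G FG.
  by move=> h x Ux; apply: near_eq_differentiable (h x Ux); apply: (near_open oU).
move=> [h hD]; split=> [x Ux|v].
  by apply: near_eq_differentiable (h x Ux); apply: (near_open oU).
apply: IH (hD v) => x Ux.
by apply: near_eq_derive; apply: (near_open oU).
Qed.

Lemma Ck_cst k V (U : set V) (c : R) : Ck k U (fun=> c).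
Proof.
elim: k c => [|k IH] c; first by move=> x _; exact: differentiable_cst.
split=> [x _|v]; first exact: differentiable_cst.
have -> : (fun x => 'D_v (fun=> c) x) = fun=> 0 :> R by apply/funext => x; exact: derive_cst.
exact: IH.
Qed.

Lemma Ck_add k V (U : set V) F G : open U ->
  Ck k U F -> Ck k U G -> Ck k U (fun x => F x + G x).
Proof.
move=> oU; elim: k F G => [|k IH] F G.
  by move=> hF hG x Ux; apply: differentiableD; [exact: hF|exact: hG].
move=> [hF hDF] [hG hDG]; split=> [x Ux|v].
  by apply: differentiableD; [exact: hF|exact: hG].
apply: Ck_ext (IH _ _ (hDF v) (hDG v)) => // x Ux.
  by rewrite [RHS]deriveD //; apply: diff_derivable; [exact: hF|exact: hG].
Qed.

Lemma Ck_mul k V (U : set V) F G : open U ->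
  Ck k U F -> Ck k U G -> Ck k U (fun x => F x * G x).
Proof.
move=> oU; elim: k F G => [|k IH] F G cF cG.
  by move=> x Ux; apply: differentiableM; [exact: cF|exact: cG].
move: (cF) (cG) => [hF hDF] [hG hDG]; split=> [x Ux|v].
  by apply: differentiableM; [exact: hF|exact: hG].
apply: (@Ck_ext _ _ _ (fun x => F x * 'D_v G x + G x * 'D_v F x)) => // [x Ux|].
    by rewrite [RHS]deriveM //; apply: diff_derivable; [exact: hF|exact: hG].
  by apply: Ck_add => //; apply: IH; [exact: CkS cF|exact: hDG|exact: CkS cG|exact: hDF].
Qed.

Lemma Ck_sum k V (U : set V) I (r : seq I) (F : I -> V -> R) : open U ->
  (forall i, Ck k U (F i)) -> Ck k U (fun x => \sum_(i <- r) F i x).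
Proof.
move=> oU h; elim: r => [|i r IH].
  by under eq_fun do rewrite big_nil; exact: Ck_cst.
by under eq_fun do rewrite big_cons; exact: Ck_add.
Qed.

(** The derivative - F' / F ^ 2 involves 1 / F itself only to the previous order. *)
Lemma Ck_inv k V (U : set V) F : open U -> (forall x, U x -> F x != 0) ->
  Ck k U F -> Ck k U (fun x => (F x)^-1).
Proof.
move=> oU F0; elim: k => [|k IH] cF.
  by move=> x Ux; apply: differentiableV; [exact: cF|exact: F0].
move: (cF) => [hF hDF]; split=> [x Ux|v].
  by apply: differentiableV; [exact: hF|exact: F0].
have cI := IH (CkS cF); apply: (@Ck_ext _ _ _ (fun x => -1 * ((F x)^-1 * (F x)^-1) * 'D_v F x)) => // [x Ux|].
    rewrite deriveV ?F0 //; last by apply: diff_derivable; exact: hF.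
    by rewrite -[RHS]/(_ * _) mulN1r -invfM -expr2.
apply: Ck_mul => //; last exact: hDF.
by apply: Ck_mul => //; [exact: Ck_cst|exact: Ck_mul].
Qed.

(** The chain rule for an inner function given by coordinates with respect to
    finitely many vectors: its derivatives are then scalar functions, to which
    the induction on the order of differentiability applies again. *)
Lemma derive_comp_basis V W (I : finType) (w : I -> W) (e : I -> V -> R)
    (F : W -> R) x v :
  (forall i, differentiable (e i) x) ->
  differentiable F (\sum_i e i x *: w i) ->
  differentiable (fun y => F (\sum_i e i y *: w i)) x /\
  'D_v (fun y => F (\sum_i e i y *: w i)) x =
    \sum_i 'D_v (e i) x * 'D_(w i) F (\sum_j e j x *: w j).
Proof.
move=> de dF; set E := fun y => \sum_i e i y *: w i.
have dE : is_diff x E (fun v => \sum_i 'd (e i) x v *: w i).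
  rewrite /E; elim: (index_enum I) => [|i r IH].
    under eq_fun do rewrite big_nil; apply: is_diff_eq.
    by apply/funext => y; rewrite big_nil.
  under eq_fun do rewrite big_cons.
  apply: (@is_diff_eq _ _ _ _ (fun v => 'd (e i) x v *: w i + \sum_(j <- r) 'd (e j) x v *: w j)); last first.
    by apply/funext => y; rewrite big_cons.
  apply: is_diffD; apply: DiffDef; first exact: differentiableZl.
  by rewrite diffZl.
have dFE : differentiable (F \o E) x by apply: differentiable_comp => //; exact: ex_diff.
split=> //; rewrite -[LHS]/('D_v (F \o E) x) deriveE // diff_comp //=.
rewrite diff_val /= linear_sum; apply: eq_bigr => i _.
by rewrite linearZ /= !deriveE.
Qed.

Lemma Ck_comp k V W (U : set V) (U' : set W) (I : finType) (w : I -> W)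
    (e : I -> V -> R) (F : W -> R) : open U ->
  (forall x, U x -> U' (\sum_i e i x *: w i)) ->
  (forall i, Ck k U (e i)) -> Ck k U' F ->
  Ck k U (fun x => F (\sum_i e i x *: w i)).
Proof.
move=> oU UU'; elim: k e F UU' => [|k IH] e F UU' ce cF.
  move=> x Ux; apply: (derive_comp_basis 0 _ _).1; first by move=> i; exact: ce.
  by apply: cF; exact: UU'.
split=> [x Ux|v].
  apply: (derive_comp_basis 0 _ _).1; first by move=> i; exact: Ck_diff (ce i) Ux.
  by apply: (Ck_diff cF); exact: UU'.
apply: (@Ck_ext _ _ _ (fun x => \sum_i 'D_v (e i) x * 'D_(w i) F (\sum_j e j x *: w j))) => //.
    move=> x Ux; apply/esym/(derive_comp_basis v _ _).2.
      by move=> i; exact: Ck_diff (ce i) Ux.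
    by apply: (Ck_diff cF); exact: UU'.
  apply: Ck_sum => // i; apply: Ck_mul => //; first exact: (ce i).2.
  apply: (IH e (fun y => 'D_(w i) F y)) => //; first by move=> j; exact: CkS.
  exact: cF.2.
Qed.

Lemma smooth_diff V (U : set V) F x : smooth U F -> U x -> differentiable F x.
Proof. by move=> h; exact: (h [::]). Qed.

Lemma smooth_derive V (U : set V) F v : smooth U F -> smooth U (fun x => 'D_v F x).
Proof. by move=> /smoothP h; apply/smoothP => k; exact: (h k.+1).2. Qed.

Lemma smooth_ext V (U : set V) F G : open U -> (forall x, U x -> F x = G x) ->
  smooth U F -> smooth U G.
Proof. by move=> oU FG /smoothP h; apply/smoothP => k; exact: Ck_ext (h k). Qed.

Lemma smooth_sub V (U U' : set V) F : U' `<=` U -> smooth U F -> smooth U' F.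
Proof. by move=> UU h vs x /UU; exact: h. Qed.

Lemma smooth_cst V (U : set V) (c : R) : smooth U (fun=> c).
Proof. by apply/smoothP => k; exact: Ck_cst. Qed.

Lemma smooth_add V (U : set V) F G : open U ->
  smooth U F -> smooth U G -> smooth U (fun x => F x + G x).
Proof. by move=> oU /smoothP f /smoothP g; apply/smoothP => k; exact: Ck_add. Qed.

Lemma smooth_mul V (U : set V) F G : open U ->
  smooth U F -> smooth U G -> smooth U (fun x => F x * G x).
Proof. by move=> oU /smoothP f /smoothP g; apply/smoothP => k; exact: Ck_mul. Qed.

Lemma smooth_sub_fun V (U : set V) F G : open U ->
  smooth U F -> smooth U G -> smooth U (fun x => F x - G x).
Proof.
move=> oU sF sG; apply: (@smooth_ext _ _ (fun x => F x + (-1) * G x)) => //.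
  by move=> x _; rewrite mulN1r.
by apply: smooth_add => //; apply: smooth_mul => //; exact: smooth_cst.
Qed.

Lemma smooth_sum V (U : set V) I (r : seq I) (F : I -> V -> R) : open U ->
  (forall i, smooth U (F i)) -> smooth U (fun x => \sum_(i <- r) F i x).
Proof.
by move=> oU f; apply/smoothP => k; apply: Ck_sum => // i; move/smoothP: (f i).
Qed.

Lemma smooth_inv V (U : set V) F : open U -> (forall x, U x -> F x != 0) ->
  smooth U F -> smooth U (fun x => (F x)^-1).
Proof. by move=> oU F0 /smoothP f; apply/smoothP => k; exact: Ck_inv. Qed.

Lemma smooth_linear V (U : set V) (F : V -> R) : linear F -> continuous F ->
  smooth U F.
Proof.
move=> lF cF; pose L := GRing.isLinear.Build R V R *%R F lF.
pose F' : {linear V -> R} := HB.pack F L.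
have dF x : differentiable F x by exact: (@linear_differentiable _ _ _ F').
apply/smoothP => -[//|k]; split=> // v.
have -> : (fun x => 'D_v F x) = fun=> F v; last exact: Ck_cst.
by apply/funext => x; rewrite deriveE // (@diff_lin _ _ _ F').
Qed.

Lemma smooth_comp_basis V W (U : set V) (U' : set W) (I : finType) (w : I -> W)
    (e : I -> V -> R) (F : W -> R) : open U ->
  (forall x, U x -> U' (\sum_i e i x *: w i)) ->
  (forall i, smooth U (e i)) -> smooth U' F ->
  smooth U (fun x => F (\sum_i e i x *: w i)).
Proof.
move=> oU UU ce /smoothP cF; apply/smoothP => k; apply: (Ck_comp (U' := U')) => //.
by move=> i; move/smoothP: (ce i).
Qed.

Lemma smooth_comp_mx V m n (U : set V) (U' : set 'M[R]_(m, n))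
    (E : V -> 'M[R]_(m, n)) (F : 'M[R]_(m, n) -> R) : open U ->
  (forall x, U x -> U' (E x)) ->
  (forall i j, smooth U (fun x => E x i j)) -> smooth U' F ->
  smooth U (fun x => F (E x)).
Proof.
move=> oU UU ce cF.
have EE x : E x = \sum_(p : 'I_m * 'I_n) E x p.1 p.2 *: delta_mx p.1 p.2.
  by rewrite {1}(matrix_sum_delta (E x)) pair_big.
under eq_fun do rewrite EE.
apply: (@smooth_comp_basis _ _ U U' _ (fun p => delta_mx p.1 p.2) (fun p x => E x p.1 p.2)) => //.
by move=> x Ux; rewrite -EE; exact: UU.
Qed.

Lemma smooth_comp_real V (U : set V) (U' : set R) (e : V -> R) (F : R -> R) : open U ->
  (forall x, U x -> U' (e x)) -> smooth U e -> smooth U' F ->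
  smooth U (fun x => F (e x)).
Proof.
move=> oU UU ce cF.
have EE x : e x = \sum_(p : 'I_1) e x *: (1 : R).
  by rewrite big_ord1 -[RHS]/(_ * _) mulr1.
under eq_fun do rewrite EE.
by apply: (@smooth_comp_basis V R U U' _ (fun=> 1) (fun=> e)) => // x /UU; rewrite -EE.
Qed.

End Smoothness.

(** * Smooth families of functions on a matrix group *)

Section SmoothFamilies.
Variables (R : realType) (n : nat).
Local Notation M := 'M[R]_n.+2.
Local Notation RM := (R * M)%type.

Lemma smooth_fst (U : set RM) : smooth U (fun x : RM => x.1).
Proof.
apply: smooth_linear; first by move=> a x y.
by move=> [s g]; exact: cvg_fst.
Qed.

Lemma smooth_snd (U : set RM) p q : smooth U (fun x : RM => x.2 p q).
Proof.
apply: smooth_linear; first by move=> a x y; rewrite /= !mxE.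
move=> [s g]; apply: (cvg_comp (fun x : RM => x.2) (fun g : M => g p q)); first exact: cvg_snd.
exact: coord_continuous.
Qed.

Lemma smooth_coord (U : set M) p q : smooth U (fun x : M => x p q).
Proof.
apply: smooth_linear; first by move=> a x y; rewrite /= !mxE.
exact: coord_continuous.
Qed.

Variable H : set M.
Hypothesis HM : forall g h, H g -> H h -> H (g *m h).

(** Joint smoothness in the parameter and in the point of the group, again as
    local restriction of smooth functions on open sets of matrices. *)
Definition smooth_family (Phi : R -> M -> R) : Prop :=
  forall s g, H g -> exists U : set RM, exists F : RM -> R,
    [/\ open U, U (s, g), smooth U F & forall x, U x -> H x.2 -> F x = Phi x.1 x.2].

Definition basis_RM (i : 'I_n.+2 * 'I_n.+2) : RM := (0, delta_mx i.1 i.2).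

Let curve X s g : R -> RM := fun t => (s, g *m expm (t *: X)).

Let curve_diff X s g : is_diff 0 (curve X s g) (fun t => (0, t *: (g *m X))).
Proof.
have d0 : is_diff (0 : R) (fun _ : R => s) (fun _ : R => 0 : R).
  by apply: DiffDef; [exact: differentiable_cst|exact: diff_cst].
apply: (is_diff_pair d0).
have lc : continuous (mulmx g : M -> M).
  by move=> h; apply: (@cvg_mulmx R M (nbhs h) _ _ _ _ (fun=> g) (fun h => h) g h); [exact: cvg_cst|exact: cvg_id].
have d1 : is_diff (0 : R) (fun t => expm (t *: X)) (fun t => t *: X).
  have dX := @derivable_expm _ _ X 0; apply: DiffDef; first exact/derivable1_diffP.
  by rewrite deriv1E // derive1E derive_expm0.
have d2 : is_diff (expm (0 *: X)) (mulmx g : M -> M) (mulmx g).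
  apply: DiffDef; first exact: linear_differentiable.
  by rewrite (@diff_lin _ _ _ (mulmx g : {linear M -> M})).
have -> : *:%R^~ (g *m X) = mulmx g \o ( *:%R^~ X) :> (R -> M).
  by apply/funext => t /=; rewrite scalemxAr.
exact: is_diff_comp d1 d2.
Qed.

Let curve0 X s g : curve X s g 0 = (s, g).
Proof. by rewrite /curve scale0r expm0 mulmx1. Qed.

Let curve_derive (U : set RM) F X s g : smooth U F -> U (s, g) ->
  derivable (F \o curve X s g) 0 1 /\
  'D_1 (F \o curve X s g) 0 = \sum_i (g *m X) i.1 i.2 * 'D_(basis_RM i) F (s, g).
Proof.
move=> sF Usg; have dc := curve_diff X s g.
have dF : differentiable F (s, g) by exact: smooth_diff Usg.
have dFc : differentiable (F \o curve X s g) 0.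
  by apply: differentiable_comp; [exact: ex_diff|rewrite curve0].
split; first exact: diff_derivable.
rewrite deriveE // diff_comp; [|exact: ex_diff|by rewrite curve0].
rewrite diff_val /= curve0 scale1r.
have -> : (0, g *m X) = \sum_i (g *m X) i.1 i.2 *: basis_RM i :> RM.
  rewrite {1}(matrix_sum_delta (g *m X)) pair_big /=.
  apply: (big_ind2 (fun (u : M) (v : RM) => (0, u) = v)) => //.
    by move=> u v u' v' <- <-; rewrite -[RHS]/(0 + 0, _) addr0.
  by move=> i _; rewrite -[RHS]/(_ *: 0, _) scaler0.
rewrite linear_sum; apply: eq_bigr => i _.
by rewrite linearZ /= deriveE.
Qed.

Let curve_near (U : set RM) (F : RM -> R) Phi X s g : lie H X -> open U -> U (s, g) -> H g ->
  (forall x, U x -> H x.2 -> F x = Phi x.1 x.2) ->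
  \forall t \near (0 : R), (F \o curve X s g) t = Phi s (g *m expm (t *: X)).
Proof.
move=> lX oU Usg Hg FE.
have cc : curve X s g t @[t --> 0] --> (s, g).
  rewrite -[Y in _ --> Y](curve0 X s g).
  have dc := curve_diff X s g.
  by apply: differentiable_continuous; exact: ex_diff.
have : \forall t \near (0 : R), U (curve X s g t).
  by apply: cc; exact: open_nbhs_nbhs.
apply: filterS => t Ut; rewrite /= FE //=; apply: HM => //; exact: lX.
Qed.

(** Along t |-> g exp (t X) the extension F has derivative d F (g, g X), which is
    smooth in g although X is only tangent to the group. *)
Lemma smooth_family_lie Phi X : lie H X -> smooth_family Phi ->
  smooth_family (fun s g => 'D_1 (fun t : R => Phi s (g *m expm (t *: X))) 0).
Proof.
move=> lX sP s g Hg; have [U [F [oU Usg sF FE]]] := sP s g Hg.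
exists U, (fun x => \sum_i (x.2 *m X) i.1 i.2 * 'D_(basis_RM i) F x); split => //.
  apply: smooth_sum => // i; apply: smooth_mul => //; last exact: smooth_derive.
  apply: (@smooth_ext _ _ _ (fun x : RM => \sum_l x.2 i.1 l * X l i.2)) => // [x _|].
    by rewrite mxE.
  by apply: smooth_sum => // l; apply: smooth_mul => //; [exact: smooth_snd|exact: smooth_cst].
move=> [s' g'] Ux Hx /=; rewrite -(near_eq_derive _ (curve_near lX oU Ux Hx FE)).
by rewrite (curve_derive X sF Ux).2.
Qed.

Lemma derivable_family_lie Phi X s g : lie H X -> smooth_family Phi -> H g ->
  derivable (fun t : R => Phi s (g *m expm (t *: X))) 0 1.
Proof.
move=> lX sP Hg; have [U [F [oU Usg sF FE]]] := sP s g Hg.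
apply: (near_eq_derivable (curve_near lX oU Usg Hg FE)).
exact: (curve_derive X sF Usg).1.
Qed.

Let slice_derive (F : RM -> R) s g :
  ((fun s => F (s, g)) \o shift s) = (fun h : R => (F \o shift (s, g)) (h *: (1, 0))).
Proof.
apply/funext => h /=; congr F.
by rewrite -[RHS]/(h * 1 + s, h *: 0 + g) mulr1 scaler0 add0r.
Qed.

Let slice_D (F : RM -> R) s g : 'D_1 (fun s => F (s, g)) s = 'D_(1, 0) F (s, g).
Proof.
have E : (fun h : R => h^-1 *: (((fun s => F (s, g)) \o shift s) (h *: 1) - F (s, g)))
  = (fun h => h^-1 *: ((F \o shift (s, g)) (h *: (1, 0)) - F (s, g))).
  apply/funext => h; have := congr1 (fun f => f h) (slice_derive F s g).
  by rewrite /= [h *: 1]mulr1 => ->.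
exact: (congr1 (fun f : R -> R => lim (f h @[h --> 0^'])) E).
Qed.

Let slice_near (U : set RM) (F : RM -> R) (Phi : R -> M -> R) s g : open U -> U (s, g) -> H g ->
  (forall x, U x -> H x.2 -> F x = Phi x.1 x.2) ->
  \forall t \near s, F (t, g) = Phi t g.
Proof.
move=> oU Usg Hg FE.
have [[A B] [/= nA nB] AB] := open_nbhs_nbhs (conj oU Usg).
apply: filterS nA => t At; rewrite FE //=.
by apply: (AB (t, g)); split => //=; exact: nbhs_singleton.
Qed.

Lemma smooth_family_param Phi : smooth_family Phi ->
  smooth_family (fun s g => 'D_1 (fun s => Phi s g) s).
Proof.
move=> sP s g Hg; have [U [F [oU Usg sF FE]]] := sP s g Hg.
exists U, (fun x => 'D_(1, 0) F x); split => //; first exact: smooth_derive.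
move=> [s' g'] Ux Hx /=.
by rewrite -(near_eq_derive _ (slice_near oU Ux Hx FE)) slice_D.
Qed.

Lemma derivable_family_param Phi s g : smooth_family Phi -> H g ->
  derivable (fun s => Phi s g) s 1.
Proof.
move=> sP Hg; have [U [F [oU Usg sF FE]]] := sP s g Hg.
apply: (near_eq_derivable (slice_near oU Usg Hg FE)).
apply/derivable1_diffP.
apply: (@differentiable_comp _ _ _ _ (fun s => (s, g)) F); last exact: smooth_diff Usg.
by apply: differentiable_pair; [exact: ex_diff|exact: differentiable_cst].
Qed.

(** Local boundedness of the extensions and compactness of the product of the
    parameter interval with K. *)
Lemma smooth_family_bounded Phi (K : set M) : smooth_family Phi -> compact K -> K `<=` H ->
  exists C, forall s g, `|s| <= 1 -> K g -> `|Phi s g| <= C.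
Proof.
move=> sP cK KH.
have cc : compact (`[-1, 1]%classic `*` K : set RM).
  by apply: compact_setX => //; exact: segment_compact.
have [B [_ hB]] : \forall C \near +oo, (`[-1, 1]%classic `*` K : set RM) `<=` (fun x => `|Phi x.1 x.2| <= C).
  move/compact_near_coveringP/near_covering_withinP: cc; apply.
  move=> [s g] [_ Kg]; have [U [F [oU Usg sF FE]]] := sP s g (KH g Kg).
  have cF : {for (s, g), continuous F}.
    by apply: differentiable_continuous; exact: smooth_diff Usg.
  have nF : \forall x \near (s, g), `|F x| < `|F (s, g)| + 1.
    by apply: (cvgr_lt _ (cvg_norm cF)); rewrite ltrDl.
  exists ([set x | U x /\ `|F x| < `|F (s, g)| + 1], [set C | `|F (s, g)| + 1 <= C]) => /=.
    split; last exact: nbhs_pinfty_ge.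
    by apply: filterI => //; exact: open_nbhs_nbhs.
  move=> [[s' g'] C] [/= [Ux Fx] hC] [/= _ Kx].
  by rewrite -(FE _ Ux) //; [exact: le_trans (ltW Fx) hC|exact: KH].
exists (`|B| + 1) => s g s1 Kg; apply: (hB (`|B| + 1) _ (s, g)).
  by rewrite (le_lt_trans (ler_norm B)) // ltrDl.
by split=> //=; rewrite in_itv /= -ler_norml.
Qed.

Lemma lie_deriv_ext Xs (phi psi : M -> R) : (forall X, X \in Xs -> lie H X) ->
  (forall g, H g -> phi g = psi g) ->
  forall g, H g -> lie_deriv Xs phi g = lie_deriv Xs psi g.
Proof.
move=> + e; elim: Xs => [|X Xs IH] lX g Hg; first exact: e.
rewrite /=; suff -> : (fun t : R => lie_deriv Xs phi (g *m expm (t *: X))) =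
  (fun t : R => lie_deriv Xs psi (g *m expm (t *: X))) by [].
apply/funext => t; apply: IH.
  by move=> Y Ys; apply: lX; rewrite in_cons Ys orbT.
by apply: HM => //; apply: lX; rewrite mem_head.
Qed.

Lemma smooth_family_lie_deriv Xs Phi : (forall X, X \in Xs -> lie H X) ->
  smooth_family Phi -> smooth_family (fun s => lie_deriv Xs (Phi s)).
Proof.
move=> + sP; elim: Xs => [|X Xs IH] lX //.
apply: (smooth_family_lie (Phi := fun s => lie_deriv Xs (Phi s))).
  by apply: lX; rewrite mem_head.
by apply: IH => Y Ys; apply: lX; rewrite in_cons Ys orbT.
Qed.

Lemma smooth_group_family phi : smooth_on_group H phi -> smooth_family (fun=> phi).
Proof.
move=> sp s g Hg; have [U [F [oU Ug sF FE]]] := sp g Hg.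
exists [set x | U x.2], (fun x => F x.2); split => //.
- rewrite openE => -[s' g'] /= Ux; exists (setT, U) => /=; last by move=> x [].
  by split; [exact: filterT|exact: open_nbhs_nbhs].
- apply: (smooth_comp_mx (U' := U)) => //.
    rewrite openE => -[s' g'] /= Ux; exists (setT, U) => /=; last by move=> x [].
    by split; [exact: filterT|exact: open_nbhs_nbhs].
  by move=> i j; exact: smooth_snd.
- by move=> x Ux Hx; rewrite FE.
Qed.

Lemma smooth_family_add Phi Psi : smooth_family Phi -> smooth_family Psi ->
  smooth_family (fun s g => Phi s g + Psi s g).
Proof.
move=> sP sQ s g Hg; have [U [F [oU Usg sF FE]]] := sP s g Hg.
have [V [G [oV Vsg sG GE]]] := sQ s g Hg.
exists (U `&` V), (fun x => F x + G x); split => //; first exact: openI.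
  by apply: smooth_add; [exact: openI|apply: smooth_sub sF|apply: smooth_sub sG].
by move=> x [Ux Vx] Hx; rewrite FE // GE.
Qed.

Lemma smooth_family_scale a Phi : smooth_family Phi -> smooth_family (fun s g => a * Phi s g).
Proof.
move=> sP s g Hg; have [U [F [oU Usg sF FE]]] := sP s g Hg.
exists U, (fun x => a * F x); split => //; last by move=> x Ux Hx; rewrite FE.
by apply: smooth_mul => //; exact: smooth_cst.
Qed.

Lemma lie_deriv_lin Xs (phi psi : M -> R) a b : (forall X, X \in Xs -> lie H X) ->
  smooth_family (fun=> phi) -> smooth_family (fun=> psi) ->
  forall g, H g -> lie_deriv Xs (fun g => a * phi g + b * psi g) g =
     a * lie_deriv Xs phi g + b * lie_deriv Xs psi g.
Proof.
move=> + sp sq; elim: Xs => [|X Xs IH] lX g Hg //=.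
have lX0 : lie H X by apply: lX; rewrite mem_head.
have lXs Y : Y \in Xs -> lie H Y by move=> Ys; apply: lX; rewrite in_cons Ys orbT.
have dp := derivable_family_lie (s := 0) lX0 (smooth_family_lie_deriv lXs sp) Hg.
have dq := derivable_family_lie (s := 0) lX0 (smooth_family_lie_deriv lXs sq) Hg.
under eq_fun => t do rewrite (IH lXs _ (HM Hg (lX0 t))).
rewrite -[LHS]/('D_1 (a *: (fun t : R => lie_deriv Xs phi (g *m expm (t *: X)))
  + b *: (fun t : R => lie_deriv Xs psi (g *m expm (t *: X)))) 0).
by rewrite deriveD; [rewrite !deriveZ|exact: derivableZ|exact: derivableZ].
Qed.

Lemma lie_deriv_sum Xs (I : Type) (r : seq I) (a : I -> R) (phi : I -> M -> R) :
  (forall X, X \in Xs -> lie H X) ->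
  (forall i, smooth_family (fun=> phi i)) ->
  forall g, H g -> lie_deriv Xs (fun g => \sum_(i <- r) a i * phi i g) g =
     \sum_(i <- r) a i * lie_deriv Xs (phi i) g.
Proof.
move=> lX sp.
have s0 : smooth_family (fun _ _ => 0).
  move=> s g Hg; exists setT, (fun=> 0); split => //; [exact: openT|exact: smooth_cst].
suff h : smooth_family (fun _ g => \sum_(i <- r) a i * phi i g) /\
    forall g, H g -> lie_deriv Xs (fun g => \sum_(i <- r) a i * phi i g) g =
     \sum_(i <- r) a i * lie_deriv Xs (phi i) g by exact: h.2.
elim: r => [|i r [IH1 IH2]].
  split; first by under eq_fun => s do under eq_fun do rewrite big_nil.
  move=> g Hg; under eq_fun do rewrite big_nil; rewrite big_nil.
  by have := lie_deriv_lin 0 0 lX s0 s0 Hg; rewrite !mul0r addr0.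
split.
  under eq_fun => s do under eq_fun do rewrite big_cons.
  exact: (smooth_family_add (smooth_family_scale (a i) (sp i)) IH1).
move=> g Hg; rewrite big_cons -IH2 //.
have := lie_deriv_lin (a i) 1 lX (sp i) IH1 Hg; rewrite mul1r => <-.
by congr (lie_deriv _ _ _); apply/funext => h; rewrite big_cons mul1r.
Qed.

End SmoothFamilies.

(** * Smooth steps, Taylor bounds and finite differences *)

Section Bump.
Variable R : realType.
Implicit Types x : R.

(** The derivatives of exp (- 1 / x) are combinations of these functions, so that
    the whole family can be shown to be smooth at once. *)
Definition flat (k : nat) x : R := if 0 < x then x^-1 ^+ k * expR (- x^-1) else 0.

(** exp (1 / x) dominates the power (1 / x) ^ (k + 2) of its Taylor series; the
    quadratic bound gives the derivative 0 at the origin. *)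
Lemma flat_bound k x : `|flat k x| <= k.+2`!%:R * x ^+ 2.
Proof.
rewrite /flat; case: ifP => [x0|_]; last by rewrite normr0 mulr_ge0 ?sqr_ge0.
set y := x^-1; have y0 : 0 < y by rewrite invr_gt0.
rewrite ger0_norm; last by rewrite mulr_ge0 ?exprn_ge0 ?expR_ge0 // ltW.
rewrite (_ : x ^+ 2 = (y ^+ 2)^-1); last by rewrite /y exprVn invrK.
rewrite expRN ler_pdivrMr ?expR_gt0 //.
have := expR_ge1Dxn k.+1 (ltW y0).
have f0 : 0 < k.+2`!%:R :> R by rewrite ltr0n fact_gt0.
move=> h; have {}h : y ^+ k.+2 / k.+2`!%:R <= expR y by apply: le_trans h; rewrite lerDr.
rewrite ler_pdivrMr // in h.
rewrite mulrAC ler_pdivlMr ?exprn_gt0 // -exprD addn2.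
by rewrite mulrC.
Qed.

Lemma is_derive_flat k x : is_derive x 1 (flat k) (flat k.+2 x - k%:R * flat k.+1 x).
Proof.
have [x0|x0|->] := ltgtP x 0.
- rewrite /flat ltNge (ltW x0) /= mulr0 subrr.
  apply: (@near_eq_is_derive _ _ _ (fun=> 0)) => //.
  near=> y; rewrite ltNge.
  have y0 : y < 0 by near: y; exact: lt_nbhsl.
  by rewrite (ltW y0).
- apply: (@near_eq_is_derive R R R (fun y : R => y^-1 ^+ k * expR (- y^-1)) (flat k) x 1).
    near=> y; have y0 : 0 < y by near: y; exact: lt_nbhsr.
    by rewrite /flat y0.
  rewrite /flat x0; have xn : x != 0 by rewrite gt_eqF.
  have dV : is_derive x 1 (fun y : R => y^-1) (- (x^-1 ^+ 2)).
    have -> : - (x^-1 ^+ 2) = (- x ^- 2) *: (1 : R) by rewrite [RHS]mulr1 exprVn.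
    exact: (is_deriveV (f := id) xn (is_derive_id _ _)).
  have dX : is_derive x 1 (fun y : R => y^-1 ^+ k) (k%:R * (x^-1 ^+ k.-1) * (- (x^-1 ^+ 2))).
    by have := is_deriveX k dV; rewrite exprfctE.
  have dE : is_derive x 1 (fun y : R => expR (- y^-1)) (x^-1 ^+ 2 * expR (- x^-1)).
    have -> : x^-1 ^+ 2 * expR (- x^-1) = expR (- x^-1) * - - x^-1 ^+ 2.
      by rewrite opprK mulrC.
    exact: is_derive1_comp (is_derive_expR _) (is_deriveN dV).
  have -> : x^-1 ^+ k.+2 * expR (- x^-1) - k%:R * (x^-1 ^+ k.+1 * expR (- x^-1)) =
      x^-1 ^+ k *: (x^-1 ^+ 2 * expR (- x^-1)) +
      expR (- x^-1) *: (k%:R * (x^-1 ^+ k.-1) * (- (x^-1 ^+ 2))).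
    rewrite -[RHS]/(_ * _ + _ * _); case: k {dX} => [|k].
      by rewrite !expr0 !mul0r !mulr0; ring.
    by rewrite /= !exprS; ring.
  exact: is_deriveM dX dE.
- have f0 j : flat j 0 = 0 by rewrite /flat ltxx.
  rewrite !f0 mulr0 subrr.
  have h : h^-1 *: ((flat k \o shift 0) h%:A - flat k 0) @[h --> 0^'] --> (0 : R).
    apply/cvgr0Pnorm_lt => e e0; near=> h; rewrite f0 subr0 /= addr0.
    have h0 : h != 0 by near: h; exact: nbhs_dnbhs_neq.
    rewrite [h%:A]mulr1 [_ *: _]/(_ * _) normrM normfV.
    rewrite mulrC ltr_pdivrMr ?normr_gt0 //.
    apply: le_lt_trans (flat_bound k h) _.
    rewrite -[h ^+ 2]ger0_norm ?sqr_ge0 // normrX expr2 mulrA ltr_pM2r ?normr_gt0 //.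
    rewrite mulrC -ltr_pdivlMr ?ltr0n ?fact_gt0 //.
    near: h; apply: dnbhs0_lt; by rewrite divr_gt0 // ltr0n fact_gt0.
  apply: DeriveDef; first by apply/cvg_ex; exists 0.
  exact: cvg_lim h.
Unshelve. all: by end_near. Qed.

Lemma smooth_flat k : smooth [set: R] (flat k).
Proof.
apply/smoothP => m; elim: m k => [|m IH] k.
  by move=> x _; apply/derivable1_diffP; have d := is_derive_flat k x; exact: ex_derive.
have dk x : differentiable (flat k) x.
  by apply/derivable1_diffP; have d := is_derive_flat k x; exact: ex_derive.
split=> [x _|v]; first exact: dk.
apply: (@Ck_ext _ _ _ _ (fun x => v * (flat k.+2 x + (- k%:R) * flat k.+1 x))) => [|x _|]; first exact: openT.
  have d1 := is_derive_flat k x.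
  rewrite deriveE // -[v in RHS]mulr1 -[v * 1]/(v *: 1) linearZ /= -deriveE //.
  by rewrite derive_val mulNr.
apply: Ck_mul; [exact: openT|exact: Ck_cst|].
apply: Ck_add; [exact: openT|exact: IH|].
by apply: Ck_mul; [exact: openT|exact: Ck_cst|exact: IH].
Qed.

Lemma flat0_gt0 x : 0 < x -> 0 < flat 0 x.
Proof. by move=> x0; rewrite /flat x0 expr0 mul1r expR_gt0. Qed.

Lemma flat0_ge0 x : 0 <= flat 0 x.
Proof. by rewrite /flat; case: ifP => // _; rewrite expr0 mul1r expR_ge0. Qed.

Lemma exists_smooth_step (a b : R) : a < b -> exists psi : R -> R,
  [/\ smooth setT psi, forall x, x <= a -> psi x = 0 & forall x, b <= x -> psi x = 1].
Proof.
move=> ab; pose u x := flat 0 (x - a); pose v x := flat 0 (b - x).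
have oT := @openT R.
have sid : smooth [set: R] (fun x => x).
  by apply: smooth_linear; [move=> c x y|move=> x; exact: cvg_id].
have su : smooth setT u.
  apply: (@smooth_comp_real _ _ _ setT (fun x => x - a) (flat 0)) => //; last exact: smooth_flat.
  by apply: smooth_sub_fun => //; exact: smooth_cst.
have sv : smooth setT v.
  apply: (@smooth_comp_real _ _ _ setT (fun x => b - x) (flat 0)) => //; last exact: smooth_flat.
  by apply: smooth_sub_fun => //; exact: smooth_cst.
have uv x : u x + v x != 0.
  rewrite gt_eqF //; have [xa|ax] := leP x a.
    by apply: ltr_wpDl; [exact: flat0_ge0|apply: flat0_gt0; rewrite subr_gt0 (le_lt_trans xa)].
  by apply: ltr_wpDr; [exact: flat0_ge0|apply: flat0_gt0; rewrite subr_gt0].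
exists (fun x => u x * (u x + v x)^-1); split.
- apply: smooth_mul => //; apply: smooth_inv => //; exact: smooth_add.
- by move=> x xa; rewrite /u {1}/flat subr_gt0 ltNge xa /= mul0r.
- move=> x bx; have v0 : v x = 0 by rewrite /v /flat subr_gt0 ltNge bx.
  by have := uv x; rewrite v0 addr0 => u0; rewrite mulfV.
Qed.

End Bump.

Section Taylor.
Variable R : realType.

(** Taylor's formula by induction on m: the mean value theorem applied to the
    remainder turns the bound for the derivative into one for the function. *)
Lemma taylor_bound m (h : nat -> R -> R) C :
  (forall j (s : R), is_derive s (1 : R) (h j) (h j.+1 s)) ->
  (forall s : R, `|s| <= 1 -> `|h m s| <= C) ->
  exists p : nat -> R, forall s, `|s| <= 1 ->
    `|h 0%N s - \sum_(k < m) p k * s ^+ k| <= C * `|s| ^+ m.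
Proof.
elim: m h => [|m IH] h dh hC.
  by exists (fun=> 0) => s s1; rewrite big_ord0 subr0 expr0 mulr1; exact: hC.
have [q hq] := IH (fun j => h j.+1) (fun j s => dh j.+1 s) hC.
have C0 : 0 <= C by apply: le_trans (hC 0 _); rewrite ?normr0.
pose p k := if k is k'.+1 then q k' / k'.+1%:R else h 0%N 0.
exists p => s s1; pose P x := \sum_(k < m.+1) p k * x ^+ k.
pose u x := h 0%N x - P x.
pose du x := h 1%N x - \sum_(k < m) q k * x ^+ k.
have dP (x : R) : is_derive x (1 : R) P (\sum_(k < m) q k * x ^+ k).
  have dPk (k : 'I_m.+1) : is_derive x (1 : R) (fun x : R => p k * x ^+ k)
      (p k * (k%:R * x ^+ k.-1)).
    have dk := is_deriveX k (is_derive_id x (1 : R)).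
    have -> : p k * (k%:R * x ^+ k.-1) = p k *: ((k%:R * x ^+ k.-1) *: (1 : R)).
      by rewrite -[RHS]/(p k * (k%:R * x ^+ k.-1 * 1)) mulr1.
    by have := is_deriveZ (p k) dk; rewrite exprfctE.
  have -> : P = \sum_(k < m.+1) (fun x : R => p k * x ^+ k).
    by apply/funext => y; rewrite fct_sumE.
  have -> : \sum_(k < m) q k * x ^+ k = \sum_(k < m.+1) p k * (k%:R * x ^+ k.-1).
    rewrite big_ord_recl /= mul0r mulr0 add0r; apply: eq_bigr => i _.
    by rewrite /bump /= add1n /= mulrA divfK.
  exact: is_derive_sum.
have du' (x : R) : is_derive x (1 : R) u (du x) by exact: is_deriveB.
have u0 : u 0 = 0.
  rewrite /u /P big_ord_recl /= expr0 mulr1 big1 ?addr0 ?subrr // => i _.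
  by rewrite /bump /= exprS mul0r mulr0.
have cu (A : set R) : {within A, continuous u}.
  apply: continuous_subspaceT => x.
  by apply: differentiable_continuous; apply/derivable1_diffP; have d := du' x; exact: ex_derive.
have bound c : `|c| <= `|s| -> `|du c| <= C * `|s| ^+ m.
  move=> cs; apply: le_trans (hq c (le_trans cs s1)) _.
  by apply: ler_wpM2l => //; apply: lerXn2r; rewrite ?nnegrE.
rewrite -/(P s) -/(u s) exprS mulrCA.
have [s0|s0] := leP 0 s.
  have [c] := MVT_segment s0 (fun x _ => du' x) (cu _).
  rewrite in_itv /= => /andP[c0 cs]; rewrite u0 !subr0 => ->.
  rewrite normrM mulrC ler_wpM2l //; apply: bound.
  by rewrite !ger0_norm.
have [c] := MVT_segment (ltW s0) (fun x _ => du' x) (cu _).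
rewrite in_itv /= => /andP[c0 cs]; rewrite u0 !sub0r => E.
rewrite -[`|u s|]normrN E normrM mulrC normrN ler_wpM2l //; apply: bound.
by rewrite !ler0_norm ?lerN2 // ltW.
Qed.

Section Differences.
Variables (V : zmodType) (scal : R -> V -> V) (c : nat -> R).

(** Composition of the q-difference operators h |-> h (c s) - c ^ l h (s) for
    l < m; the l-th one kills s ^ l and preserves the other monomials up to a
    scalar. The factor c may depend on l and may be negative, and this is what
    allows to compare the values of h at s and - s. *)
Fixpoint iter_diff (m : nat) (h : R -> V) : R -> V :=
  if m is m'.+1 then iter_diff m' (fun s => h (c m' * s) - scal (c m' ^+ m') (h s)) else h.

End Differences.

Lemma iter_diff_morph (V V' : zmodType) (sc : R -> V -> V) (sc' : R -> V' -> V') c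
    (T : V -> V') m h :
  (forall x y, T (x - y) = T x - T y) -> (forall r x, T (sc r x) = sc' r (T x)) ->
  forall s, T (iter_diff sc c m h s) = iter_diff sc' c m (fun s => T (h s)) s.
Proof.
move=> TB TZ; elim: m h => [|m IH] h s //=; rewrite IH.
by congr (iter_diff _ _ _ _ _); apply/funext => t; rewrite TB TZ.
Qed.

Lemma iter_diff_ext (V : zmodType) (sc : R -> V -> V) c m (D : set R) h h' :
  (forall j s, (j < m)%N -> D s -> D (c j * s)) ->
  (forall s, D s -> h s = h' s) ->
  forall s, D s -> iter_diff sc c m h s = iter_diff sc c m h' s.
Proof.
elim: m h h' => [|m IH] h h' cD hh s Ds /=; first exact: hh.
apply: IH => // [j t jm|t Dt]; first by apply: cD; exact: leqW.
by rewrite !hh //; apply: cD.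
Qed.

(** A function homogeneous under the dilation by q is an eigenfunction; for
    h (s) = s ^ a the eigenvalue is the product of the q ^ a - q ^ j. *)
Lemma iter_diff_eigen (c : nat -> R) (q : R) (kappa : R[i]) m (h : R -> R[i]) : 0 < q ->
  (forall j, (j < m)%N -> c j = q) ->
  (forall s, 0 < s -> h (q * s) = kappa * h s) ->
  forall s, 0 < s -> iter_diff (fun r z => r%:C * z) c m h s =
    (\prod_(j < m) (kappa - (q ^+ j)%:C)) * h s.
Proof.
move=> q0; elim: m h => [|m IH] h cq hq s s0; first by rewrite big_ord0 mul1r.
have cm : c m = q by exact: cq.
rewrite /= IH => [|j jm|t t0|//]; last first.
- by rewrite cm !hq ?mulr_gt0 //; ring.
- by apply: cq; exact: leqW.
by rewrite big_ord_recr /= cm hq //; ring.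
Qed.

Lemma iter_diffB (c : nat -> R) m (h h' : R -> R) s :
  iter_diff *%R c m (fun s => h s - h' s) s = iter_diff *%R c m h s - iter_diff *%R c m h' s.
Proof.
elim: m h h' => [//|m IH] h h' /=; rewrite -IH.
by congr (iter_diff _ _ _ _ _); apply/funext => t; ring.
Qed.

Lemma iter_diff_bound c m (h : R -> R) C : 0 <= C -> (forall j, `|c j| <= 1) ->
  (forall s, `|s| <= 1 -> `|h s| <= C * `|s| ^+ m) ->
  forall l s, `|s| <= 1 -> `|iter_diff *%R c l h s| <= 2 ^+ l * C * `|s| ^+ m.
Proof.
move=> C0 c1 + l; elim: l C C0 h => [|l IH] C C0 h hC s s1.
  by rewrite expr0 mul1r; exact: hC.
rewrite exprSr -(mulrA _ 2) /=; apply: IH => //; first by rewrite mulr_ge0.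
move=> t t1; apply: le_trans (ler_normB _ _) _; rewrite -mulrA mulr2n mulrDl !mul1r.
apply: lerD.
  have ct : `|c l * t| <= `|t| by rewrite normrM ler_piMl.
  apply: le_trans (hC _ (le_trans ct t1)) _.
  by apply: ler_wpM2l => //; apply: lerXn2r; rewrite ?nnegrE.
rewrite normrM normrX; apply: le_trans (hC t t1); apply: ler_piMl => //.
by apply: exprn_ile1.
Qed.

(** On s ^ k the operator of index l = k in the composition vanishes. *)
Lemma iter_diff_poly c m (p : nat -> R) s : iter_diff *%R c m (fun s => \sum_(k < m) p k * s ^+ k) s = 0.
Proof.
suff h l : (l <= m)%N -> forall (p : nat -> R) s,
   iter_diff *%R c l (fun s => \sum_(k < m) p k * s ^+ k) s =
   \sum_(k < m) (\prod_(j < l) (c j ^+ k - c j ^+ j)) * p k * s ^+ k.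
  rewrite h // big1 // => k _; rewrite (bigD1 k) //= subrr !mul0r //.
elim: l => [|l IH] lm q t; first by apply: eq_bigr => k _; rewrite big_ord0 mul1r.
rewrite /= -[RHS](_ : \sum_(k < m) (\prod_(j < l) (c j ^+ k - c j ^+ j)) *
   ((c l ^+ k - c l ^+ l) * q k) * t ^+ k = _); last first.
  by apply: eq_bigr => k _; rewrite big_ord_recr /= !mulrA.
rewrite -(IH (ltnW lm) (fun k => (c l ^+ k - c l ^+ l) * q k)).
congr (iter_diff _ _ _ _ _); apply/funext => u; rewrite mulr_sumr -sumrB.
by apply: eq_bigr => k _; rewrite exprMn; ring.
Qed.

(** Only the remainder of the Taylor expansion survives. *)
Lemma iter_diff_taylor m (h : nat -> R -> R) C c : (forall j, `|c j| <= 1) ->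
  (forall j (s : R), is_derive s (1 : R) (h j) (h j.+1 s)) ->
  (forall s : R, `|s| <= 1 -> `|h m s| <= C) ->
  forall s, `|s| <= 1 -> `|iter_diff *%R c m (h 0%N) s| <= 2 ^+ m * C * `|s| ^+ m.
Proof.
move=> c1 dh hC s s1; have [p hp] := taylor_bound dh hC.
have C0 : 0 <= C by apply: le_trans (hC 0 _); rewrite ?normr0.
set P := fun s => \sum_(k < m) p k * s ^+ k.
have -> : iter_diff *%R c m (h 0%N) s = iter_diff *%R c m (fun s => h 0%N s - P s) s.
  by rewrite iter_diffB iter_diff_poly subr0.
exact: iter_diff_bound.
Qed.

End Taylor.

(** * The alternating symbol of a splitting of the indices *)

Section HodgeStar.
Variables (R : realType) (i i' m : nat) (e : (i + i' = m)%N).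
Local Notation K := {ffun 'I_i -> 'I_m}.
Local Notation K' := {ffun 'I_i' -> 'I_m}.
Implicit Types (k l : K) (p q : K') (B : 'M[R]_m).

Definition join k p (a : 'I_(i + i')) : 'I_m :=
  match fintype.split a with inl b => k b | inr b => p b end.

Lemma join_lshift k p a : join k p (lshift i' a) = k a.
Proof. by rewrite /join -[lshift i' a]/(unsplit (inl a)) unsplitK. Qed.

Lemma join_rshift k p a : join k p (rshift i a) = p a.
Proof. by rewrite /join -[rshift i a]/(unsplit (inr a)) unsplitK. Qed.

(** The sign of the word k p when it is a permutation of the indices, and 0
    otherwise. As a determinant it is alternating in the letters of k and of p,
    and its behaviour under linear maps follows from multiplicativity. *)
Definition eps k p : R :=
  \det (\matrix_(a < i + i', b < i + i') (join k p a == cast_ord e b)%:R).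

Lemma eps_inj k p : eps k p != 0 -> injective (join k p).
Proof.
move=> h a b ab; apply/eqP; apply: contraNT h => nab; apply/eqP.
by apply: (determinant_alternate nab) => c; rewrite !mxE ab.
Qed.

Lemma eps_sq k p : injective (join k p) -> eps k p ^+ 2 = 1.
Proof.
move=> inj; have injc : injective (fun a => cast_ord (esym e) (join k p a)).
  by move=> a b /cast_ord_inj /inj.
have -> : eps k p = \det (perm_mx (perm injc) : 'M[R]_(i + i')).
  congr (\det _); apply/matrixP => a b; rewrite !mxE permE.
  by rewrite -(inj_eq (@cast_ord_inj _ _ e)) cast_ordKV.
by rewrite det_perm sqrr_sign.
Qed.

Lemma epsE k p : eps k p = \sum_(s : 'S_(i + i')) (-1) ^+ s *
   (\prod_(a < i) (k a == cast_ord e (s (lshift i' a)))%:R *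
    \prod_(a < i') (p a == cast_ord e (s (rshift i a)))%:R).
Proof.
apply: eq_bigr => s _; congr (_ * _); rewrite big_split_ord /=; congr (_ * _).
  by apply: eq_bigr => a _; rewrite mxE join_lshift.
by apply: eq_bigr => a _; rewrite mxE join_rshift.
Qed.

Lemma eps_permL (s : 'S_i) k p : eps [ffun a => k (s a)] p = (-1) ^+ s * eps k p.
Proof.
pose A : 'M[R]_(i + i') := block_mx (perm_mx s) 0 0 1%:M.
rewrite -(det_perm R s) -[\det (perm_mx s)]mulr1 -(det1 R i') -(det_ublock (perm_mx s) 0 1%:M).
rewrite -det_mulmx; congr (\det _); apply/matrixP => a b; rewrite !mxE.
(* Only the column that s assigns to a contributes to the matrix product. *)
rewrite (bigD1 (unsplit (match fintype.split a with inl c => inl (s c) | inr c => inr c end))) //=.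
rewrite big1 ?addr0 => [|c].
  rewrite mxE; case: (split_ordP a) => c -> /=.
    rewrite block_mxEul join_lshift.
    by rewrite join_lshift !mxE eqxx mul1r ffunE.
  rewrite block_mxEdr !join_rshift.
  by rewrite !mxE eqxx mul1r.
case: (split_ordP a) => d ->.
  case: (split_ordP c) => f -> h; rewrite ?block_mxEul ?block_mxEur !mxE ?mul0r //.
  by rewrite (_ : s d == f = false) ?mul0r //; apply: contraNF h => /eqP ->.
case: (split_ordP c) => f -> h; rewrite ?block_mxEdl ?block_mxEdr !mxE ?mul0r //.
by rewrite (_ : d == f = false) ?mul0r //; apply: contraNF h => /eqP ->.
Qed.

Lemma eps_permR (s : 'S_i') k p : eps k [ffun a => p (s a)] = (-1) ^+ s * eps k p.
Proof.
pose A : 'M[R]_(i + i') := block_mx 1%:M 0 0 (perm_mx s).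
rewrite -(det_perm R s) -[\det (perm_mx s)]mul1r -(det1 R i) -(det_ublock 1%:M 0 (perm_mx s)).
rewrite -det_mulmx; congr (\det _); apply/matrixP => a b; rewrite !mxE.
(* Only the column that s assigns to a contributes to the matrix product. *)
rewrite (bigD1 (unsplit (match fintype.split a with inl c => inl c | inr c => inr (s c) end))) //=.
rewrite big1 ?addr0 => [|c].
  rewrite mxE; case: (split_ordP a) => c -> /=.
    rewrite block_mxEul !join_lshift.
    by rewrite !mxE eqxx mul1r.
  rewrite block_mxEdr !join_rshift.
  by rewrite !mxE eqxx mul1r ffunE.
case: (split_ordP a) => d ->.
  case: (split_ordP c) => f -> h; rewrite ?block_mxEul ?block_mxEur !mxE ?mul0r //.
  by rewrite (_ : d == f = false) ?mul0r //; apply: contraNF h => /eqP ->.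
case: (split_ordP c) => f -> h; rewrite ?block_mxEdl ?block_mxEdr !mxE ?mul0r //.
by rewrite (_ : s d == f = false) ?mul0r //; apply: contraNF h => /eqP ->.
Qed.

(** Both sides are the determinant of the rows k p of B, expanded over all words
    on the left. *)
Lemma eps_mulmx B k p :
  \sum_(l : K) \sum_(q : K') (\prod_a B (k a) (l a)) * (\prod_a B (p a) (q a)) * eps l q
  = \det B * eps k p.
Proof.
have -> : \det B * eps k p =
   \det (\matrix_(a < i + i', b < i + i') B (join k p a) (cast_ord e b)).
  have -> : \det B = \det (\matrix_(a < i + i', b < i + i') B (cast_ord e a) (cast_ord e b)).
    move: B; case: _ / e => B; congr (\det _); apply/matrixP => a b.
    by rewrite mxE !cast_ord_id.
  rewrite mulrC -det_mulmx; congr (\det _); apply/matrixP => a b; rewrite !mxE.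
  rewrite (bigD1 (cast_ord (esym e) (join k p a))) //= !mxE cast_ordKV eqxx mul1r.
  rewrite big1 ?addr0 // => c h; rewrite !mxE (_ : _ == _ = false) ?mul0r //.
  by apply: contraNF h => /eqP ->; rewrite cast_ordK.
pose T (s : 'S_(i + i')) l p' := (-1) ^+ s *
  ((\prod_a B (k a) (l a)) * (\prod_a B (p a) (p' a)) *
   (\prod_(a < i) (l a == cast_ord e (s (lshift i' a)))%:R *
    \prod_(a < i') (p' a == cast_ord e (s (rshift i a)))%:R)).
transitivity (\sum_l \sum_p' \sum_s T s l p').
  apply: eq_bigr => l _; apply: eq_bigr => p' _; rewrite epsE mulr_sumr.
  by apply: eq_bigr => s _; rewrite /T mulrCA.
under eq_bigr => l _ do rewrite exchange_big /=.
rewrite exchange_big /=; apply: eq_bigr => s _.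
rewrite big_split_ord /=.
under [in RHS]eq_bigr do rewrite mxE join_lshift.
under [X in _ = _ * (_ * X)]eq_bigr do rewrite mxE join_rshift.
have pick j (r0 : {ffun 'I_j -> 'I_m}) (f : 'I_j -> 'I_(i + i')) :
  \prod_a B (r0 a) (cast_ord e (s (f a))) =
  \sum_(l : {ffun 'I_j -> 'I_m}) \prod_a (B (r0 a) (l a) * (l a == cast_ord e (s (f a)))%:R).
  rewrite -(bigA_distr_bigA (fun a x => B (r0 a) x * (x == cast_ord e (s (f a)))%:R)).
  apply: eq_bigr => a _; rewrite (bigD1 (cast_ord e (s (f a)))) //= eqxx mulr1.
  by rewrite big1 ?addr0 // => x /negbTE ->; rewrite mulr0.
rewrite !pick mulrCA mulr_suml mulr_sumr; apply: eq_bigr => l _.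
rewrite !mulr_sumr; apply: eq_bigr => q _.
have R5 (a b c d f : R) : f * (a * b * (c * d)) = a * c * (f * (b * d)) by ring.
by rewrite /T !big_split /=; exact: R5.
Qed.

(** Laplace duality: minors of an orthogonal matrix are det B times the
    complementary minors. It follows from the expansion of det for B^T by moving
    one block of factors to the other side with B B^T = 1. *)
Lemma eps_orthogonal B p l : B *m B^T = 1%:M ->
  \sum_(k : K) eps k p * \prod_a B (k a) (l a) =
  \det B * \sum_(q : K') (\prod_a B (p a) (q a)) * eps l q.
Proof.
move=> BBT; rewrite mulr_sumr.
under [RHS]eq_bigr => q _ do
  rewrite mulrCA -(det_tr B) -(eps_mulmx B^T l q) mulr_sumr.
rewrite exchange_big /=; apply: eq_bigr => k _.
under [RHS]eq_bigr => q _ do rewrite mulr_sumr.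
rewrite exchange_big /= (bigD1 p) //= [X in _ = _ + X]big1 ?addr0 => [|r0 qk].
  transitivity ((\prod_(a < i') (B *m B^T) (p a) (p a)) * (eps k p * \prod_a B (k a) (l a))).
    by rewrite [in RHS]big1 ?mul1r // => a _; rewrite BBT mxE eqxx.
  under [X in X * _ = _]eq_bigr do rewrite mxE.
  rewrite bigA_distr_bigA /= mulr_suml; apply: eq_bigr => q _.
  under [X in _ = _ * (X * _ * _)]eq_bigr do rewrite mxE.
  have R5 (a b c d : R) : a * b * (d * c) = a * (c * b * d) by ring.
  by rewrite big_split /=; exact: R5.
transitivity ((\sum_(q : K') \prod_a (B (p a) (q a) * B^T (q a) (r0 a))) *
  (\prod_a B^T (l a) (k a) * eps k r0)).
  have R5 (a b c d : R) : a * (c * b * d) = a * b * (c * d) by ring.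
  by rewrite mulr_suml; apply: eq_bigr => q _; rewrite big_split /=; exact: R5.
rewrite -(bigA_distr_bigA (fun a x => B (p a) x * B^T x (r0 a))).
have [a qa] : exists a, p a != r0 a.
  apply/existsP; rewrite -negb_forall; apply: contra qk => /forallP h.
  by apply/eqP/ffunP => a; rewrite (eqP (h a)).
rewrite (bigD1 a) //= (_ : \sum_x _ = (B *m B^T) (p a) (r0 a)); last by rewrite mxE.
by rewrite BBT mxE (negbTE qa) !mul0r.
Qed.

(** A word completed by the same p must use the same letters. *)
Lemma join_exchange k l p : injective (join k p) -> injective (join l p) ->
  exists s : 'S_i, l = [ffun a => k (s a)].
Proof.
move=> jk jl.
have key a : exists b, k b == l a.
  have /codomP [c] : l a \in codom (join k p).
    apply/inj_card_onto => //; by rewrite !card_ord e.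
  case: (split_ordP c) => b ->; first by rewrite join_lshift => ->; exists b.
  rewrite join_rshift => E; have := @jl (lshift i' a) (rshift i b).
  rewrite join_lshift join_rshift => /(_ E) /eqP; rewrite eq_sym eq_rlshift //.
pose f a := xchoose (key a).
have fE a : k (f a) = l a by exact/eqP/(xchooseP (key a)).
have finj : injective f.
  move=> a b fab; have := @jl (lshift i' a) (lshift i' b).
  by rewrite !join_lshift -!fE fab => /(_ erefl) /lshift_inj.
by exists (perm finj); apply/ffunP => a; rewrite ffunE permE fE.
Qed.

Lemma join_exchangeR k p q : injective (join k p) -> injective (join k q) ->
  exists s : 'S_i', q = [ffun a => p (s a)].
Proof.
move=> jk jl.
have key a : exists b, p b == q a.
  have /codomP [c] : q a \in codom (join k p).
    apply/inj_card_onto => //; by rewrite !card_ord e.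
  case: (split_ordP c) => b ->; last by rewrite join_rshift => ->; exists b.
  rewrite join_lshift => E; have := @jl (rshift i a) (lshift i' b).
  by rewrite join_lshift join_rshift => /(_ E) /eqP; rewrite eq_rlshift.
pose f a := xchoose (key a).
have fE a : p (f a) = q a by exact/eqP/(xchooseP (key a)).
have finj : injective f.
  move=> a b fab; have := @jl (rshift i a) (rshift i b).
  by rewrite !join_rshift -!fE fab => /(_ erefl) /rshift_inj.
by exists (perm finj); apply/ffunP => a; rewrite ffunE permE fE.
Qed.

End HodgeStar.

(** * The Hodge star on exterior powers *)

Section ExtpowFunctor.
Variables (R : realType) (m i : nat).
Implicit Types (A B : 'M[R]_m) (u : extpow R m i).

Lemma extpow_mapE B u k : extpow_map B u k =
  \sum_(l : {ffun 'I_i -> 'I_m}) (\prod_(a < i) (B (k a) (l a))%:C) * u l.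
Proof. by rewrite ffunE. Qed.

Lemma extpowP (u v : extpow R m i) : (forall k, u k = v k) -> u = v.
Proof. by move=> h; apply/val_inj/ffunP. Qed.

Lemma extpow_add (u v : extpow R m i) k : (u + v) k = u k + v k.
Proof. by rewrite ffunE. Qed.

Lemma extpow_scale (c : R[i]) u k : (c *: u) k = c * u k.
Proof. by rewrite ffunE. Qed.

Lemma extpow_lin (c : R[i]) (u v : extpow R m i) k : (c *: u + v) k = c * u k + v k.
Proof. by rewrite extpow_add extpow_scale. Qed.

Lemma extpow_map_comp A B u : extpow_map (A *m B) u = extpow_map A (extpow_map B u).
Proof.
apply: extpowP => k; rewrite !extpow_mapE.
under [RHS]eq_bigr do rewrite extpow_mapE mulr_sumr.
rewrite exchange_big /=; apply: eq_bigr => l _.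
under eq_bigr do rewrite mxE raddf_sum /=.
rewrite bigA_distr_bigA /= mulr_suml; apply: eq_bigr => p _.
rewrite mulrA -big_split /=; congr (_ * _).
by apply: eq_bigr => a _; rewrite rmorphM.
Qed.

Lemma extpow_map1 u : extpow_map 1%:M u = u.
Proof.
apply: extpowP => k; rewrite extpow_mapE (bigD1 k) //= big1 ?mul1r => [|a _].
  rewrite big1 ?addr0 // => l lk.
  have [a ka] : exists a, k a != l a.
    apply/existsP; rewrite -negb_forall; apply: contra lk => /forallP h.
    by apply/eqP/ffunP => a; rewrite (eqP (h a)).
  by rewrite (bigD1 a) //= mxE (negbTE ka) !mul0r.
by rewrite mxE eqxx.
Qed.

Lemma extpow_mapZ B (c : R[i]) u : extpow_map B (c *: u) = c *: extpow_map B u.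
Proof.
have h0 : extpow_map B 0 = 0 :> extpow R m i.
  by have := extpow_mapP B (-1) 0 (0 : extpow R m i); rewrite scaler0 addr0 scaleN1r addNr.
by have := extpow_mapP B c u 0; rewrite !addr0 h0 addr0.
Qed.

Lemma extpow_alternates u (s : 'S_i) (k : {ffun 'I_i -> 'I_m}) :
  u [ffun a => k (s a)] = (-1) ^+ s * u k.
Proof. by have /alternatingP := extpow_alt u; apply. Qed.

Lemma extpow_noninj u (k : {ffun 'I_i -> 'I_m}) : ~ injective k -> u k = 0.
Proof.
move=> nk; have [a [b [ab kab]]] : exists a b, a != b /\ k a = k b.
  apply: contrapT => h; apply: nk => a b kab; apply/eqP; apply: contraT => ab.
  by exfalso; apply: h; exists a, b.
have E : [ffun c => k (tperm a b c)] = k.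
  by apply/ffunP => c; rewrite ffunE; case: tpermP => // ->.
have := extpow_alternates u (tperm a b) k; rewrite E odd_tperm ab expr1 mulN1r.
move/eqP; rewrite -subr_eq0 opprK -mulr2n mulrn_eq0 /=.
by move/eqP.
Qed.

End ExtpowFunctor.

Section Star.
Variables (R : realType) (i i' m : nat) (e : (i + i' = m)%N).
Local Notation K := {ffun 'I_i -> 'I_m}.
Local Notation K' := {ffun 'I_i' -> 'I_m}.

(** The factor 1 / i! compensates for summing over all words k rather than over
    the increasing ones. *)
Definition star_coef (k : K) (p : K') : R := (i`!%:R)^-1 * eps R e k p.
Definition starinv_coef (k : K) (p : K') : R := (i'`!%:R)^-1 * eps R e k p.

Definition star_tensor (u : tensor R m i) : tensor R m i' :=
  [ffun p => \sum_k (star_coef k p)%:C * u k].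
Definition starinv_tensor (v : tensor R m i') : tensor R m i :=
  [ffun k => \sum_p (starinv_coef k p)%:C * v p].

Lemma star_tensor_alt u : star_tensor u \in @Defs.alternating R m i'.
Proof.
apply/alternatingP => s p; rewrite !ffunE mulr_sumr; apply: eq_bigr => k _.
by rewrite /star_coef eps_permR mulrCA rmorphM rmorphXn rmorphN1 mulrA.
Qed.

Lemma starinv_tensor_alt v : starinv_tensor v \in @Defs.alternating R m i.
Proof.
apply/alternatingP => s k; rewrite !ffunE mulr_sumr; apply: eq_bigr => p _.
by rewrite /starinv_coef eps_permL mulrCA rmorphM rmorphXn rmorphN1 mulrA.
Qed.

Definition star (u : extpow R m i) : extpow R m i' := Extpow (star_tensor_alt u).
Definition starinv (v : extpow R m i') : extpow R m i := Extpow (starinv_tensor_alt v).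

Lemma starE u p : star u p = \sum_k (star_coef k p)%:C * u k.
Proof. by rewrite ffunE. Qed.

Lemma starinvE v k : starinv v k = \sum_p (starinv_coef k p)%:C * v p.
Proof. by rewrite ffunE. Qed.

Lemma star_linear : linear star.
Proof.
move=> a u v; apply: extpowP => p.
rewrite extpow_add extpow_scale !starE mulr_sumr -big_split /=.
by apply: eq_bigr => k _; rewrite (extpow_lin a u v) mulrDr mulrCA.
Qed.

Lemma starinv_linear : linear starinv.
Proof.
move=> a u v; apply: extpowP => p.
rewrite extpow_add extpow_scale !starinvE mulr_sumr -big_split /=.
by apply: eq_bigr => k _; rewrite (extpow_lin a u v) mulrDr mulrCA.
Qed.

(** Reduces a sum over words to the orderings of a fixed set of letters. *)
Let sum_perm_inj j (k : {ffun 'I_j -> 'I_m}) (F : {ffun 'I_j -> 'I_m} -> R[i]) C :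
  injective k ->
  (forall s : 'S_j, F [ffun a => k (s a)] = C) ->
  (forall l, F l != 0 -> exists s : 'S_j, l = [ffun a => k (s a)]) ->
  \sum_l F l = j`!%:R * C.
Proof.
move=> kinj FC Fs.
pose f (s : 'S_j) : {ffun 'I_j -> 'I_m} := [ffun a => k (s a)].
have finj : injective f.
  by move=> s t /ffunP st; apply/permP => a; apply: kinj; have := st a; rewrite !ffunE.
rewrite (bigID (fun l => l \in [set f s | s in predT]%SET)) /= [X in _ + X]big1 ?addr0.
  rewrite big_imset /=; last by move=> s t _ _; exact: finj.
  under eq_bigr do rewrite FC.
  by rewrite sumr_const card_Sn mulr_natl.
move=> l; apply: contraNeq => /Fs [s ->].
by apply/imsetP; exists s.
Qed.

(** By alternation all orderings of the letters complementary to p contribute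
    the same amount, which 1 / i! averages. *)
Lemma star_at (u : extpow R m i) k p : injective (join k p) ->
  star u p = (eps R e k p)%:C * u k.
Proof.
move=> jk; rewrite starE.
rewrite (@sum_perm_inj _ k _ ((i`!%:R)^-1 * ((eps R e k p)%:C * u k))).
- by rewrite mulrA divff ?mul1r.
- by move=> a b kab; apply: (@lshift_inj _ i'); apply: jk; rewrite !join_lshift.
- move=> s; rewrite /star_coef eps_permL extpow_alternates.
  rewrite rmorphM fmorphV rmorph_nat rmorphM rmorphXn rmorphN1.
  have R5 (a b c d : R[i]) : a * (b * c) * (b * d) = b ^+ 2 * (a * (c * d)) by ring.
  by rewrite R5 sqrr_sign mul1r.
- move=> l; rewrite mulf_eq0 negb_or => /andP[h _].
  apply: (@join_exchange i i' m e k l p) => //; apply: (@eps_inj R i i' m e).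
  by apply: contraNneq h; rewrite /star_coef => ->; rewrite mulr0.
Qed.

Lemma starinv_at (v : extpow R m i') k p : injective (join k p) ->
  starinv v k = (eps R e k p)%:C * v p.
Proof.
move=> jk; rewrite starinvE.
rewrite (@sum_perm_inj _ p _ ((i'`!%:R)^-1 * ((eps R e k p)%:C * v p))).
- by rewrite mulrA divff ?mul1r.
- by move=> a b kab; apply: (@rshift_inj i); apply: jk; rewrite !join_rshift.
- move=> s; rewrite /starinv_coef eps_permR extpow_alternates.
  rewrite rmorphM fmorphV rmorph_nat rmorphM rmorphXn rmorphN1.
  have R5 (a b c d : R[i]) : a * (b * c) * (b * d) = b ^+ 2 * (a * (c * d)) by ring.
  by rewrite R5 sqrr_sign mul1r.
- move=> l; rewrite mulf_eq0 negb_or => /andP[h _].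
  apply: (@join_exchangeR i i' m e k p l) => //; apply: (@eps_inj R i i' m e).
  by apply: contraNneq h; rewrite /starinv_coef => ->; rewrite mulr0.
Qed.

Let complement j j' (k : {ffun 'I_j -> 'I_m}) : (j + j' = m)%N -> injective k ->
  exists p : {ffun 'I_j' -> 'I_m}, injective p /\ forall a b, k a <> p b.
Proof.
move=> ejj kinj; pose A := [predC codom k].
have cA : #|A| = j'.
  have E := cardC (mem (codom k)); apply: (@addnI j); rewrite ejj.
  rewrite card_codom // [#|'I_j|]card_ord [RHS]card_ord in E; apply: etrans E; congr (_ + _)%N.
exists [ffun a => enum_val (cast_ord (esym cA) a)]; split=> [a b|a b].
  by rewrite !ffunE => /enum_val_inj /cast_ord_inj.
rewrite ffunE => E; have := enum_valP (cast_ord (esym cA) b).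
by rewrite -E inE /= codom_f.
Qed.

Let join_inj (k : K) (p : K') : injective k -> injective p ->
  (forall a b, k a <> p b) -> injective (join k p).
Proof.
move=> kinj pinj kp a b; case: (split_ordP a) => a' ->; case: (split_ordP b) => b' ->;
  rewrite ?join_lshift ?join_rshift.
- by move/kinj ->.
- by move/kp.
- by move/esym/kp.
- by move/pinj ->.
Qed.

Let eps2 (k : K) (p : K') (z : R[i]) : injective (join k p) ->
  (eps R e k p)%:C * ((eps R e k p)%:C * z) = z.
Proof. by move=> j; rewrite mulrA -rmorphM -expr2 eps_sq // mul1r. Qed.

(** At an injective word k choose p complementary to k; then the two stars
    multiply the coordinate by eps k p twice, and this sign has square 1. *)
Lemma starK : cancel star starinv.
Proof.
move=> u; apply: extpowP => k; have [kinj|nk] := pselect (injective k).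
  have [p [pinj kp]] := complement e kinj.
  by have j := join_inj kinj pinj kp; rewrite (starinv_at _ j) (star_at _ j) eps2.
by rewrite !extpow_noninj.
Qed.

Lemma starinvK : cancel starinv star.
Proof.
move=> v; apply: extpowP => p; have [pinj|np] := pselect (injective p).
  have [k [kinj kp]] := complement (etrans (addnC i' i) e) pinj.
  have j : injective (join k p) by apply: join_inj => // a b ab; exact: (kp b a).
  by rewrite (star_at _ j) (starinv_at _ j) eps2.
by rewrite !extpow_noninj.
Qed.

(** This factor det B is why the star operators on sections have to be twisted by
    the determinant of the group element. *)
Lemma star_map B (u : extpow R m i) : B *m B^T = 1%:M ->
  star (extpow_map B u) = (\det B)%:C *: extpow_map B (star u).
Proof.
move=> BBT; apply: extpowP => p; rewrite extpow_scale extpow_mapE starE.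
under [X in _ = _ * X]eq_bigr do rewrite starE mulr_sumr.
under [LHS]eq_bigr do rewrite extpow_mapE mulr_sumr.
rewrite exchange_big /= [X in _ = _ * X]exchange_big /= mulr_sumr; apply: eq_bigr => l _.
under [LHS]eq_bigr do rewrite mulrA.
under [X in _ = _ * X]eq_bigr do rewrite mulrA.
rewrite -!mulr_suml mulrA; congr (_ * _).
have := congr1 (fun x : R => ((i`!%:R)^-1 * x)%:C) (@eps_orthogonal R i i' m e B p l BBT).
rewrite /= mulr_sumr rmorph_sum /= => E; apply: etrans (etrans E _).
  apply: eq_bigr => k _; rewrite /star_coef -rmorph_prod -rmorphM; congr (_%:C); ring.
rewrite mulrCA rmorphM /=; congr (_ * _).
rewrite mulr_sumr rmorph_sum; apply: eq_bigr => q _.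
rewrite /star_coef -rmorph_prod -!rmorphM; congr (_%:C); ring.
Qed.

Lemma starinv_map B (v : extpow R m i') : B *m B^T = 1%:M ->
  starinv (extpow_map B v) = (\det B)%:C *: extpow_map B (starinv v).
Proof.
move=> BBT; apply: (can_inj starK); rewrite starinvK.
have := star_linear (\det B)%:C (extpow_map B (starinv v)) 0.
have s0 : star 0 = 0 by have := star_linear (-1) 0 0; rewrite scaler0 addr0 scaleN1r addNr.
rewrite addr0 s0 addr0 => ->; rewrite star_map // starinvK scalerA -rmorphM.
have : \det (B *m B^T) = 1 by rewrite BBT det1.
by rewrite det_mulmx det_tr => ->; rewrite scale1r.
Qed.

End Star.

(** * The Lorentz group in a null frame *)

Section MatrixIdentities.
Variable R : realType.

Lemma invmx_eq m (A B : 'M[R]_m) : A *m B = 1%:M -> invmx A = B.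
Proof.
by move=> AB; have [uA _] := mulmx1_unit AB; rewrite -[LHS]mulmx1 -AB mulKmx.
Qed.

Lemma invmx_mul m (A B : 'M[R]_m) : A \in unitmx -> B \in unitmx ->
  invmx (A *m B) = invmx B *m invmx A.
Proof. by move=> uA uB; apply: invmx_eq; rewrite !mulmxA mulmxK // mulmxV. Qed.

Lemma invmx_involution m (A : 'M[R]_m) : A *m A = 1%:M -> invmx A = A.
Proof. exact: invmx_eq. Qed.

Lemma trD m k (A B : 'M[R]_(m, k)) : (A + B)^T = A^T + B^T. Proof. exact: linearD. Qed.
Lemma trB m k (A B : 'M[R]_(m, k)) : (A - B)^T = A^T - B^T. Proof. exact: linearB. Qed.
Lemma trN m k (A : 'M[R]_(m, k)) : (- A)^T = - A^T. Proof. exact: linearN. Qed.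
Lemma trZ m k c (A : 'M[R]_(m, k)) : (c *: A)^T = c *: A^T. Proof. exact: linearZ. Qed.

Lemma mxD m k (A B : 'M[R]_(m, k)) p q : (A + B) p q = A p q + B p q. Proof. by rewrite mxE. Qed.
Lemma mxN m k (A : 'M[R]_(m, k)) p q : (- A) p q = - A p q. Proof. by rewrite mxE. Qed.
Lemma mxZ m k c (A : 'M[R]_(m, k)) p q : (c *: A) p q = c * A p q. Proof. by rewrite mxE. Qed.

Lemma mulmx_2 m (A : 'M[R]_(m, 1)) : A *m 2%:M = 2 *: A.
Proof. by rewrite mul_mx_scalar. Qed.

End MatrixIdentities.

Definition mxlinE := (mxD, mxN, mxZ).
Definition mx0E := (oppr0, mulmx0, mul0mx, scaler0, addr0, add0r, subr0, sub0r, mulmx1, mul1mx).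

Section LorentzAlgebra.
Variables (R : realType) (n : nat).
Local Notation M := 'M[R]_n.+2.
Implicit Types (g h X : M) (B C : 'M[R]_n) (v w : 'cV[R]_n) (b t : R).

Definition mid (k : 'I_n) : 'I_n.+2 := lift ord0 (widen_ord (leqnSn n) k).
(** The null frame: xi spans the line fixed by P, eta the opposite null line, and
    the columns of iota_mx are the basis vectors e_1, ..., e_n between them. All
    constants are locked, as unfolding them makes unification very slow. *)
Definition xi : 'cV[R]_n.+2 := locked (basis_vec R ord0 + basis_vec R ord_max).
Definition eta : 'cV[R]_n.+2 := locked (basis_vec R ord0 - basis_vec R ord_max).
(** Conjugating by this matrix embeds n x n matrices as the middle block. *)
Definition iota_mx : 'M[R]_(n.+2, n) := locked (\matrix_(p, k) (p == mid k)%:R).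
Let ioE p k : iota_mx p k = (p == mid k)%:R. Proof. by rewrite /iota_mx -lock mxE. Qed.
Definition J : M := locked (1%:M - 2 *: delta_mx ord_max ord_max).
Local Notation io := iota_mx.

Let e0m : (ord0 == ord_max :> 'I_n.+2) = false. Proof. by []. Qed.
Let em0 : (ord_max == ord0 :> 'I_n.+2) = false. Proof. by []. Qed.

Lemma mid_neqmax k : (mid k == ord_max) = false.
Proof. by rewrite -val_eqE /= /bump /= add1n eqSS ltn_eqF. Qed.
Lemma mid_inj : injective mid.
Proof. by move=> k l /lift_inj /(congr1 val) /= h; exact: val_inj. Qed.

Let xiE : xi = basis_vec R ord0 + basis_vec R ord_max. Proof. by rewrite /xi -lock. Qed.
Let etaE : eta = basis_vec R ord0 - basis_vec R ord_max. Proof. by rewrite /eta -lock. Qed.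
Let JE : J = 1%:M - 2 *: delta_mx ord_max ord_max. Proof. by rewrite /J -lock. Qed.

Let xiT : xi^T = delta_mx ord0 ord0 + delta_mx ord0 ord_max.
Proof. by rewrite xiE trD !trmx_delta. Qed.
Let etaT : eta^T = delta_mx ord0 ord0 - delta_mx ord0 ord_max.
Proof. by rewrite etaE trB !trmx_delta. Qed.

Let dd (p q : 'I_n.+2) : (delta_mx ord0 p : 'rV[R]_n.+2) *m (delta_mx q ord0 : 'cV[R]_n.+2) = ((p == q)%:R)%:M.
Proof.
rewrite mul_delta_mx_cond; apply/matrixP => a c.
by rewrite !ord1 !mxE eqxx; case: (p == q); rewrite ?mulr0n ?mulr1n !mxE ?eqxx.
Qed.

Lemma xixi : xi^T *m xi = 2%:M.
Proof.
rewrite xiT xiE /basis_vec mulmxDl !mulmxDr !dd !eqxx e0m em0 /= !raddf0 addr0 add0r.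
by rewrite -raddfD.
Qed.
Lemma xieta : xi^T *m eta = 0.
Proof.
rewrite xiT etaE /basis_vec mulmxDl !mulmxBr !dd !eqxx e0m em0 /= !raddf0 ?oppr0 addr0 add0r.
by rewrite subrr.
Qed.
Lemma etaxi : eta^T *m xi = 0.
Proof.
rewrite etaT xiE /basis_vec mulmxBl !mulmxDr !dd !eqxx e0m em0 /= !raddf0 addr0 add0r.
by rewrite subrr.
Qed.
Lemma etaeta : eta^T *m eta = 2%:M.
Proof.
rewrite etaT etaE /basis_vec mulmxBl !mulmxBr !dd !eqxx e0m em0 /= !raddf0 ?oppr0 addr0 add0r.
by rewrite opprK -raddfD.
Qed.

Let io_delta p : (forall k, (mid k == p) = false) -> io^T *m (delta_mx p ord0 : 'cV[R]_n.+2) = 0.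
Proof.
move=> h; apply/matrixP => k c; rewrite !mxE big1 // => q _; rewrite !mxE ioE.
by case: eqP => [->|]; rewrite ?mul0r // h mul1r.
Qed.
Lemma ioxi : io^T *m xi = 0.
Proof. by rewrite xiE mulmxDr !io_delta ?addr0 // => k; exact: mid_neqmax. Qed.
Lemma ioeta : io^T *m eta = 0.
Proof. by rewrite etaE mulmxBr !io_delta ?subr0 // => k; exact: mid_neqmax. Qed.
Lemma xiio : xi^T *m io = 0.
Proof. by apply: trmx_inj; rewrite trmx_mul trmxK ioxi trmx0. Qed.
Lemma etaio : eta^T *m io = 0.
Proof. by apply: trmx_inj; rewrite trmx_mul trmxK ioeta trmx0. Qed.
Lemma ioio : io^T *m io = 1%:M.
Proof.
apply/matrixP => k l; rewrite !mxE (bigD1 (mid k)) //= big1 ?addr0 => [|q /negbTE h].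
  by rewrite !mxE !ioE eqxx mul1r (inj_eq mid_inj).
by rewrite !mxE !ioE h mul0r.
Qed.

Lemma iota_sandwich B : io *m B *m io^T = \sum_(k < n) \sum_(l < n) B k l *: delta_mx (mid k) (mid l).
Proof.
apply/matrixP => p q; rewrite summxE mxE.
under [RHS]eq_bigr do rewrite summxE.
rewrite exchange_big /=; apply: eq_bigr => l _; rewrite mxE mulr_suml.
apply: eq_bigr => k _; rewrite !mxE !ioE.
by case: (p == mid k); case: (q == mid l); rewrite /= ?mulr1 ?mul1r ?mulr0 ?mul0r.
Qed.

Let xx_ee : xi *m xi^T + eta *m eta^T = 2 *: (delta_mx ord0 ord0 + delta_mx ord_max ord_max).
Proof.
rewrite xiT etaT xiE etaE /basis_vec !mulmxDl !mulmxDr !mulmxN !mulNmx !mul_delta_mx opprK.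
set a := delta_mx _ _; set c := delta_mx _ _; set d := delta_mx _ _; set f := delta_mx _ _.
by apply/matrixP => p q; rewrite !mxlinE; ring.
Qed.

Lemma diag3E b B : diag3 b B = (b / 2) *: (xi *m xi^T + eta *m eta^T) + io *m B *m io^T.
Proof. by rewrite xx_ee iota_sandwich scalerA mulfVK. Qed.

Lemma diag3_1 : diag3 1 1%:M = 1%:M :> M.
Proof.
rewrite diag3E xx_ee iota_sandwich scalerA mulfVK // scale1r.
have -> : (1%:M : M) = \sum_p delta_mx p p.
  apply/matrixP => p q; rewrite summxE (bigD1 p) //= big1 ?addr0 => [|r /negbTE h].
    by rewrite !mxE eqxx eq_sym.
  by rewrite mxE eq_sym h.
rewrite big_ord_recl big_ord_recr /= -addrA; congr (_ + _); rewrite addrC.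
congr (_ + _).
  apply: eq_bigr => k _; rewrite (bigD1 k) //= mxE eqxx scale1r big1 ?addr0 // => l /negbTE h.
  by rewrite mxE eq_sym h scale0r.
Qed.

Lemma resolution : 2^-1 *: (xi *m xi^T + eta *m eta^T) + io *m io^T = 1%:M.
Proof. by rewrite -diag3_1 diag3E mulmx1 mul1r. Qed.

(** Identities between matrices are checked on the frame, where all generators of
    the group act by short formulas. *)
Lemma mx_ext3 m (A A' : 'M[R]_(m, n.+2)) :
  A *m xi = A' *m xi -> A *m eta = A' *m eta -> A *m io = A' *m io -> A = A'.
Proof.
move=> h1 h2 h3; rewrite -[A]mulmx1 -[A']mulmx1 -resolution.
by rewrite !mulmxDr -!scalemxAr !mulmxDr !mulmxA h1 h2 h3.
Qed.

Lemma H0E : H0 R n = 2^-1 *: (xi *m xi^T - eta *m eta^T).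
Proof.
rewrite xiT etaT xiE etaE /basis_vec /H0 !mulmxDl !mulmxDr !mulmxN !mulNmx !mul_delta_mx opprK.
set a := delta_mx _ _; set c := delta_mx _ _; set d := delta_mx ord_max _; set f := delta_mx ord0 _.
by apply/matrixP => p q; rewrite !mxlinE; field.
Qed.

Lemma J_xi : J *m xi = eta.
Proof.
rewrite JE mulmxBl mul1mx -scalemxAl xiE etaE /basis_vec mulmxDr !mul_delta_mx_cond em0 eqxx.
by rewrite mulr0n mulr1n add0r scaler_nat mulr2n opprD addrA addrK.
Qed.
Lemma J_eta : J *m eta = xi.
Proof.
rewrite JE mulmxBl mul1mx -scalemxAl xiE etaE /basis_vec mulmxBr !mul_delta_mx_cond em0 eqxx.
by rewrite mulr0n mulr1n sub0r scalerN opprK scaler_nat mulr2n addrA subrK.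
Qed.
Lemma J_io : J *m io = io.
Proof.
rewrite JE mulmxBl mul1mx -scalemxAl.
suff -> : (delta_mx ord_max ord_max : M) *m io = 0 by rewrite scaler0 subr0.
apply/matrixP => p k; rewrite !mxE big1 // => q _; rewrite !mxE ioE.
by case: (q =P mid k) => [->|]; rewrite ?mulr0 // mid_neqmax andbF mul0r.
Qed.

Lemma J_tr : J^T = J.
Proof. by rewrite JE trB trmx1 trZ trmx_delta. Qed.
Lemma JJ : J *m J = 1%:M.
Proof. by apply: mx_ext3; rewrite -mulmxA ?(J_xi, J_eta, J_io) mul1mx. Qed.
Lemma xiJ : xi^T *m J = eta^T.
Proof. by rewrite -J_xi trmx_mul J_tr. Qed.
Lemma etaJ : eta^T *m J = xi^T.
Proof. by rewrite -J_eta trmx_mul J_tr. Qed.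
Lemma ioJ : io^T *m J = io^T.
Proof. by rewrite -{2}J_io trmx_mul J_tr. Qed.

Lemma qformE x : qform x = (x^T *m J *m x) ord0 ord0.
Proof.
have -> : (x^T *m J *m x) ord0 ord0 = (x^T *m x) ord0 ord0 -
    2 * (x^T *m delta_mx ord_max ord_max *m x) ord0 ord0.
  rewrite JE mulmxBr mulmx1 mulmxBl -scalemxAr -scalemxAl.
  by move: (x^T *m x) (x^T *m _ *m x) => A B; rewrite !mxE.
rewrite [X in X - _]mxE big_ord_recr /=.
rewrite (_ : (x^T *m delta_mx ord_max ord_max *m x) ord0 ord0 = x ord_max ord0 ^+ 2); last first.
  rewrite mxE (bigD1 ord_max) //= big1 ?addr0 => [|p /negbTE h].
    rewrite mxE (bigD1 ord_max) //= big1 ?addr0 => [|p /negbTE h]; last by rewrite !mxE h mulr0.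
    by rewrite !mxE !eqxx mulr1 expr2.
  rewrite mxE big1 ?mul0r // => q _; by rewrite !mxE h andbF mulr0.
under [in RHS]eq_bigr do rewrite mxE -expr2.
by rewrite /qform mxE; ring.
Qed.

(** By polarization a quadratic form determines its symmetric matrix, here
    g^T J g - J. *)
Lemma lorentzP g : lorentz n g <-> g^T *m J *m g = J.
Proof.
split=> [h|h x]; last first.
  by rewrite !qformE trmx_mul !mulmxA -(mulmxA (x^T)) -(mulmxA (x^T)) h.
pose D := g^T *m J *m g - J.
have DT : D^T = D by rewrite /D trB !trmx_mul trmxK J_tr mulmxA.
have D0 (x : 'cV[R]_n.+2) : (x^T *m D *m x) ord0 ord0 = 0.
  have := h x; rewrite !qformE trmx_mul => hx.
  have -> : x^T *m D *m x = x^T *m g^T *m J *m (g *m x) - x^T *m J *m x.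
    by rewrite /D mulmxBr mulmxBl !mulmxA.
  by rewrite mxD mxN hx subrr.
suff : D = 0 by move/eqP; rewrite subr_eq0 => /eqP.
clearbody D; apply/matrixP => p q.
have E (x y : 'I_n.+2) : ((delta_mx x ord0 : 'cV[R]_n.+2)^T *m D *m (delta_mx y ord0 : 'cV[R]_n.+2)) ord0 ord0 = D x y.
  by rewrite trmx_delta -rowE -colE !mxE.
have := D0 (delta_mx p ord0 + delta_mx q ord0).
have := D0 (delta_mx p ord0); have := D0 (delta_mx q ord0).
rewrite trD !mulmxDl !mulmxDr !mxD !E => -> ->.
have -> : D q p = D p q by rewrite -{1}DT mxE.
by rewrite add0r addr0 -mulr2n => /eqP; rewrite mulrn_eq0 /= mxE => /eqP.
Qed.

Lemma lorentz_1 : lorentz n (1%:M : M).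
Proof. by apply/lorentzP; rewrite trmx1 mul1mx mulmx1. Qed.

Lemma lorentz_mul g h : lorentz n g -> lorentz n h -> lorentz n (g *m h).
Proof. by move=> lg lh x; rewrite -mulmxA lg lh. Qed.

Lemma lorentz_invE g : lorentz n g -> g \in unitmx /\ invmx g = J *m g^T *m J.
Proof.
move/lorentzP => h; have h1 : (J *m g^T *m J) *m g = 1%:M by rewrite -!mulmxA (mulmxA g^T) h JJ.
have [_ ug] := mulmx1_unit h1; split => //.
by rewrite -[RHS](mulmxK ug) h1 mul1mx.
Qed.

Lemma lorentz_inv g : lorentz n g -> lorentz n (invmx g).
Proof. by move=> lg x; have [ug _] := lorentz_invE lg; rewrite -[in RHS](mulKVmx ug x) lg. Qed.

Lemma lorentz_det g : lorentz n g -> \det g = 1 \/ \det g = -1.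
Proof.
move/lorentzP => h; have := congr1 determinant h; rewrite !det_mulmx det_tr.
have dJ : \det J != 0 by have [u _] := mulmx1_unit JJ; rewrite -unitfE -unitmxE.
rewrite mulrAC -[RHS]mul1r => /(mulIf dJ) /eqP; rewrite -expr2 sqrf_eq1.
by case/orP => /eqP; [left|right].
Qed.

(** The exponential of the element of n_+ with parameter v, and its conjugate by
    J, which lies in the opposite unipotent group N_-. *)
Definition np v : M := locked (
  1%:M + xi *m v^T *m io^T - io *m v *m eta^T - 2^-1 *: (xi *m (v^T *m v) *m eta^T)).
Definition nm v : M := locked (J *m np v *m J).
Lemma nm_def v : nm v = J *m np v *m J. Proof. by rewrite /nm -lock. Qed.
Definition boost t : M := locked (
  (expR t / 2) *: (xi *m xi^T) + (expR (- t) / 2) *: (eta *m eta^T) + io *m io^T).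

Lemma npE v : np v = 1%:M + xi *m v^T *m io^T - io *m v *m eta^T - 2^-1 *: (xi *m (v^T *m v) *m eta^T).
Proof. by rewrite /np -lock. Qed.
Lemma boostE t : boost t = (expR t / 2) *: (xi *m xi^T) + (expR (- t) / 2) *: (eta *m eta^T) + io *m io^T.
Proof. by rewrite /boost -lock. Qed.

Definition frameE := (xixi, xieta, etaxi, etaeta, ioxi, ioeta, xiio, etaio, ioio).

Lemma np_xi v : np v *m xi = xi.
Proof.
rewrite npE !mulmxBl mulmxDl mul1mx -scalemxAl -!mulmxA !frameE !mx0E.
by [].
Qed.
Lemma np_io v : np v *m io = io + xi *m v^T.
Proof.
rewrite npE !mulmxBl mulmxDl mul1mx -scalemxAl -!mulmxA !frameE !mx0E.
by [].
Qed.
Lemma np_eta v : np v *m eta = eta - 2 *: (io *m v) - xi *m (v^T *m v).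
Proof.
rewrite npE !mulmxBl mulmxDl mul1mx -scalemxAl -!mulmxA !frameE !mx0E.
by rewrite !mulmxA !mulmx_2 scalerA mulVf // scale1r.
Qed.

Let sym11 v w : w^T *m v = v^T *m w.
Proof.
have T1 (A : 'M[R]_1) : A^T = A by rewrite [A]mx11_scalar tr_scalar_mx.
by rewrite -[LHS]T1 trmx_mul trmxK.
Qed.

Lemma np_add v w : np (v + w) = np v *m np w.
Proof.
apply: mx_ext3; rewrite -mulmxA ?np_xi ?np_io ?np_eta //.
  rewrite !mulmxBr -scalemxAr !mulmxA np_xi.
 rewrite np_eta np_io mulmxDl.
  have S : xi *m w^T *m v = xi *m v^T *m w by rewrite -!mulmxA sym11.
  rewrite trD !(mulmxDl, mulmxDr) S !scalerDr !mulmxA.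
  by apply/matrixP => p q; rewrite !mxlinE; ring.
by rewrite mulmxDr np_io mulmxA np_xi trD mulmxDr addrA.
Qed.

Lemma np_0 : np 0 = 1%:M.
Proof. by rewrite npE trmx0 !mulmx0 !mul0mx scaler0 addr0 !subr0. Qed.

Lemma np_tr v : (np v)^T = J *m np (- v) *m J.
Proof.
have npT : (np v)^T = 1%:M + io *m v *m xi^T - eta *m v^T *m io^T - 2^-1 *: (eta *m (v^T *m v) *m xi^T).
  by rewrite npE !(trD, trN, trZ) !trmx_mul !trmxK trmx1 !mulmxA.
apply: mx_ext3; rewrite -[in RHS]mulmxA -[in RHS]mulmxA ?(J_xi, J_eta, J_io) ?np_xi ?np_eta ?np_io.
all: rewrite npT !(mulmxDl, mulNmx) mul1mx -scalemxAl -!mulmxA !frameE !mx0E.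
- rewrite !mulmxA !mulmx_2 !mulmxBr -!scalemxAr J_eta !mulmxA J_io J_xi scalerA mulVf // scale1r.
  rewrite !mulmxN -!mulmxA [(- v)^T]raddfN /= !mulNmx !mulmxN opprK !mulmxA.
  by apply/matrixP => p q; rewrite !mxlinE; ring.
- by rewrite J_xi.
- by rewrite mulmxDr J_io mulmxA J_xi raddfN /= mulmxN.
Qed.

Lemma lorentz_np v : lorentz n (np v).
Proof.
apply/lorentzP; rewrite np_tr -!mulmxA (mulmxA J J) JJ mul1mx -np_add addNr np_0.
by rewrite mulmx1.
Qed.

Lemma J_lorentz : lorentz n J.
Proof. by apply/lorentzP; rewrite J_tr JJ mul1mx. Qed.

Lemma lorentz_nm v : lorentz n (nm v).
Proof.
by rewrite nm_def; apply: lorentz_mul J_lorentz; apply: lorentz_mul; [exact: J_lorentz|exact: lorentz_np].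
Qed.

Lemma nm_add v w : nm (v + w) = nm v *m nm w.
Proof. by rewrite !nm_def np_add -!mulmxA (mulmxA J J) JJ mul1mx. Qed.
Lemma nm_0 : nm 0 = 1%:M.
Proof. by rewrite nm_def np_0 mulmx1 JJ. Qed.
Lemma nm_xi v : nm v *m xi = xi - 2 *: (io *m v) - eta *m (v^T *m v).
Proof. by rewrite nm_def -!mulmxA J_xi np_eta !mulmxBr -scalemxAr !mulmxA J_eta J_io J_xi. Qed.
Lemma nm_eta v : nm v *m eta = eta.
Proof. by rewrite nm_def -!mulmxA J_eta np_xi J_xi. Qed.
Lemma nm_io v : nm v *m io = io + eta *m v^T.
Proof. by rewrite nm_def -!mulmxA J_io np_io mulmxDr mulmxA J_io J_xi. Qed.

Lemma boost_xi t : boost t *m xi = expR t *: xi.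
Proof.
rewrite boostE !mulmxDl -!scalemxAl -!mulmxA !frameE !mx0E mulmx_2.
by rewrite scalerA mulfVK.
Qed.
Lemma boost_eta t : boost t *m eta = expR (- t) *: eta.
Proof.
rewrite boostE !mulmxDl -!scalemxAl -!mulmxA !frameE !mx0E mulmx_2.
by rewrite scalerA mulfVK.
Qed.
Lemma boost_io t : boost t *m io = io.
Proof. by rewrite boostE !mulmxDl -!scalemxAl -!mulmxA !frameE !mx0E. Qed.

Lemma diag3_xi b B : diag3 b B *m xi = b *: xi.
Proof.
rewrite diag3E !mulmxDl -!scalemxAl mulmxDl -!mulmxA !frameE !mx0E mulmx_2.
by rewrite scalerA mulfVK.
Qed.
Lemma diag3_eta b B : diag3 b B *m eta = b *: eta.
Proof.
rewrite diag3E !mulmxDl -!scalemxAl mulmxDl -!mulmxA !frameE !mx0E mulmx_2.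
by rewrite scalerA mulfVK.
Qed.
Lemma diag3_io b B : diag3 b B *m io = io *m B.
Proof.
by rewrite diag3E !mulmxDl -!scalemxAl mulmxDl -!mulmxA !frameE !mx0E.
Qed.

Lemma H0_xi : H0 R n *m xi = xi.
Proof.
rewrite H0E -scalemxAl mulmxBl -!mulmxA !frameE !mx0E mulmx_2.
by rewrite scalerA mulVf ?scale1r.
Qed.
Lemma H0_eta : H0 R n *m eta = - eta.
Proof.
rewrite H0E -scalemxAl mulmxBl -!mulmxA !frameE !mx0E mulmx_2.
by rewrite scalerN scalerA mulVf ?scale1r.
Qed.
Lemma H0_io : H0 R n *m io = 0.
Proof. by rewrite H0E -scalemxAl mulmxBl -!mulmxA !frameE !mx0E. Qed.

Lemma expm_H0 t : expm (t *: H0 R n) = boost t.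
Proof.
apply: mx_ext3; rewrite ?boost_xi ?boost_eta ?boost_io.
- by apply: expm_eigen; rewrite -scalemxAl H0_xi.
- by apply: expm_eigen; rewrite -scalemxAl H0_eta scalerN scaleNr.
- rewrite -[RHS]scale1r -expR0; apply: expm_eigen.
  by rewrite -scalemxAl H0_io scaler0 scale0r.
Qed.

Lemma boost_add t s : boost (t + s) = boost t *m boost s.
Proof.
apply: mx_ext3; rewrite -mulmxA ?boost_xi ?boost_eta ?boost_io //.
  by rewrite -scalemxAr boost_xi scalerA -expRD addrC.
by rewrite -scalemxAr boost_eta scalerA -expRD opprD addrC.
Qed.
Lemma boost_0 : boost 0 = 1%:M.
Proof. by apply: mx_ext3; rewrite ?boost_xi ?boost_eta ?boost_io mul1mx // ?oppr0 expR0 scale1r. Qed.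

Lemma diag3_mul b B c C : diag3 b B *m diag3 c C = diag3 (b * c) (B *m C).
Proof.
apply: mx_ext3; rewrite -mulmxA ?diag3_xi ?diag3_eta ?diag3_io.
- by rewrite -scalemxAr diag3_xi scalerA mulrC.
- by rewrite -scalemxAr diag3_eta scalerA mulrC.
- by rewrite mulmxA diag3_io mulmxA.
Qed.

Lemma diag3_boost b B t : diag3 b B *m boost t = boost t *m diag3 b B.
Proof.
apply: mx_ext3; rewrite -!mulmxA ?diag3_xi ?diag3_eta ?diag3_io ?boost_xi ?boost_eta ?boost_io.
- by rewrite -!scalemxAr diag3_xi boost_xi !scalerA mulrC.
- by rewrite -!scalemxAr diag3_eta boost_eta !scalerA mulrC.
- by rewrite diag3_io mulmxA boost_io.
Qed.

Lemma diag3_H0 b B : diag3 b B *m H0 R n = H0 R n *m diag3 b B.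
Proof.
apply: mx_ext3; rewrite -!mulmxA ?diag3_xi ?diag3_eta ?diag3_io ?H0_xi ?H0_eta ?H0_io.
- by rewrite -!scalemxAr diag3_xi H0_xi.
- by rewrite -!scalemxAr mulmxN diag3_eta H0_eta scalerN.
- by rewrite mulmx0 mulmxA H0_io mul0mx.
Qed.

Lemma diag3_tr b B : (diag3 b B)^T = diag3 b B^T :> M.
Proof.
by rewrite !diag3E !(trD, trZ) !trmx_mul !trmxK mulmxA.
Qed.

Lemma diag3_J b B : J *m diag3 b B *m J = diag3 b B.
Proof.
apply: mx_ext3; rewrite -!mulmxA ?J_xi ?J_eta ?J_io ?diag3_xi ?diag3_eta ?diag3_io.
- by rewrite -scalemxAr J_eta.
- by rewrite -scalemxAr J_xi.
- by rewrite mulmxA J_io.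
Qed.

Lemma lorentz_diag3 b B : b ^+ 2 = 1 -> B *m B^T = 1%:M -> lorentz n (diag3 b B : M).
Proof.
move=> b2 BB; apply/lorentzP; have BB' := mulmx1C BB.
rewrite diag3_tr -[RHS]mul1mx -diag3_1 -BB' -b2 expr2 -diag3_mul -!mulmxA; congr (_ *m _).
by rewrite -[in RHS](diag3_J b B) -[RHS]mulmxA JJ mulmx1.
Qed.

Lemma boost_tr t : (boost t)^T = boost t.
Proof. by rewrite boostE !(trD, trZ) !trmx_mul !trmxK. Qed.

Lemma lorentz_boost t : lorentz n (boost t).
Proof.
apply/lorentzP; rewrite boost_tr; apply: mx_ext3; rewrite -!mulmxA.
- by rewrite boost_xi -!scalemxAr J_xi boost_eta scalerA -expRD subrr expR0 scale1r.
- by rewrite boost_eta -!scalemxAr J_eta boost_xi scalerA -expRD addNr expR0 scale1r.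
- by rewrite boost_io J_io boost_io.
Qed.

(** A boost is the square of another one, and determinants are 1 or -1. *)
Lemma boost_det t : \det (boost t) = 1.
Proof.
rewrite (splitr t) boost_add det_mulmx.
by case: (lorentz_det (lorentz_boost (t / 2))) => ->; rewrite ?mulr1 // mulrNN mulr1.
Qed.

Lemma xi_basis : basis_vec R ord0 + basis_vec R ord_max = xi.
Proof. by rewrite xiE. Qed.

Lemma xi_sub_eta : xi - eta = 2 *: basis_vec R ord_max.
Proof. by rewrite xiE etaE opprB addrC addrA subrK scaler_nat mulr2n. Qed.

End LorentzAlgebra.

(** * The parabolic subgroup *)

Section Parabolic.
Variables (R : realType) (n : nat).
Local Notation M := 'M[R]_n.+2.
Local Notation xi := (xi R n).
Local Notation eta := (eta R n).
Local Notation io := (iota_mx R n).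
Local Notation J := (J R n).
Local Notation boost := (boost n).
Implicit Types (g h X : M) (B C : 'M[R]_n) (v w : 'cV[R]_n) (b t : R).

Let two_neq0 : (2 : R) != 0. Proof. by []. Qed.

Let det_frame b B : \det (block_mx (b%:M : 'M[R]_(1 + 1)) 0 0 B) = b ^+ 2 * \det B.
Proof. by rewrite det_ublock det_scalar. Qed.

(** In the frame xi, eta, iota_mx the matrix is block diagonal with blocks b, b and B. *)
Lemma diag3_det b B : \det (diag3 b B : M) = b ^+ 2 * \det B.
Proof.
pose T : 'M[R]_(1 + 1 + n) := row_mx (row_mx xi eta) io.
pose T' : 'M[R]_(1 + 1 + n) := col_mx (col_mx (2^-1 *: xi^T) (2^-1 *: eta^T)) io^T.
have TT : T *m T' = 1%:M.
  by rewrite /T /T' !mul_row_col -!scalemxAr -scalerDr resolution.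
have dT : \det T != 0.
  have := congr1 determinant TT; rewrite det_mulmx det1.
  by apply: contra_eq_neq => ->; rewrite mul0r eq_sym oner_eq0.
have E : (diag3 b B : M) *m T = T *m block_mx (b%:M : 'M[R]_(1 + 1)) 0 0 B.
  rewrite /T [LHS]mul_mx_row mul_mx_row diag3_xi diag3_eta diag3_io.
  rewrite mul_row_block !mulmx0 addr0 add0r; congr row_mx.
  by rewrite mul_mx_scalar scale_row_mx.
have := congr1 determinant E; rewrite [LHS]det_mulmx [RHS]det_mulmx det_frame.
by rewrite mulrC => /(mulfI dT).
Qed.

Definition Xp v : M := locked (xi *m v^T *m io^T - io *m v *m eta^T).

Let XpE v : Xp v = xi *m v^T *m io^T - io *m v *m eta^T. Proof. by rewrite /Xp -lock. Qed.

Lemma Xp_xi v : Xp v *m xi = 0.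
Proof. by rewrite XpE mulmxBl -!mulmxA !frameE !mx0E. Qed.
Lemma Xp_io v : Xp v *m io = xi *m v^T.
Proof. by rewrite XpE mulmxBl -!mulmxA !frameE !mx0E. Qed.
Lemma Xp_eta v : Xp v *m eta = - (2 *: (io *m v)).
Proof. by rewrite XpE mulmxBl -!mulmxA !frameE !mx0E mulmxA mulmx_2. Qed.

Lemma expm_Xp t v : expm (t *: Xp v) = np (t *: v).
Proof.
have -> : t *: Xp v = Xp (t *: v).
  by rewrite !XpE linearZ /= -!scalemxAr -!scalemxAl scalerBr.
move: (t *: v) => {t}v; rewrite expm_cube0.
  apply: mx_ext3; rewrite !mulmxDl mul1mx -scalemxAl -mulmxA ?np_xi ?np_io ?np_eta ?Xp_xi ?Xp_io ?Xp_eta ?mx0E //.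
    rewrite mulmxN -(scalemxAr _ _ (io *m v)) (mulmxA (Xp v)) Xp_io -mulmxA scalerN scalerA mulVf // scale1r.
    by [].
  by rewrite (mulmxA (Xp v)) Xp_xi !mx0E.
apply: mx_ext3; rewrite -!mulmxA ?Xp_xi ?Xp_io ?Xp_eta !mx0E //.
  by rewrite !mulmxN -!(scalemxAr _ _ (io *m v)) (mulmxA (Xp v) io) Xp_io -(mulmxA xi) -scalemxAr (mulmxA (Xp v)) Xp_xi mul0mx !mx0E.
by rewrite (mulmxA (Xp v) xi) Xp_xi mul0mx mulmx0.
Qed.

Lemma n_plus_Xp v : n_plus (Xp v).
Proof.
split=> [t|]; first by rewrite expm_Xp; exact: lorentz_np.
apply: mx_ext3; rewrite mulmxBl -!mulmxA ?H0_xi ?H0_eta ?H0_io ?Xp_xi ?Xp_io ?Xp_eta ?mx0E //.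
  by rewrite !mulmxN Xp_eta opprK -scalemxAr mulmxA H0_io !mx0E.
by rewrite mulmxA H0_xi.
Qed.

Section NPlus.
Variable X : M.
Hypothesis nX : n_plus X.

Let comm : H0 R n *m X = X + X *m H0 R n.
Proof. by have [_ h] := nX; rewrite -[X in _ = X + _]h subrK. Qed.

Let xiH : xi^T *m H0 R n = xi^T.
Proof. by rewrite H0E -scalemxAr mulmxBr !mulmxA !frameE !mx0E mul_scalar_mx scalerA mulVf // scale1r. Qed.
Let etaH : eta^T *m H0 R n = - eta^T.
Proof. by rewrite H0E -scalemxAr mulmxBr !mulmxA !frameE !mx0E mul_scalar_mx scalerN scalerA mulVf // scale1r. Qed.
Let ioH : io^T *m H0 R n = 0.
Proof. by rewrite H0E -scalemxAr mulmxBr !mulmxA !frameE !mx0E. Qed.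

Let neg_self m k (A : 'M[R]_(m, k)) (c : R) : c != 1 -> A = c *: A -> A = 0.
Proof.
move=> c1 /eqP; rewrite -{1}[A]scale1r -subr_eq0 -scalerBl scaler_eq0 subr_eq0 eq_sym (negbTE c1).
by move/eqP.
Qed.

Let xiHA k (A : 'M[R]_(n.+2, k)) : xi^T *m (H0 R n *m A) = xi^T *m A.
Proof. by rewrite mulmxA xiH. Qed.
Let etaHA k (A : 'M[R]_(n.+2, k)) : eta^T *m (H0 R n *m A) = - (eta^T *m A).
Proof. by rewrite mulmxA etaH mulNmx. Qed.
Let ioHA k (A : 'M[R]_(n.+2, k)) : io^T *m (H0 R n *m A) = 0.
Proof. by rewrite mulmxA ioH mul0mx. Qed.

(** X raises the eigenvalue of H0 by one, and the eigenvalue 2 does not occur. In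
    the same way X maps the middle block to xi and eta to the middle block, so
    that X is nilpotent. *)
Lemma n_plus_xi : X *m xi = 0.
Proof.
have E : H0 R n *m (X *m xi) = 2 *: (X *m xi).
  by rewrite mulmxA comm mulmxDl -mulmxA H0_xi scaler_nat mulr2n.
have E1 : xi^T *m (X *m xi) = 0.
  apply: (@neg_self _ _ _ 2); first by rewrite -subr_eq0 (_ : 2 - 1 = 1 :> R) //; ring.
  by rewrite scalemxAr -E xiHA.
have E2 : eta^T *m (X *m xi) = 0.
  apply: (@neg_self _ _ _ (-2)); first by rewrite -subr_eq0 (_ : -2 - 1 = -3 :> R) ?oppr_eq0 //; ring.
  by rewrite scaleNr scalemxAr -E etaHA opprK.
have E3 : io^T *m (X *m xi) = 0.
  by apply: (scalerI two_neq0); rewrite scalemxAr -E ioHA scaler0.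
rewrite -[LHS]mul1mx -resolution mulmxDl -scalemxAl mulmxDl -!mulmxA E1 E2 E3.
by rewrite !mx0E.
Qed.

Lemma n_plus_io : exists w : 'rV[R]_n, X *m io = xi *m w.
Proof.
exists (2^-1 *: (xi^T *m (X *m io))).
have E : H0 R n *m (X *m io) = X *m io by rewrite mulmxA comm mulmxDl -mulmxA H0_io !mx0E.
have E2 : eta^T *m (X *m io) = 0.
  apply: (@neg_self _ _ _ (-1)); first by rewrite -subr_eq0 (_ : -1 - 1 = -2 :> R) ?oppr_eq0 //; ring.
  by rewrite scaleN1r -{1}E etaHA.
have E3 : io^T *m (X *m io) = 0 by rewrite -E ioHA.
rewrite -[LHS]mul1mx -resolution mulmxDl -scalemxAl mulmxDl -!mulmxA E2 E3.
by rewrite !mx0E -scalemxAr.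
Qed.

Lemma n_plus_eta : exists v, X *m eta = io *m v.
Proof.
exists (io^T *m (X *m eta)).
have E : H0 R n *m (X *m eta) = 0 by rewrite mulmxA comm mulmxDl -mulmxA H0_eta mulmxN subrr.
have E1 : xi^T *m (X *m eta) = 0 by rewrite -xiHA E mulmx0.
have E2 : eta^T *m (X *m eta) = 0 by apply: oppr_inj; rewrite -etaHA E mulmx0 oppr0.
rewrite -[LHS]mul1mx -resolution mulmxDl -scalemxAl mulmxDl -!mulmxA E1 E2.
by rewrite !mx0E.
Qed.

Lemma n_plus_cube : X *m X *m X = 0.
Proof.
have [w Xio] := n_plus_io; have [v Xeta] := n_plus_eta.
apply: mx_ext3; rewrite -!mulmxA ?n_plus_xi ?Xio ?Xeta !mx0E //.
  by rewrite (mulmxA X io) Xio -mulmxA mulmxA n_plus_xi mul0mx.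
by rewrite (mulmxA X xi) n_plus_xi !mx0E.
Qed.

Lemma expm_n_plus : expm X = 1%:M + X + 2^-1 *: (X *m X).
Proof. exact: expm_cube0 n_plus_cube. Qed.

Lemma expm_n_plus_xi : expm X *m xi = xi.
Proof. by rewrite expm_n_plus !mulmxDl -scalemxAl -mulmxA n_plus_xi !mx0E. Qed.

Lemma expm_n_plus_io : exists w : 'rV[R]_n, expm X *m io = io + xi *m w.
Proof.
have [w Xio] := n_plus_io; exists w.
by rewrite expm_n_plus !mulmxDl -scalemxAl -mulmxA Xio (mulmxA X) n_plus_xi !mx0E.
Qed.

Lemma lorentz_expm_n_plus : lorentz n (expm X).
Proof. by have [h _] := nX; have := h 1; rewrite scale1r. Qed.

(** exp X is the square of exp (X / 2). *)
Lemma det_expm_n_plus : \det (expm X) = 1.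
Proof.
have [h _] := nX; pose Y := 2^-1 *: X.
have Y3 : Y *m Y *m Y = 0 by rewrite /Y -!scalemxAl -!scalemxAr -!scalemxAl n_plus_cube !scaler0.
have XY : X = 2 *: Y by rewrite /Y scalerA divff // scale1r.
have -> : expm X = expm Y *m expm Y.
  rewrite expm_n_plus (expm_cube0 Y3) XY; move: (Y) Y3 => Z Z3.
  have Z4 : Z *m (Z *m (Z *m Z)) = 0 by rewrite !mulmxA Z3 mul0mx.
  have Z3' : Z *m (Z *m Z) = 0 by rewrite mulmxA.
  rewrite !(mulmxDl, mulmxDr) !mul1mx -?scalemxAr -?scalemxAl -?scalemxAr -!mulmxA Z4 Z3' !mulmx1 !mx0E.
  move: (Z *m Z) => W; apply/matrixP => p q; by rewrite !mxlinE; field.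
by rewrite det_mulmx; case: (lorentz_det (h 2^-1)) => ->; rewrite ?mulr1 // mulrNN mulr1.
Qed.

End NPlus.

Lemma n_plus_conj b B X : b ^+ 2 = 1 -> B *m B^T = 1%:M -> n_plus X ->
  n_plus (diag3 b B *m X *m diag3 b B^T).
Proof.
move=> b2 BB [lX cX].
have d1 : diag3 b B *m diag3 b B^T = 1%:M :> M by rewrite diag3_mul -expr2 b2 BB diag3_1.
split=> [t|].
  rewrite scalemxAl scalemxAr expm_conj //.
  apply: lorentz_mul; last by apply: lorentz_diag3 => //; rewrite trmxK; exact: mulmx1C.
  by apply: lorentz_mul; [exact: lorentz_diag3|exact: lX].
have e1 : H0 R n *m (diag3 b B *m X *m diag3 b B^T) = diag3 b B *m (H0 R n *m X) *m diag3 b B^T.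
  by rewrite !mulmxA -diag3_H0.
have e2 : diag3 b B *m X *m diag3 b B^T *m H0 R n = diag3 b B *m (X *m H0 R n) *m diag3 b B^T.
  by rewrite -mulmxA diag3_H0 !mulmxA.
by rewrite e1 e2 -mulmxBl -mulmxBr cX.
Qed.

(** The general element of P = M A N_+. *)
Definition man b B t X : M := diag3 b B *m expm (t *: H0 R n) *m expm X.

Section Man.
Variables (b : R) (B : 'M[R]_n) (t : R) (X : M).
Hypotheses (hb : b = 1 \/ b = -1) (hB : B *m B^T = 1%:M) (nX : n_plus X).

Let b2 : b ^+ 2 = 1. Proof. by case: hb => ->; rewrite ?sqrrN expr1n. Qed.

Lemma man_lorentz : lorentz n (man b B t X).
Proof.
apply: lorentz_mul (lorentz_expm_n_plus nX).
by rewrite expm_H0; apply: lorentz_mul; [exact: lorentz_diag3|exact: lorentz_boost].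
Qed.

Lemma man_det : \det (man b B t X) = \det B.
Proof. by rewrite /man !det_mulmx expm_H0 det_expm_n_plus // boost_det !mulr1 diag3_det b2 mul1r. Qed.

Lemma man_xi : man b B t X *m xi = (b * expR t) *: xi.
Proof.
rewrite -!mulmxA expm_n_plus_xi // expm_H0 boost_xi -scalemxAr diag3_xi scalerA.
by rewrite mulrC.
Qed.

Lemma man_io : exists w : 'rV[R]_n, man b B t X *m io = io *m B + xi *m w.
Proof.
have [w E] := expm_n_plus_io nX; exists ((b * expR t) *: w).
rewrite -!mulmxA E expm_H0 !mulmxDr boost_io diag3_io; congr (_ + _).
by rewrite !mulmxA -(mulmxA (diag3 b B)) boost_xi -scalemxAr diag3_xi scalerA -scalemxAl mulrC scalemxAr.
Qed.

Lemma man_conj c C : c ^+ 2 = 1 -> C *m C^T = 1%:M ->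
  exists2 X', n_plus X' & man b B t X *m diag3 c C = man (b * c) (B *m C) t X'.
Proof.
move=> c2 CC; exists (diag3 c C^T *m X *m diag3 c C).
  have := @n_plus_conj c C^T X c2; rewrite trmxK; apply => //; exact: mulmx1C.
have d1 : diag3 c C^T *m diag3 c C = 1%:M :> M.
  by rewrite diag3_mul -expr2 c2 (mulmx1C CC) diag3_1.
have d2 := mulmx1C d1.
rewrite /man expm_conj // expm_H0 !mulmxA -diag3_mul -!(mulmxA (diag3 b B)).
by rewrite diag3_boost -(mulmxA (boost t) (diag3 c C)) d2 mulmx1 !mulmxA.
Qed.

Lemma man_conjl c C : diag3 c C *m man b B t X = man (c * b) (C *m B) t X.
Proof. by rewrite /man !mulmxA diag3_mul. Qed.

Lemma man_boostl s : boost s *m man b B t X = man b B (s + t) X.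
Proof. by rewrite /man !expm_H0 !mulmxA -diag3_boost -(mulmxA (diag3 b B)) -boost_add. Qed.

End Man.

Lemma man_np b B t v : man b B t (Xp v) = diag3 b B *m boost t *m np v.
Proof. by rewrite /man expm_H0 -[Xp v]scale1r expm_Xp scale1r. Qed.

(** The converse description of P: preservation of the form determines the
    remaining entries of a matrix that maps xi to a multiple of itself. *)
Lemma lorentz_parabolic g c : lorentz n g -> g *m xi = c *: xi ->
  exists b B t v, [/\ b = 1 \/ b = -1, B *m B^T = 1%:M, c = b * expR t &
    g = diag3 b B *m boost t *m np v].
Proof.
move=> lg gxi; have lg' := lg; move/lorentzP: lg' => gJg.
have [ug _] := lorentz_invE lg.
have xi0 : xi != 0.
  apply/eqP => h; have := xixi R n; rewrite h mulmx0 => /matrixP /(_ ord0 ord0).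
  by rewrite !mxE => /eqP; rewrite eq_sym mulr1n (negbTE two_neq0).
have c0 : c != 0.
  apply: contra_eq_neq gxi => ->; rewrite scale0r; apply: contra xi0 => /eqP h.
  by rewrite -[xi](mulKmx ug) h mulmx0.
(* The blocks of g in the frame; etag and the four quad equations express that g
   preserves the form. *)
have [B BE] : exists B, B = io^T *m g *m io by eexists.
have [w wE] : exists w : 'rV[R]_n, w = xi^T *m g *m io by eexists.
have [y yE0] : exists y, y = io^T *m g *m eta by eexists.
have [z zE] : exists z : 'M[R]_1, z = xi^T *m g *m eta by eexists.
have etag : eta^T *m g = c^-1 *: eta^T.
  apply: (scalerI c0); rewrite scalerA divff // scale1r -[RHS]xiJ -gJg !mulmxA.
  by rewrite -trmx_mul gxi linearZ /= -!scalemxAl xiJ.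
have res k (A : 'M[R]_(n.+2, k)) : A = 2^-1 *: (xi *m (xi^T *m A)) + 2^-1 *: (eta *m (eta^T *m A)) + io *m (io^T *m A).
  by rewrite -[LHS]mul1mx -resolution mulmxDl -scalemxAl mulmxDl scalerDr !mulmxA.
have gio : g *m io = 2^-1 *: (xi *m w) + io *m B.
  rewrite {1}(res _ (g *m io)) (mulmxA eta^T) etag -scalemxAl etaio !mx0E wE BE.
  by rewrite !(mulmxA _ g io).
have geta : g *m eta = 2^-1 *: (xi *m z) + c^-1 *: eta + io *m y.
  rewrite {1}(res _ (g *m eta)) (mulmxA eta^T) etag -scalemxAl etaeta -scalemxAr mulmx_2 !scalerA.
  by rewrite mulrAC mulVf // mul1r zE yE0 !mulmxA.
have giot : (g *m io)^T *m J = 2^-1 *: (w^T *m eta^T) + B^T *m io^T.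
  by rewrite gio trD trZ !trmx_mul mulmxDl -scalemxAl -!mulmxA xiJ ioJ.
have getat : (g *m eta)^T *m J = 2^-1 *: (z^T *m eta^T) + c^-1 *: xi^T + y^T *m io^T.
  by rewrite geta !trD !trZ !trmx_mul !mulmxDl -!scalemxAl -!mulmxA xiJ etaJ ioJ.
have quad k l (A : 'M[R]_(n.+2, k)) (A' : 'M[R]_(n.+2, l)) : (g *m A)^T *m J *m (g *m A') = A^T *m J *m A'.
  by rewrite trmx_mul -{2}gJg !mulmxA.
have etagio : eta^T *m (g *m io) = 0 by rewrite mulmxA etag -scalemxAl etaio scaler0.
have iogio : io^T *m (g *m io) = B by rewrite BE mulmxA.
have etageta : eta^T *m (g *m eta) = (2 * c^-1)%:M.
  by rewrite mulmxA etag -scalemxAl etaeta scale_scalar_mx mulrC.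
have iogeta : io^T *m (g *m eta) = y by rewrite yE0 mulmxA.
have xigeta : xi^T *m (g *m eta) = z by rewrite zE mulmxA.
have BB : B^T *m B = 1%:M.
  have := quad _ _ io io; rewrite ioJ ioio giot mulmxDl -scalemxAl -!mulmxA etagio iogio.
  by rewrite !mx0E.
have By : B^T *m y = - (c^-1 *: w^T).
  have := quad _ _ io eta; rewrite ioJ ioeta giot mulmxDl -scalemxAl -!mulmxA etageta iogeta.
  rewrite mul_mx_scalar scalerA mulrA mulVf // mul1r => /eqP.
  by rewrite addrC addr_eq0 => /eqP.
have yz : z = - (c / 2) *: (y^T *m y).
  have := quad _ _ eta eta; rewrite etaJ xieta getat !mulmxDl -!scalemxAl -!mulmxA etageta iogeta xigeta.
  rewrite mul_mx_scalar scalerA mulrA mulVf // mul1r.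
  have -> : z^T = z by rewrite [z]mx11_scalar tr_scalar_mx.
  move: (y^T *m y) => Y /matrixP h; apply/matrixP => p q; have := h p q.
  rewrite !mxlinE [RHS]mxE => e; have -> : Y p q = - 2 * (c^-1 * z p q) by rewrite (_ : Y p q = - (c^-1 * z p q + c^-1 * z p q)) ?[LHS]addrC; [ring | apply/eqP; rewrite -subr_eq0 opprK addrC e].
  by field.
have BBt : B *m B^T = 1%:M by exact: mulmx1C.
have yE : y = - (c^-1 *: (B *m w^T)).
  by rewrite -[LHS]mul1mx -BBt -mulmxA By mulmxN scalemxAr.
have [v vE] : exists v : 'cV[R]_n, v = (2 * c)^-1 *: w^T by eexists.
exists (Num.sg c), B, (ln `|c|), v.
have ec : expR (ln `|c|) = `|c| by rewrite lnK // posrE normr_gt0.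
split.
- by case: (ltgtP c 0) c0 => // [/ltr0_sg ->|/gtr0_sg ->] _; [right|left].
- exact: BBt.
- by rewrite ec -numEsg.
have sgc : Num.sg c * `|c| = c by rewrite -numEsg.
have sgc' : Num.sg c * `|c|^-1 = c^-1.
  by case: (ltgtP c 0) c0 => // h _; rewrite ?(ltr0_sg h) ?(gtr0_sg h) ?(gtr0_norm h) ?(ltr0_norm h); rewrite ?mul1r // mulN1r invrN opprK.
pose D : M := diag3 (Num.sg c) B *m boost (ln `|c|).
have Dxi : D *m xi = c *: xi by rewrite /D -mulmxA boost_xi ec -scalemxAr diag3_xi scalerA mulrC sgc.
have Deta : D *m eta = c^-1 *: eta.
  by rewrite /D -mulmxA boost_eta expRN ec -scalemxAr diag3_eta scalerA mulrC sgc'.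
have Dio : D *m io = io *m B by rewrite /D -mulmxA boost_io diag3_io.
have wv : w^T = (2 * c) *: v by rewrite vE scalerA divff ?scale1r // mulf_neq0.
have yv : y = - (2 *: (B *m v)) by rewrite yE wv -scalemxAr scalerA mulrCA mulVf // mulr1.
have zv : z = - ((2 * c) *: (v^T *m v)).
  rewrite yz yv trN trZ trmx_mul mulmxN mulNmx opprK -scalemxAl -scalemxAr -mulmxA (mulmxA B^T) BB mul1mx.
  by move: (v^T *m v) => V; apply/matrixP => k l; rewrite !(mxN, mxZ); field.
rewrite -/D; move: (D) Dxi Deta Dio => F Fxi Feta Fio.
have FA k (A : 'M[R]_(n.+2, k)) : F *m np v *m A = F *m (np v *m A) by rewrite mulmxA.
apply: mx_ext3; rewrite FA ?np_xi ?np_io ?np_eta.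
- by rewrite gxi Fxi.
- rewrite geta !mulmxBr -scalemxAr !(mulmxA F) Fxi Fio Feta -mulmxA -scalemxAl zv yv !mulmxN -!scalemxAr.
  move: (io *m (B *m v)) (xi *m (v^T *m v)) => d q; apply/matrixP => k l.
  rewrite !mxlinE; field.
  exact: c0.
- rewrite gio mulmxDr (mulmxA F xi) Fxi Fio addrC -scalemxAl; congr (_ + _).
  have -> : w = (2 * c) *: v^T by rewrite -trZ -wv trmxK.
  by rewrite -scalemxAr scalerA mulrA mulVf // mul1r.
Qed.

(** A acts on N_- by dilations. *)
Lemma boost_nm t v : boost (- t) *m nm v = nm (expR t *: v) *m boost (- t).
Proof.
have L k (A : 'M[R]_(n.+2, k)) : boost (- t) *m nm v *m A = boost (- t) *m (nm v *m A).
  by rewrite mulmxA.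
have L' k (A : 'M[R]_(n.+2, k)) : nm (expR t *: v) *m boost (- t) *m A = nm (expR t *: v) *m (boost (- t) *m A).
  by rewrite mulmxA.
have e1 : expR (- t) * expR t = 1 by rewrite -expRD addNr expR0.
apply: mx_ext3; rewrite L L' ?boost_xi ?boost_eta ?boost_io -?scalemxAr ?nm_xi ?nm_eta ?nm_io.
- rewrite !mulmxBr -!scalemxAr !(mulmxA (boost _)) boost_xi boost_io boost_eta opprK.
  rewrite trZ -!scalemxAl -?scalemxAr.
  move: (expR (- t)) (expR t) e1 (io *m v) (eta *m (v^T *m v)) => a c ac d q; apply/matrixP => k l.
  rewrite !mxlinE.
  have -> : a * (xi k l - 2 * (c * d k l) - c * (c * q k l)) = a * xi k l - 2 * (a * c * d k l) - a * c * (c * q k l) by ring.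
  by rewrite ac !mul1r.
- by rewrite boost_eta.
- by rewrite mulmxDr boost_io mulmxA boost_eta opprK trZ -scalemxAr scalemxAl.
Qed.

Lemma diag3_nm b v : b ^+ 2 = 1 -> diag3 b 1%:M *m nm v = nm (b *: v) *m diag3 b 1%:M.
Proof.
move=> b2; have bb : b * b = 1 by rewrite -expr2.
have L k (A : 'M[R]_(n.+2, k)) : diag3 b 1%:M *m nm v *m A = diag3 b 1%:M *m (nm v *m A).
  by rewrite mulmxA.
have L' k (A : 'M[R]_(n.+2, k)) : nm (b *: v) *m diag3 b 1%:M *m A = nm (b *: v) *m (diag3 b 1%:M *m A).
  by rewrite mulmxA.
apply: mx_ext3; rewrite L L' ?diag3_xi ?diag3_eta ?diag3_io -?scalemxAr ?mulmx1 ?nm_xi ?nm_eta ?nm_io.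
- rewrite !mulmxBr -!scalemxAr !(mulmxA (diag3 _ _)) diag3_xi diag3_io diag3_eta mulmx1.
  rewrite trZ -!scalemxAl -?scalemxAr.
  move: (io *m v) (eta *m (v^T *m v)) => d q; apply/matrixP => k l.
  rewrite !mxlinE.
  have -> : b * (xi k l - 2 * (b * d k l) - b * (b * q k l)) = b * xi k l - 2 * (b * b * d k l) - b * b * (b * q k l) by ring.
  by rewrite bb !mul1r.
- by rewrite diag3_eta.
- by rewrite mulmxDr diag3_io mulmx1 mulmxA diag3_eta trZ -scalemxAr scalemxAl.
Qed.

End Parabolic.

(** * Connected components *)

Section GroupComponent.
Variables (R : realType) (n : nat).
Local Notation M := 'M[R]_n.+2.
Local Notation J := (J R n).
Implicit Types (g h x X : M).

Lemma continuous_mulmx (T : topologicalType) m k l (f : T -> 'M[R]_(m, k)) (f' : T -> 'M[R]_(k, l)) :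
  continuous f -> continuous f' -> continuous (fun z => f z *m f' z).
Proof. by move=> cf cf' z; exact: (cvg_mulmx (cf z) (cf' z)). Qed.

Lemma continuous_mx (T : topologicalType) m k (f : T -> 'M[R]_(m, k)) :
  (forall p q, continuous (fun z => f z p q)) -> continuous f.
Proof. by move=> cf z; apply: (@cvg_mx R _ (nbhs z) _) => p q; exact: cf. Qed.

Lemma continuous_coord (T : topologicalType) m k (f : T -> 'M[R]_(m, k)) p q :
  continuous f -> continuous (fun z => f z p q).
Proof. by move=> cf z; exact: (cvg_mx_coord (i := p) (j := q) (cf z)). Qed.

Lemma continuous_mulmxl g : continuous (fun x : M => g *m x).
Proof. by apply: continuous_mulmx => x; [exact: cst_continuous|exact: cvg_id]. Qed.

Lemma continuous_entry p q : continuous (fun x : M => x p q).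
Proof. by apply: continuous_coord => x; exact: cvg_id. Qed.

Lemma continuous_det : continuous (fun x : M => \det x).
Proof.
move=> x; rewrite /determinant.
elim: (index_enum _) => [|s r IH].
  under eq_fun do rewrite big_nil.
  exact: cst_continuous.
under eq_fun do rewrite big_cons.
apply: cvgD IH; apply: cvgM; first exact: cst_continuous.
elim: (index_enum _) => [|k r' IH].
  rewrite big_nil; under eq_fun do rewrite big_nil.
  exact: cvg_cst.
rewrite big_cons; under eq_fun do rewrite big_cons.
by apply: cvgM IH; exact: continuous_entry.
Qed.

Variable H : set M.
Hypothesis H1 : H 1%:M.
Hypothesis HM : forall g h, H g -> H h -> H (g *m h).
Hypothesis HV : forall g, H g -> H (invmx g).
Hypothesis HL : H `<=` lorentz n.

Local Notation H0 := (connected_component H 1%:M).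

Lemma component_sub : H0 `<=` H. Proof. exact: connected_component_sub. Qed.

Lemma component_1 : H0 1%:M. Proof. exact: connected_component_refl. Qed.

Lemma component_image (f : M -> M) g : continuous f -> (forall x, H x -> H (f x)) ->
  H0 g -> connected_component H (f 1%:M) (f g).
Proof.
move=> cf fH gH0.
apply: (@connected_component_max _ _ (f @` H0)); last by exists g.
- by exists 1%:M => //; exact: component_1.
- by move=> _ [x /component_sub Hx <-]; exact: fH.
apply: connected_continuous_connected; first exact: component_connected.
exact: continuous_subspaceT.
Qed.

Lemma component_mul g h : H0 g -> H0 h -> H0 (g *m h).
Proof.
move=> gH0 hH0; apply: (connected_component_trans gH0).
have := @component_image (mulmx g) h (@continuous_mulmxl g).
by rewrite mulmx1; apply => // x; apply: HM; exact: component_sub.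
Qed.

Lemma component_conj m g : H m -> H0 g -> H0 (invmx m *m g *m m).
Proof.
move=> Hm gH0.
have um : m \in unitmx by have [] := lorentz_invE (HL Hm).
have := @component_image (fun x => invmx m *m x *m m) g.
rewrite mulmx1 mulVmx //; apply => // [|x Hx].
  by apply: continuous_mulmx => x; [exact: continuous_mulmxl|exact: cst_continuous].
by apply: HM => //; apply: HM => //; exact: HV.
Qed.

Lemma component_inv g : H0 g -> H0 (invmx g).
Proof.
move=> gH0.
have gH := component_sub gH0.
have ug : g \in unitmx by have [] := lorentz_invE (HL gH).
apply: connected_component_sym.
have := @component_image (mulmx (invmx g)) g (@continuous_mulmxl _).
rewrite mulmx1 mulVmx //; apply => // x; apply: HM; exact: HV.
Qed.

Lemma component_path (f : R -> M) t : continuous f -> f 0 = 1%:M -> (forall s, H (f s)) -> H0 (f t).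
Proof.
move=> cf f0 fH.
apply: (@connected_component_max _ _ (range f)); last by exists t.
- by exists 0.
- by move=> _ [s _ <-].
apply: connected_continuous_connected; last exact: continuous_subspaceT.
by apply/connected_intervalP => x y _ _ z _.
Qed.

Lemma component_expm X : lie H X -> H0 (expm X).
Proof.
move=> lX; rewrite -[X]scale1r.
apply: (@component_path (fun t => expm (t *: X))) => //; first exact: continuous_expm.
by rewrite scale0r expm0.
Qed.

Lemma lie_component X : lie H X -> lie H0 X.
Proof.
move=> lX t; apply: component_expm => s.
by rewrite scalerA; exact: lX.
Qed.

(** By the intermediate value theorem on the image of the component, an interval. *)
Lemma component_pos (f : M -> R) g : continuous f -> (forall x, H x -> f x != 0) ->
  0 < f 1%:M -> H0 g -> 0 < f g.
Proof.
move=> cf f0 f1 gH0; rewrite ltNge; apply/negP => fg.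
have cA : connected (f @` H0).
  apply: connected_continuous_connected; first exact: component_connected.
  exact: continuous_subspaceT.
have [x Hx fx] : (f @` H0) 0.
  move/connected_intervalP : cA => iA; apply: (iA (f g) (f 1%:M)); last by rewrite fg (ltW f1).
    by exists g.
  by exists 1%:M => //; exact: component_1.
by have := f0 _ (component_sub Hx); rewrite fx eqxx.
Qed.

End GroupComponent.

(** * The components of O(n+1,1) and of O(n,1) *)

Section Fixing.
Variables (R : realType) (n : nat).
Local Notation M := 'M[R]_n.+3.
Local Notation xi := (xi R n.+1).
Local Notation eta := (eta R n.+1).
Local Notation io := (iota_mx R n.+1).
Local Notation J := (J R n.+1).
Local Notation boost := (boost n.+1).
Implicit Types (g h x X : M) (B C : 'M[R]_n.+1) (v w u : 'cV[R]_n.+1) (b c t : R) (F : {set 'I_n.+1}).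

Definition unit_vec (q : 'I_n.+1) : 'cV[R]_n.+1 := delta_mx q ord0.
Local Notation e := unit_vec.

Lemma unit_vec_tr q v : (e q)^T *m v = (v q ord0)%:M.
Proof.
rewrite /e trmx_delta -rowE; apply/matrixP => p r; rewrite !mxE !ord1 eqxx mulr1n.
by [].
Qed.

Lemma tr_unit_vec q v : v^T *m e q = (v q ord0)%:M.
Proof. by apply: trmx_inj; rewrite trmx_mul trmxK unit_vec_tr tr_scalar_mx. Qed.

(** The subgroup fixing the middle basis vectors indexed by F: the empty F gives
    O(n+1,1), the last index gives O(n,1). This makes one argument serve both. *)
Definition fixing F : set M :=
  [set g | lorentz n.+1 g /\ forall q, q \in F -> g *m (io *m e q) = io *m e q].

(** The condition on B for diag3 b B to belong to the subgroup. *)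
Definition fixing_mx F B := B *m B^T = 1%:M /\ forall q, q \in F -> B *m e q = e q.

Lemma fixing_lorentz F : fixing F `<=` lorentz n.+1. Proof. by move=> g []. Qed.

Lemma fixing_1 F : fixing F 1%:M.
Proof. by split=> [|q _]; [exact: lorentz_1|rewrite mul1mx]. Qed.

Lemma fixing_mul F g h : fixing F g -> fixing F h -> fixing F (g *m h).
Proof.
move=> [lg gF] [lh hF]; split=> [|q qF]; first exact: lorentz_mul.
by rewrite -mulmxA hF // gF.
Qed.

Lemma fixing_inv F g : fixing F g -> fixing F (invmx g).
Proof.
move=> [lg gF]; split=> [|q qF]; first exact: lorentz_inv.
have [ug _] := lorentz_invE lg.
by rewrite -{1}(gF q qF) mulmxA mulVmx // mul1mx.
Qed.

Definition fixing0 F : set M := connected_component (fixing F) 1%:M.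

Lemma fixing_diag3 F b B : b ^+ 2 = 1 -> fixing_mx F B -> fixing F (diag3 b B).
Proof.
move=> b2 [BB BF]; split=> [|q qF]; first exact: lorentz_diag3.
by rewrite mulmxA diag3_io -mulmxA BF.
Qed.

Lemma fixing_boost F t : fixing F (boost t).
Proof. by split=> [|q _]; [exact: lorentz_boost|rewrite mulmxA boost_io]. Qed.

Lemma fixing_np F v : (forall q, q \in F -> v q ord0 = 0) -> fixing F (np v).
Proof.
move=> vF; split=> [|q qF]; first exact: lorentz_np.
by rewrite mulmxA np_io mulmxDl -mulmxA tr_unit_vec vF // raddf0 mulmx0 addr0.
Qed.

Lemma fixing_nm F v : (forall q, q \in F -> v q ord0 = 0) -> fixing F (nm v).
Proof.
move=> vF; split=> [|q qF]; first exact: lorentz_nm.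
by rewrite mulmxA nm_io mulmxDl -mulmxA tr_unit_vec vF // raddf0 mulmx0 addr0.
Qed.

Lemma fixing_man F b B t X : b = 1 \/ b = -1 -> B *m B^T = 1%:M -> n_plus X ->
  fixing F (man b B t X) -> fixing_mx F B.
Proof.
move=> hb hB nX [_ pF]; split=> // q /pF h.
have [w E] := man_io b B t nX.
have := congr1 (mulmx io^T) h; rewrite (mulmxA (man b B t X)) E mulmxDl mulmxDr !mulmxA !frameE.
by rewrite !mx0E.
Qed.

Definition nsq u : R := (u^T *m u) ord0 ord0.

Lemma nsqE u : u^T *m u = (nsq u)%:M. Proof. exact: mx11_scalar. Qed.

Lemma nsq_sum u : nsq u = \sum_k u k ord0 ^+ 2.
Proof. by rewrite /nsq !mxE; apply: eq_bigr => k _; rewrite !mxE expr2. Qed.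

Lemma nsq_eq0 u : (nsq u == 0) = (u == 0).
Proof.
rewrite nsq_sum psumr_eq0 => [|k _]; last exact: sqr_ge0.
apply/allP/eqP => [h|-> k _ /=]; last by rewrite mxE expr0n.
apply/matrixP => k l; rewrite ord1 mxE.
by have := h k (mem_index_enum _); rewrite sqrf_eq0 => /eqP.
Qed.

Definition reflection u : 'M[R]_n.+1 := 1%:M - (2 / nsq u) *: (u *m u^T).

Lemma reflection_col u v : reflection u *m v = v - (2 / nsq u * (u^T *m v) ord0 ord0) *: u.
Proof.
by rewrite /reflection mulmxBl mul1mx -scalemxAl -mulmxA {1}[u^T *m v]mx11_scalar mul_mx_scalar scalerA.
Qed.

Lemma reflection_sq u : u != 0 -> reflection u *m reflection u = 1%:M.
Proof.
rewrite -nsq_eq0 => u0; rewrite {2}/reflection mulmxBr mulmx1 -scalemxAr mulmxA reflection_col.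
rewrite -/(nsq u) mulfVK // mulmxBl -scalemxAl /reflection; move: (2 / nsq u) (u *m u^T) => a U.
apply/matrixP => p q; rewrite !mxlinE; ring.
Qed.

Lemma reflection_tr u : (reflection u)^T = reflection u.
Proof. by rewrite /reflection linearB linearZ /= trmx1 trmx_mul trmxK. Qed.

Lemma reflection_orthogonal u : u != 0 -> reflection u *m (reflection u)^T = 1%:M.
Proof. by move=> u0; rewrite reflection_tr reflection_sq. Qed.

Lemma reflection_scale a u : a != 0 -> reflection (a *: u) = reflection u.
Proof.
move=> a0; rewrite /reflection; congr (_ - _).
have -> : nsq (a *: u) = a ^+ 2 * nsq u.
  by rewrite !nsq_sum mulr_sumr; apply: eq_bigr => k _; rewrite mxE exprMn.
rewrite linearZ /= -scalemxAl -scalemxAr !scalerA; case: (eqVneq (nsq u) 0) => [/eqP|n0]; last first.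
  by congr (_ *: _); field; rewrite n0 a0.
by rewrite nsq_eq0 => /eqP ->; rewrite mul0mx !scaler0.
Qed.

Lemma reflection_swap u v : nsq u = nsq v -> u != v -> reflection (u - v) *m u = v.
Proof.
move=> uv neq; rewrite reflection_col.
have n0 : nsq (u - v) != 0 by rewrite nsq_eq0 subr_eq0.
have -> : ((u - v)^T *m u) ord0 ord0 = nsq (u - v) / 2.
  have e1 : (u - v)^T *m (u - v) = u^T *m u - u^T *m v - v^T *m u + v^T *m v.
    rewrite trB mulmxBl !mulmxBr opprB; move: (u^T *m u) (u^T *m v) (v^T *m u) (v^T *m v) => a b c d.
    by apply/matrixP => p q; rewrite !mxlinE; ring.
  have e2 : v^T *m u = u^T *m v by rewrite -[LHS]trmxK trmx_mul trmxK [u^T *m v]mx11_scalar tr_scalar_mx.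
  rewrite {1}/nsq e1 trB mulmxBl e2; move: uv; rewrite /nsq.
  move: (u^T *m u) (u^T *m v) (v^T *m v) => a b d ad.
  by rewrite !mxlinE ad; field.
rewrite [2 / _ * _](_ : _ = 1) ?scale1r; last by field.
by rewrite opprB addrC subrK.
Qed.

(** diag (c, 1, ..., 1). It is placed on the first middle coordinate, which is
    moved by both groups. *)
Definition sign_mx c : 'M[R]_n.+1 := diag_mx (\row_k (if k == ord0 then c else 1)).

Lemma sign_mxM c c' : sign_mx c *m sign_mx c' = sign_mx (c * c').
Proof.
rewrite /sign_mx mulmx_diag; congr diag_mx; apply/rowP => k; rewrite !mxE.
by case: ifP; rewrite ?mulr1.
Qed.

Lemma sign_mx1 : sign_mx 1 = 1%:M.
Proof.
rewrite /sign_mx -[RHS]diag_const_mx; congr diag_mx; apply/rowP => k; rewrite !mxE.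
by case: ifP.
Qed.

Lemma sign_mx_det c : \det (sign_mx c) = c.
Proof.
rewrite /sign_mx det_diag (bigD1 ord0) //= mxE eqxx big1 ?mulr1 // => k /negbTE h.
by rewrite mxE h.
Qed.

Lemma sign_mx_orthogonal c : c ^+ 2 = 1 -> sign_mx c *m (sign_mx c)^T = 1%:M.
Proof. by move=> c2; rewrite tr_diag_mx sign_mxM -expr2 c2 sign_mx1. Qed.

Lemma sign_mx_vec c q : q != ord0 -> sign_mx c *m e q = e q.
Proof.
move=> q0; rewrite /sign_mx mul_diag_mx; apply/matrixP => p r; rewrite !mxE.
by case: (p =P q) => [->|_]; rewrite ?mulr0 //= (negbTE q0) mul1r.
Qed.

Lemma reflection_e0 : reflection (e ord0) = sign_mx (-1).
Proof.
have n1 : nsq (e ord0) = 1 by rewrite /nsq unit_vec_tr !mxE eqxx mulr1n.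
rewrite /reflection n1 divr1 trmx_delta mul_delta_mx; apply/matrixP => p q; rewrite !mxE.
case: (p =P q) => [->|/eqP pq].
  by case: (q =P ord0) => _; rewrite /= ?mulr1n ?mulr1 ?mulr0 ?subr0 //; ring.
rewrite mulr0n sub0r; case: (p =P ord0) pq => [->|_]; case: (q =P ord0) => [->|_] //=; rewrite ?mulr0 ?oppr0 ?mulr0n //.
Qed.

Section Component.
Variable F : {set 'I_n.+1}.
Local Notation H := (fixing F).
Local Notation H0 := (fixing0 F).

Let mulH0 := component_mul (@fixing_1 F) (@fixing_mul F).
Let conjH0 := component_conj (@fixing_1 F) (@fixing_mul F) (@fixing_inv F) (@fixing_lorentz F).
Let pathH0 := @component_path R n.+1 H.

Lemma fixing0_boost t : H0 (boost t).
Proof.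
rewrite -expm_H0; apply: component_expm => s.
by rewrite scalerA expm_H0; exact: fixing_boost.
Qed.

Lemma fixing0_np v : (forall q, q \in F -> v q ord0 = 0) -> H0 (np v).
Proof.
move=> vF; rewrite -[v]scale1r -expm_Xp scale1r; apply: component_expm => s.
rewrite expm_Xp; apply: fixing_np => q /vF vq.
by rewrite mxE vq mulr0.
Qed.

Lemma fixing0_nm v : (forall q, q \in F -> v q ord0 = 0) -> H0 (nm v).
Proof.
move=> vF; have -> : nm v = nm (1 *: v) by rewrite scale1r.
have c1 : continuous (fun t : R => nm (t *: v)).
  under eq_fun do rewrite nm_def -expm_Xp.
  apply: continuous_mulmx => [|t]; last exact: cst_continuous.
  apply: continuous_mulmx => t; first exact: cst_continuous.
  exact: continuous_expm.
apply: (pathH0 _ c1); first by rewrite scale0r nm_0.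
move=> s; apply: fixing_nm => q /vF vq.
by rewrite mxE vq mulr0.
Qed.

Lemma fixing_reflection u : u != 0 -> (forall q, q \in F -> u q ord0 = 0) ->
  fixing_mx F (reflection u).
Proof.
move=> u0 uF; split=> [|q qF]; first exact: reflection_orthogonal.
by rewrite reflection_col tr_unit_vec uF // raddf0 mxE mulr0 scale0r subr0.
Qed.

Hypothesis F0 : ord0 \notin F.

(** The reflections in two independent vectors are joined by the reflections in
    the vectors of the segment between them. Here one of them is e_0, whose
    reflection is the sign matrix. *)
Lemma fixing0_reflection u : u != 0 -> (forall q, q \in F -> u q ord0 = 0) ->
  H0 (diag3 1 (reflection u *m sign_mx (-1))).
Proof.
move=> u0 uF; rewrite -reflection_e0.
have e0F q : q \in F -> e ord0 q ord0 = 0.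
  by move=> qF; rewrite mxE; case: eqP qF F0 => [->|] // -> .
have [[a uE]|dep] := pselect (exists a, u = a *: e ord0).
  have a0 : a != 0 by apply: contraNneq u0 => a0; rewrite uE a0 scale0r.
  have e0 : e ord0 != 0 by apply: contraNneq u0 => h; rewrite uE h scaler0.
  rewrite uE reflection_scale // reflection_sq // diag3_1.
  exact: component_1 (@fixing_1 F).
pose w t := (1 - t) *: e ord0 + t *: u.
have w0 t : w t != 0.
  apply/eqP => wt; have [t0|t0] := eqVneq t 0.
    move: wt; rewrite /w t0 subr0 scale0r addr0 scale1r => /matrixP /(_ ord0 ord0).
    by rewrite !mxE !eqxx => /eqP; rewrite oner_eq0.
  apply: dep; exists (- (1 - t) / t); apply: (scalerI t0).
  rewrite scalerA mulrCA divff // mulr1 scaleNr.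
  by apply/eqP; rewrite -subr_eq0 opprK addrC -/(w t) wt.
have wF t q : q \in F -> w t q ord0 = 0 by move=> qF; rewrite /w mxD !mxZ uF // e0F // !mulr0 addr0.
have cw : continuous w.
  apply: continuous_mx => p q t; rewrite /w.
  under eq_fun do rewrite !mxE.
  by apply: cvgD; apply: cvgMl; [apply: cvgB; [exact: cvg_cst|]|]; exact: cvg_id.
have cn : continuous (fun t => nsq (w t)).
  apply: continuous_coord; apply: continuous_mulmx => //.
  apply: continuous_mx => p q; under eq_fun do rewrite mxE.
  exact: continuous_coord.
have cr : continuous (fun t => reflection (w t)).
  apply: continuous_mx => p q t; rewrite /reflection.
  under eq_fun do rewrite mxD mxN mxZ.
  apply: cvgB; first exact: cvg_cst.
  apply: cvgM.
    apply: cvgM; first exact: cvg_cst.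
    by apply: cvgV; [rewrite nsq_eq0|exact: cn].
  move: t; apply: continuous_coord; apply: continuous_mulmx => //.
  apply: continuous_mx => p' q'; under eq_fun do rewrite mxE.
  exact: continuous_coord.
have w1 : w 1 = u by rewrite /w subrr scale0r add0r scale1r.
have := @pathH0 (fun t => diag3 1 (reflection (w t) *m reflection (e ord0))) 1.
rewrite w1; apply.
- move=> t; under eq_fun do rewrite diag3E.
  apply: cvgD; first exact: cvg_cst.
  move: t; apply: continuous_mulmx => [|t]; last exact: cvg_cst.
  apply: continuous_mulmx => [t|]; first exact: cvg_cst.
  by apply: (continuous_mulmx cr) => t; exact: cvg_cst.
- rewrite /w subr0 scale0r addr0 scale1r reflection_sq ?diag3_1 //.
  by have := w0 0; rewrite /w subr0 scale0r addr0 scale1r.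
- move=> t; apply: fixing_diag3; first by rewrite expr1n.
  have [r1 r2] := @fixing_reflection (w t) (w0 t) (wF t).
  have e0 : e ord0 != 0.
    by have := w0 0; rewrite /w subr0 scale0r addr0 scale1r.
  have [r3 r4] := @fixing_reflection (e ord0) e0 e0F.
  split=> [|q qF]; last by rewrite -mulmxA r4 // r2.
  by rewrite trmx_mul mulmxA -(mulmxA _ _ (reflection (e ord0))^T) r3 mulmx1.
Qed.

(** Cartan-Dieudonne: if B moves e_q, then the reflection exchanging B e_q and
    e_q gives a matrix that fixes one more basis vector. Each reflection
    contributes a sign modulo the identity component. *)
Lemma orthogonal_sign F' B : F \subset F' -> fixing_mx F' B ->
  exists2 c, c = 1 \/ c = -1 & H0 (diag3 1 (B *m sign_mx c)).
Proof.
have [k] := ubnP #|~: F'|; elim: k F' B => // k IH F' B hk FF' [BB BF'].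
have [q qF'|allF'] := pickP [pred q | q \notin F']; last first.
  exists 1; first by left.
  have -> : B = 1%:M.
    apply/matrixP => p q; have /matrixP /(_ p ord0) := BF' q (negbFE (allF' q)).
    by rewrite -colE !mxE eqxx andbT.
  rewrite sign_mx1 mulmx1 diag3_1; exact: component_1 (@fixing_1 F).
have hk' : (#|~: (q |: F')| < k)%N.
  rewrite -ltnS; apply: leq_trans hk; rewrite ltnS; apply: proper_card.
  apply/properP; split; first by rewrite finset.setCS finset.subsetUr.
  by exists q; rewrite !inE ?eqxx.
have FF2 : F \subset q |: F' by apply: fintype.subset_trans FF' (finset.subsetUr _ _).
have [Bq|Bq] := eqVneq (B *m e q) (e q).
  apply: (IH _ _ hk' FF2); split=> // r; rewrite in_setU1 => /orP [/eqP ->//|]; exact: BF'.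
have BtB := mulmx1C BB.
pose u := B *m e q - e q.
have u0 : u != 0 by rewrite subr_eq0.
have nB v : nsq (B *m v) = nsq v by rewrite /nsq trmx_mul -mulmxA (mulmxA B^T) BtB mul1mx.
have swap : reflection u *m (B *m e q) = e q by apply: reflection_swap.
have uF' r : r \in F' -> u r ord0 = 0.
  move=> rF'; have rq : r != q by apply: contraTneq rF' => ->.
  have -> : u r ord0 = (u^T *m e r) ord0 ord0 by rewrite tr_unit_vec [RHS]mxE eqxx mulr1n.
  rewrite trB trmx_mul mulmxBl -{1}(BF' r rF') -mulmxA (mulmxA B^T) BtB mul1mx tr_unit_vec.
  by rewrite subrr mxE.
have uF r : r \in F -> u r ord0 = 0 by move=> rF; apply: uF'; apply: (fintype.subsetP FF').
pose B1 := reflection u *m B.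
have B1F : fixing_mx (q |: F') B1.
  split=> [|r].
    by rewrite trmx_mul mulmxA -(mulmxA _ B) BB mulmx1 reflection_orthogonal.
  rewrite in_setU1 => /orP [/eqP ->|rF'].
    by rewrite -mulmxA swap.
  by rewrite -mulmxA BF' // reflection_col tr_unit_vec uF' // raddf0 mxE mulr0 scale0r subr0.
have [c hc cH0] := IH _ _ hk' FF2 B1F.
exists (c * -1); first by case: hc => ->; rewrite mulrN1 ?opprK; [right|left].
have BE : B = reflection u *m B1 by rewrite /B1 mulmxA reflection_sq // mul1mx.
have sH : H (diag3 1 (sign_mx (-1))).
  apply: fixing_diag3; first by rewrite expr1n.
  split=> [|r rF]; first by apply: sign_mx_orthogonal; rewrite sqrrN expr1n.
  by rewrite sign_mx_vec //; apply: contraTneq rF => ->.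
have ss : sign_mx (-1) *m sign_mx (-1) = 1%:M by rewrite sign_mxM mulrNN mulr1 sign_mx1.
have sV : invmx (diag3 1 (sign_mx (-1)) : M) = diag3 1 (sign_mx (-1)).
  by apply: invmx_involution; rewrite diag3_mul ss mulr1 diag3_1.
have := mulH0 (fixing0_reflection u0 uF) (conjH0 sH cH0).
rewrite sV !diag3_mul !mulr1; congr (H0 (diag3 1 _)).
by rewrite BE -sign_mxM !mulmxA -(mulmxA (reflection u) (sign_mx _)) ss mulmx1.
Qed.

Lemma pm_sqr (b : R) : b = 1 \/ b = -1 -> b ^+ 2 = 1.
Proof. by case=> ->; rewrite ?sqrrN expr1n. Qed.

Lemma J_frame : J = 2^-1 *: (xi *m eta^T + eta *m xi^T) + io *m io^T.
Proof.
apply: mx_ext3; rewrite mulmxDl -scalemxAl mulmxDl -!mulmxA ?J_xi ?J_eta ?J_io !frameE !mx0E ?mul_mx_scalar ?scalerA ?mulVf ?scale1r //.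
Qed.

(** g xi is a null vector, written in the frame. *)
Lemma lorentz_null g : lorentz n.+1 g ->
  (xi^T *m (g *m xi)) ord0 ord0 * (eta^T *m (g *m xi)) ord0 ord0 + nsq (io^T *m (g *m xi)) = 0.
Proof.
move/lorentzP => lg.
have : (g *m xi)^T *m (J *m (g *m xi)) = 0.
  by rewrite trmx_mul -mulmxA (mulmxA g^T) (mulmxA (g^T *m J)) lg mulmxA xiJ etaxi.
have xt : (g *m xi)^T *m xi = (xi^T *m (g *m xi))^T by rewrite [RHS]trmx_mul trmxK.
have et : (g *m xi)^T *m eta = (eta^T *m (g *m xi))^T by rewrite [RHS]trmx_mul trmxK.
have it : (g *m xi)^T *m io = (io^T *m (g *m xi))^T by rewrite [RHS]trmx_mul trmxK.
rewrite J_frame mulmxDl mulmxDr -scalemxAl -scalemxAr mulmxDl mulmxDr -!mulmxA.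
rewrite !(mulmxA (g *m xi)^T) xt et it nsqE.
move: (xi^T *m (g *m xi)) (eta^T *m (g *m xi)) => x y.
rewrite {1 2}[x]mx11_scalar {1 2}[y]mx11_scalar !tr_scalar_mx -!scalar_mxM.
move/matrixP/(_ ord0 ord0); by rewrite !mxE eqxx !mulr1n => <-; field.
Qed.

(** The big cell N_- P: when g xi has a nonzero xi-component, an element of N_-
    moves the line of g xi to the line of xi. *)
Lemma bruhat g : lorentz n.+1 g ->
  let a := (xi^T *m (g *m xi)) ord0 ord0 in a != 0 ->
  nm (a^-1 *: (io^T *m (g *m xi))) *m g *m xi = (a / 2) *: xi.
Proof.
move=> lg a pg.
have := lorentz_null lg; rewrite -/a -mulmxA.
have xa : xi^T *m (g *m xi) = a%:M by exact: mx11_scalar.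
have [c cE] : exists c, eta^T *m (g *m xi) = c%:M by eexists; exact: mx11_scalar.
rewrite cE; move: (g *m xi) xa cE => x xa cE.
have [u uE] : exists u, u = io^T *m x by eexists.
rewrite -uE; have -> : x = 2^-1 *: (a *: xi + c *: eta) + io *m u.
  rewrite uE -[LHS]mul1mx -resolution mulmxDl -scalemxAl mulmxDl -!mulmxA xa cE.
  by rewrite !mul_mx_scalar.
rewrite !mulmxDr -!scalemxAr mulmxDr -!scalemxAr nm_xi nm_eta.
rewrite (mulmxA (nm _)) nm_io mulmxDl trZ -mulmxA -!scalemxAl -!scalemxAr.
rewrite nsqE mul_mx_scalar [c%:M _ _]mxE eqxx mulr1n => E.
have nE : nsq u = - (a * c) by apply/eqP; rewrite -addr_eq0 addrC E.
rewrite nE.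
move: (io *m u) => d; apply/matrixP => p q; rewrite !mxlinE; field.
exact: pg.
Qed.

(** A and N_+ are connected, so an element of P is equivalent to its M-part. *)
Lemma parabolic_sign g d : H g -> g *m xi = d *: xi ->
  exists b c, [/\ b = 1 \/ b = -1, c = 1 \/ c = -1 & H0 (g *m diag3 b (sign_mx c))].
Proof.
move=> Hg gxi; have [b [B [t [v [hb BB dE gE]]]]] := lorentz_parabolic (fixing_lorentz Hg) gxi.
have nX := n_plus_Xp v.
have gE' : g = man b B t (Xp v) by rewrite man_np.
have [_ BF] : fixing_mx F B.
  by apply: (fixing_man (t := t) hb BB nX); rewrite -gE'.
have vF q : q \in F -> v q ord0 = 0.
  move=> qF; have [_ /(_ q qF)] := Hg.
  rewrite gE mulmxA -(mulmxA _ (np v) io) np_io mulmxDr mulmxA -(mulmxA _ (boost t) io) boost_io diag3_io.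
  rewrite -(mulmxA _ (boost t) xi) boost_xi -scalemxAr diag3_xi scalerA => h.
  have := congr1 (mulmx xi^T) h; rewrite (mulmxA _ io) xiio mul0mx.
  rewrite mulmxDl !mulmxDr !mulmxA xiio !mul0mx add0r -!scalemxAr -scalemxAl xixi -scalemxAl -mulmxA tr_unit_vec.
  rewrite mul_scalar_mx scalerA => /matrixP /(_ ord0 ord0).
  rewrite !mxE mulr1n => /eqP; rewrite !mulf_eq0 gt_eqF ?expR_gt0 //= pnatr_eq0 /=.
  by case: hb => ->; rewrite ?oppr_eq0 oner_eq0 /= => /eqP.
have [c hc cH0] := orthogonal_sign (fintype.subxx F) (conj BB BF).
exists b, c; split=> //.
pose s : M := diag3 b (sign_mx c).
have Hs : H s.
  apply: fixing_diag3; first exact: pm_sqr.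
  split=> [|r rF]; first by apply: sign_mx_orthogonal; exact: pm_sqr.
  by rewrite sign_mx_vec //; apply: contraTneq rF => ->.
have [us _] := lorentz_invE (fixing_lorentz Hs).
have -> : g *m s = diag3 b B *m s *m (invmx s *m (boost t *m np v) *m s).
  by rewrite gE !mulmxA mulmxK.
apply: mulH0; last by apply: (conjH0 Hs); apply: mulH0; [exact: fixing0_boost|exact: fixing0_np].
by rewrite /s diag3_mul -expr2 pm_sqr.
Qed.

(** On the big cell this reduces to P, as N_- is connected. Outside of it g xi is
    a multiple of eta, and a translation by N_+ leads back to the cell. *)
Lemma component_sign g : H g ->
  exists b c, [/\ b = 1 \/ b = -1, c = 1 \/ c = -1 & H0 (g *m diag3 b (sign_mx c))].
Proof.
move=> Hg; have lg := fixing_lorentz Hg; have [ug _] := lorentz_invE lg.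
wlog pg : g Hg lg ug / (xi^T *m (g *m xi)) ord0 ord0 != 0 => [IH|].
  have [x0|] := eqVneq ((xi^T *m (g *m xi)) ord0 ord0) 0; last exact: IH.
  (* This vector is admissible for every F, as the index 0 is never fixed. *)
  pose v := e ord0.
  have vF q : q \in F -> v q ord0 = 0.
    by move=> qF; rewrite mxE; case: eqP qF F0 => [->|] // -> .
  have Hnp : H (np v) by exact: fixing_np.
  have Hng : H (np v *m g) by exact: fixing_mul.
  have lng := fixing_lorentz Hng.
  have [||||b [c [hb hc bcH]]] := IH (np v *m g) => //.
  - by have [] := lorentz_invE lng.
  - have xi0 : xi^T *m (g *m xi) = 0 by rewrite [LHS]mx11_scalar x0 raddf0.
    have gn0 : g *m xi != 0.
      apply/eqP => h; have : xi = 0 by rewrite -[xi](mulKmx ug) h mulmx0.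
      move=> h'; have := xixi R n.+1; rewrite h' mulmx0 => /matrixP /(_ ord0 ord0).
      by rewrite !mxE => /eqP; rewrite eq_sym mulr1n pnatr_eq0.
    have io0 : io^T *m (g *m xi) = 0.
      by apply/eqP; rewrite -nsq_eq0; have := lorentz_null lg; rewrite x0 mul0r add0r => ->.
    have ex : (eta^T *m (g *m xi)) ord0 ord0 != 0.
      apply: contra gn0 => /eqP h; rewrite -[g *m xi]mul1mx -resolution mulmxDl -scalemxAl mulmxDl -!mulmxA.
      have e0 : eta^T *m (g *m xi) = 0 by rewrite [LHS]mx11_scalar h raddf0.
      by rewrite io0 xi0 e0 !mulmx0 !addr0 scaler0.
    have xn : xi^T *m np v = xi^T + 2 *: (v^T *m io^T) - (v^T *m v) *m eta^T.
      apply: mx_ext3; rewrite -mulmxA ?np_xi ?np_eta ?np_io mulmxBl mulmxDl -?scalemxAl -!mulmxA ?mulmxBr ?mulmxDr -?scalemxAr ?(mulmxA xi^T) !frameE !mx0E //.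
        by rewrite mul_mx_scalar mul_scalar_mx -scalemxAr.
      by rewrite mul_scalar_mx.
    rewrite -mulmxA mulmxA xn mulmxBl mulmxDl -scalemxAl -!mulmxA io0 xi0 !mx0E.
    have vv : nsq v = 1 by rewrite /nsq unit_vec_tr !mxE eqxx mulr1n.
    by rewrite (mulmxA v^T) nsqE vv mul1mx mxN oppr_eq0.
  exists b, c; split=> //.
  have -> : g = np (- v) *m (np v *m g) by rewrite mulmxA -np_add addNr np_0 mul1mx.
  rewrite -mulmxA; apply: mulH0 => //; apply: fixing0_np => q qF.
  by rewrite mxE vF // oppr0.
set a := (xi^T *m (g *m xi)) ord0 ord0 in pg.
pose y := - (a^-1 *: (io^T *m (g *m xi))).
have yF q : q \in F -> y q ord0 = 0.
  move=> qF; have -> : y q ord0 = ((e q)^T *m y) ord0 ord0 by rewrite unit_vec_tr [RHS]mxE eqxx mulr1n.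
  have [_ /(_ q qF) gq] := Hg.
  have : (io *m e q)^T *m (g *m xi) = 0.
    have -> : (io *m e q)^T = (io *m e q)^T *m J.
      by rewrite trmx_mul -mulmxA ioJ.
    rewrite -{1}gq trmx_mul !mulmxA -(mulmxA _ _ J) -(mulmxA _ _ g).
    by move/lorentzP: lg => ->; rewrite trmx_mul -!mulmxA (mulmxA io^T) ioJ ioxi mulmx0.
  rewrite trmx_mul -mulmxA => h.
  by rewrite /y mulmxN -scalemxAr h scaler0 oppr0 mxE.
have key : nm (- y) *m g *m xi = (a / 2) *: xi by rewrite /y opprK; exact: bruhat.
have Hp : H (nm (- y) *m g).
  by apply: fixing_mul => //; apply: fixing_nm => q qF; rewrite mxE yF // oppr0.
have [b [c [hb hc bcH]]] := parabolic_sign Hp key.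
exists b, c; split=> //.
have -> : g = nm y *m (nm (- y) *m g) by rewrite mulmxA -nm_add subrr nm_0 mul1mx.
by rewrite -mulmxA; apply: mulH0 => //; exact: fixing0_nm.
Qed.

End Component.

(** The time coordinate of the null vector g xi: it never vanishes, and its sign
    together with det g separates the four components. *)
Definition height g : R := (g *m xi) ord_max ord0.

Lemma heightE g : (xi^T - eta^T) *m (g *m xi) = (2 * height g)%:M.
Proof.
have -> : xi^T - eta^T = 2 *: delta_mx ord0 ord_max.
  by rewrite -trB xi_sub_eta linearZ /= trmx_delta.
by rewrite -scalemxAl -rowE; apply/matrixP => p q; rewrite !ord1 mxZ [RHS]mxE eqxx mulr1n [in LHS]mxE.
Qed.

Lemma height_1 : height 1%:M = 1.
Proof.
have := heightE 1%:M; rewrite mul1mx mulmxBl xixi etaxi subr0 => /matrixP /(_ ord0 ord0).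
by rewrite !mxE eqxx !mulr1n -[LHS]mulr1 => /mulfI <-.
Qed.

Lemma height_mul g p d : p *m xi = d *: xi -> height (g *m p) = d * height g.
Proof. by move=> pxi; rewrite /height -mulmxA pxi -scalemxAr mxE. Qed.

Lemma continuous_height : continuous height.
Proof.
by apply: continuous_coord; apply: continuous_mulmx => x; [exact: cvg_id|exact: cst_continuous].
Qed.

(** A null vector with vanishing time coordinate is zero. *)
Lemma height_neq0 g : lorentz n.+1 g -> height g != 0.
Proof.
move=> lg; have [ug _] := lorentz_invE lg; apply/eqP => h0.
have := heightE g; rewrite h0 mulr0 raddf0 mulmxBl => /eqP; rewrite subr_eq0 => /eqP E.
have := lorentz_null lg; rewrite E -expr2 => E0.
have s0 := sqr_ge0 ((eta^T *m (g *m xi)) ord0 ord0).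
have n0 : 0 <= nsq (io^T *m (g *m xi)) by rewrite nsq_sum; apply: sumr_ge0 => k _; exact: sqr_ge0.
have /andP [] : ((eta^T *m (g *m xi)) ord0 ord0 == 0) && (io^T *m (g *m xi) == 0).
  by rewrite -nsq_eq0 -sqrf_eq0 -paddr_eq0 // E0.
move=> /eqP a0 /eqP io0.
have e0 : eta^T *m (g *m xi) = 0 by rewrite [LHS]mx11_scalar a0 raddf0.
have gx : g *m xi = 0.
  rewrite -[LHS]mul1mx -resolution mulmxDl -scalemxAl mulmxDl -!mulmxA E e0 io0.
  by rewrite !mulmx0 !addr0 scaler0.
have x0 : xi = 0 by rewrite -[xi](mulKmx ug) gx mulmx0.
by have := height_1; rewrite /height mul1mx x0 mxE => /eqP; rewrite eq_sym oner_eq0.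
Qed.

Lemma lorentz_det_neq0 g : lorentz n.+1 g -> \det g != 0.
Proof. by case/lorentz_det => ->; rewrite ?oppr_eq0 oner_eq0. Qed.

Section Rep.
Variable F : {set 'I_n.+1}.
Hypothesis F0 : ord0 \notin F.
Local Notation H := (fixing F).
Local Notation H0 := (fixing0 F).

Lemma fixing0_height g : H0 g -> 0 < height g.
Proof.
apply: (component_pos (@fixing_1 F)); first exact: continuous_height.
  by move=> x /fixing_lorentz; exact: height_neq0.
by rewrite height_1.
Qed.

Lemma fixing0_det g : H0 g -> \det g = 1.
Proof.
move=> gH0; have lg := fixing_lorentz (component_sub gH0).
have := @component_pos _ _ _ (@fixing_1 F) (@determinant R _) g (@continuous_det R _).
rewrite det1 => /(_ _ ltr01 gH0) dg; case: (lorentz_det lg) dg => // -> dg.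
suff : 0 < -1 :> R by rewrite ltr0N1.
by apply: dg => x /fixing_lorentz; exact: lorentz_det_neq0.
Qed.

Lemma fixing0_man b B t X : b = 1 \/ b = -1 -> B *m B^T = 1%:M -> n_plus X ->
  H0 (man b B t X) -> b = 1 /\ \det B = 1.
Proof.
move=> hb hB nX pH0; split; last by have <- : \det (man b B t X) = \det B; [exact: man_det|exact: fixing0_det].
have := fixing0_height pH0.
rewrite -[man _ _ _ _]mul1mx (height_mul _ (man_xi _ _ _ nX)) height_1 mulr1 pmulr_lgt0 ?expR_gt0 //.
by case: hb => // ->; rewrite ltr0N1.
Qed.

(** The representative in M of the component of g ^ -1, an involution. It lies in
    the parabolic subgroup, so that translating a section by it on the right is
    determined by equivariance. *)
Definition component_rep g : M := diag3 (Num.sg (height g)) (sign_mx (\det g)).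

Lemma component_rep_unique g b c : H g -> b = 1 \/ b = -1 -> c = 1 \/ c = -1 ->
  H0 (g *m diag3 b (sign_mx c)) -> b = Num.sg (height g) /\ c = \det g.
Proof.
move=> Hg hb hc gH0; split.
  have := fixing0_height gH0; rewrite (height_mul _ (diag3_xi _ _)).
  case: hb => ->; first by rewrite mul1r => /gtr0_sg.
  by rewrite mulN1r oppr_gt0 => /ltr0_sg.
have := fixing0_det gH0; rewrite det_mulmx diag3_det sign_mx_det pm_sqr // mul1r.
case: hc => ->; first by rewrite mulr1.
by rewrite mulrN1 => <-; rewrite opprK.
Qed.

Lemma component_repP g : H g -> H0 (g *m component_rep g).
Proof.
move=> Hg; have [b [c [hb hc gH0]]] := component_sign F0 Hg.
by rewrite /component_rep; have [<- <-] := component_rep_unique Hg hb hc gH0.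
Qed.

Lemma component_rep_sg g : lorentz n.+1 g -> Num.sg (height g) = 1 \/ Num.sg (height g) = -1.
Proof.
move=> /height_neq0; case: (ltgtP (height g) 0) => // h _; first by right; exact: ltr0_sg.
by left; exact: gtr0_sg.
Qed.

Lemma fixing_sign b c : b = 1 \/ b = -1 -> c = 1 \/ c = -1 -> H (diag3 b (sign_mx c)).
Proof.
move=> hb hc; apply: fixing_diag3; first exact: pm_sqr.
split=> [|r rF]; first by apply: sign_mx_orthogonal; exact: pm_sqr.
by rewrite sign_mx_vec //; apply: contraTneq rF => ->.
Qed.

Lemma component_rep_fixing g : lorentz n.+1 g -> H (component_rep g).
Proof. by move=> lg; apply: fixing_sign; [exact: component_rep_sg|exact: lorentz_det]. Qed.

Lemma component_rep_involution g : lorentz n.+1 g -> component_rep g *m component_rep g = 1%:M.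
Proof.
move=> lg; rewrite /component_rep diag3_mul sign_mxM -!expr2.
by rewrite (pm_sqr (component_rep_sg lg)) (pm_sqr (lorentz_det lg)) sign_mx1 diag3_1.
Qed.

Lemma component_rep_mul g x : H g -> H0 x -> component_rep (g *m x) = component_rep g.
Proof.
move=> Hg xH0; have lg := fixing_lorentz Hg.
have Hr := component_rep_fixing lg; have rr := component_rep_involution lg.
have gx : H0 (g *m x *m component_rep g).
  have -> : g *m x *m component_rep g = g *m component_rep g *m (invmx (component_rep g) *m x *m component_rep g).
    by rewrite (invmx_involution rr) !mulmxA -(mulmxA g (component_rep g)) rr mulmx1.
  apply: (component_mul (@fixing_1 F) (@fixing_mul F)) (component_repP Hg) _.
  exact: (component_conj (@fixing_1 F) (@fixing_mul F) (@fixing_inv F) (@fixing_lorentz F)).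
have Hgx : H (g *m x) by apply: fixing_mul => //; exact: component_sub.
have := component_rep_unique Hgx (component_rep_sg lg) (lorentz_det lg) gx.
by rewrite /component_rep => -[<- <-].
Qed.

End Rep.

Lemma component_rep_locally_constant g : lorentz n.+1 g ->
  exists U : set M, [/\ open U, U g & forall h, U h -> lorentz n.+1 h -> component_rep h = component_rep g].
Proof.
move=> lg; have h0 := height_neq0 lg; have d0 := lorentz_det_neq0 lg.
have ch : continuous (fun h => height h * height g).
  by move=> h; exact: (cvgM (@continuous_height h) (@cvg_cst _ (height g) _ (nbhs h) _)).
have cd : continuous (fun h => \det h * \det g).
  by move=> h; exact: (cvgM (@continuous_det _ _ h) (@cvg_cst _ (\det g) _ (nbhs h) _)).
exists [set h | 0 < height h * height g /\ 0 < \det h * \det g]; split.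
- apply: openI.
    apply: (@open_comp _ _ (fun h => height h * height g) [set x | 0 < x]); last exact: open_gt.
    by move=> x _; exact: ch.
  apply: (@open_comp _ _ (fun h => \det h * \det g) [set x | 0 < x]); last exact: open_gt.
  by move=> x _; exact: cd.
- by split; rewrite -expr2 exprn_even_gt0.
- move=> h [hh dh] lh; rewrite /component_rep; congr (diag3 _ (sign_mx _)).
    have := gtr0_sg hh; rewrite sgrM.
    by case: (component_rep_sg lg) => ->; case: (component_rep_sg lh) => -> //; rewrite ?mulr1 ?mul1r => E; rewrite E.
  case: (lorentz_det lg) dh => ->; case: (lorentz_det lh) => -> //; rewrite ?mulr1 ?mul1r ltr0N1 //.
Qed.

Lemma lorentz_fixing : lorentz n.+1 = fixing finset.set0.
Proof.
apply/seteqP; split=> g; last by case.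
by move=> lg; split=> // q; rewrite inE.
Qed.

Lemma io_unit_vec q : io *m e q = basis_vec R (mid q).
Proof.
rewrite -colE /iota_mx -lock; apply/matrixP => p r; rewrite !mxE ord1 eqxx andbT.
by [].
Qed.

Lemma lorentz_stab_fixing : lorentz_stab n.+1 = fixing [set ord_max].
Proof.
have mE : mid ord_max = inord n.+1 :> 'I_n.+3 by apply: val_inj; rewrite /= inordK.
apply/seteqP; split=> g [lg gF]; split=> //.
  by move=> q; rewrite inE => /eqP ->; rewrite io_unit_vec mE.
by have := gF ord_max; rewrite inE eqxx io_unit_vec mE; apply.
Qed.

End Fixing.

(** * The upper left block *)

Section Lead.
Variables (R : realType) (n : nat).
Implicit Types B C : 'M[R]_n.+1.
Local Notation e := (@unit_vec R n).
Local Notation fix_last := (fixing_mx [set ord_max]).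

Let wl := widen_ord (leq_pred n.+1).

Lemma fix_last_col B p : fix_last B -> B p ord_max = (p == ord_max)%:R.
Proof.
move=> [_ BF]; have /matrixP /(_ p ord0) := BF ord_max (set11 _).
by rewrite -colE !mxE eqxx andbT.
Qed.

Lemma fix_last_tr B : fix_last B -> fix_last B^T.
Proof.
move=> [BB BF]; have BtB := mulmx1C BB; split=> [|q qF]; first by rewrite trmxK.
by rewrite -{1}(BF q qF) mulmxA BtB mul1mx.
Qed.

Lemma fix_last_row B p : fix_last B -> B ord_max p = (p == ord_max)%:R.
Proof. by move=> /fix_last_tr /(fix_last_col p); rewrite mxE. Qed.

Lemma leadE B p q : lead B p q = B (wl p) (wl q). Proof. by rewrite mxE. Qed.

Lemma wl_max p : (wl p == ord_max) = false.
Proof. by rewrite -val_eqE /= ltn_eqF. Qed.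

Lemma lead_mul B C : fix_last B -> lead (B *m C) = lead B *m lead C.
Proof.
move=> hB; apply/matrixP => p q; rewrite leadE !mxE big_ord_recr /=.
rewrite -[ord_max]/(ord_max : 'I_n.+1) fix_last_col // wl_max mul0r addr0.
by apply: eq_bigr => k _; rewrite !leadE; congr (B _ _ * C _ _); exact: val_inj.
Qed.

Lemma lead_tr B : lead B^T = (lead B)^T.
Proof. by apply/matrixP => p q; rewrite !mxE. Qed.

Lemma lead_1 : lead (1%:M : 'M[R]_n.+1) = 1%:M.
Proof. by apply/matrixP => p q; rewrite !mxE -!val_eqE. Qed.

Lemma lead_orthogonal B : fix_last B -> lead B *m (lead B)^T = 1%:M.
Proof. by move=> hB; rewrite -lead_tr -lead_mul //; case: hB => -> _; exact: lead_1. Qed.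

Lemma lead_det B : fix_last B -> \det (lead B) = \det B.
Proof.
move=> hB; rewrite (expand_det_row B ord_max) (bigD1 ord_max) //= big1 ?addr0 => [|q /negbTE h].
  rewrite fix_last_row // eqxx mul1r /cofactor addnn -signr_odd odd_double mul1r.
  congr (\det _); apply/matrixP => p q; rewrite !mxE; congr (B _ _); apply: val_inj => /=;
  by rewrite /bump leqNgt ltn_ord.
by rewrite fix_last_row // h mul0r.
Qed.

End Lead.

(** * Operators between sections given by maps of the fibres *)

Section FibreOp.
Variables (R : realType) (n : nat).
Local Notation M := 'M[R]_n.+3.
Implicit Types (g h X : M).

(** The four components have finitely many names, independent of g: operators may
    then depend on the component and still be smooth. *)
Definition component_tag g : bool * bool := (0 < height g, 0 < \det g).

Definition sign_of (a : bool) : R := if a then 1 else -1.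

Lemma sign_of_pm a : sign_of a = 1 \/ sign_of a = -1.
Proof. by case: a; [left|right]. Qed.

Definition tag_rep (tau : bool * bool) : M := diag3 (sign_of tau.1) (sign_mx n (sign_of tau.2)).

Lemma sg_sign_of (x : R) : x != 0 -> Num.sg x = sign_of (0 < x).
Proof.
by case: (ltgtP 0 x) => // h _; rewrite /sign_of; [exact: gtr0_sg|exact: ltr0_sg].
Qed.

Lemma det_sign_of g : lorentz n.+1 g -> \det g = sign_of (0 < \det g).
Proof. by case/lorentz_det => ->; rewrite /sign_of ?ltr01 // ltr0N1. Qed.

Lemma component_rep_tag g : lorentz n.+1 g -> component_rep g = tag_rep (component_tag g).
Proof.
move=> lg; rewrite /component_rep (sg_sign_of (height_neq0 lg)) {1}det_sign_of //.
Qed.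

Lemma tag_rep_inj tau tau' : tag_rep tau = tag_rep tau' -> tau = tau'.
Proof.
move=> E; have /(congr1 (fun A => (A *m xi R n.+1) ord_max ord0)) := E.
rewrite /tag_rep !diag3_xi !mxE.
have -> : xi R n.+1 ord_max ord0 = 1 by have := height_1 R n; rewrite /height mul1mx.
have /(congr1 determinant) := E; rewrite /tag_rep !diag3_det !sign_mx_det.
rewrite !(pm_sqr (sign_of_pm _)) !mul1r !mulr1.
have si a a' : sign_of a = sign_of a' -> a = a'.
  have n1 : (1 == -1 :> R) = false by apply/negbTE; rewrite -addr_eq0 paddr_eq0 ?ler01 // oner_eq0.
  by case: a; case: a' => // /eqP; rewrite /sign_of ?n1 // eq_sym n1.
by move=> /si e2 /si e1; case: tau tau' e1 e2 {E} => a b [a' b'] /= -> ->.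
Qed.

Lemma component_tag_locally_constant g : lorentz n.+1 g ->
  exists U : set M, [/\ open U, U g & forall h, U h -> lorentz n.+1 h -> component_tag h = component_tag g].
Proof.
move=> lg; have [U [oU Ug UE]] := component_rep_locally_constant lg.
exists U; split=> // h Uh lh; apply: tag_rep_inj.
by rewrite -!component_rep_tag //; exact: UE.
Qed.

Lemma lorentz_lie_tag g X t : lorentz n.+1 g -> lie (lorentz n.+1) X ->
  component_tag (g *m expm (t *: X)) = component_tag g.
Proof.
move=> lg lX; have lgX : lorentz n.+1 (g *m expm (t *: X)) by exact: lorentz_mul.
apply: tag_rep_inj; rewrite -!component_rep_tag //.
have F0 : ord0 \notin (finset.set0 : {set 'I_n.+1}) by rewrite finset.in_set0.
apply: (component_rep_mul F0); first by rewrite -lorentz_fixing.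
rewrite /fixing0 -lorentz_fixing; apply: component_expm => s.
by rewrite scalerA.
Qed.

Lemma lie_sub (H H' : set M) X : H `<=` H' -> lie H X -> lie H' X.
Proof. by move=> HH lX t; apply: HH. Qed.

Variables (H1 H2 : set M) (m1 i1 m2 i2 : nat).
Local Notation V1 := (extpow R m1 i1).
Local Notation V2 := (extpow R m2 i2).
Local Notation T := (bool * bool)%type.
Hypotheses (H1L : H1 `<=` lorentz n.+1) (H2L : H2 `<=` lorentz n.+1).
Hypothesis H1M : forall g h, H1 g -> H1 h -> H1 (g *m h).
Hypothesis H2M : forall g h, H2 g -> H2 h -> H2 (g *m h).
Variables (x y yi : T -> M) (L : T -> V1 -> V2)
  (w : T -> {ffun 'I_i2 -> 'I_m2} -> {ffun 'I_i1 -> 'I_m1} -> R).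
Hypothesis LE : forall tau u k, L tau u k = \sum_l (w tau k l)%:C * u l.
Hypothesis yyi : forall tau, y tau *m yi tau = 1%:M.

Definition fop_pt g : M := x (component_tag g) *m g *m y (component_tag g).
Hypothesis ptH : forall g, H2 g -> H1 (fop_pt g).
Hypothesis lieH : forall tau X, lie H2 X -> lie H1 (yi tau *m X *m y tau).

(** Star operators, translations, restriction to the identity component and
    extension from it are all of this form: on each component of the group a
    translation on both sides, followed by a real linear map of the fibres. *)
Definition fop (f : M -> V1) (g : M) : V2 :=
  if `[< H2 g >] then L (component_tag g) (f (fop_pt g)) else 0.

Lemma fopE f g : H2 g -> fop f g = L (component_tag g) (f (fop_pt g)).
Proof. by rewrite /fop => /asboolP ->. Qed.

Lemma fop_out f g : ~ H2 g -> fop f g = 0.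
Proof. by rewrite /fop => h; case: asboolP. Qed.

Lemma fop_linear_map tau : linear (L tau).
Proof.
move=> a u v; apply: extpowP => k; rewrite extpow_lin !LE mulr_sumr -big_split /=.
by apply: eq_bigr => l _; rewrite extpow_lin mulrDr mulrCA.
Qed.

Lemma fop_coord f g k c : H2 g -> real_coord (fop f) k c g =
  \sum_l w (component_tag g) k l * real_coord f l c (fop_pt g).
Proof.
move=> Hg; rewrite /real_coord fopE // LE.
have ReD (z z' : R[i]) : complex.Re (z + z') = complex.Re z + complex.Re z' by case: z; case: z'.
have ImD (z z' : R[i]) : complex.Im (z + z') = complex.Im z + complex.Im z' by case: z; case: z'.
have ReM (a : R) (z : R[i]) : complex.Re (a%:C * z) = a * complex.Re z by case: z => u v /=; rewrite mul0r subr0.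
have ImM (a : R) (z : R[i]) : complex.Im (a%:C * z) = a * complex.Im z by case: z => u v /=; rewrite mul0r addr0.
case: c.
  rewrite (big_morph _ ReD (erefl : complex.Re (0 : R[i]) = 0)).
  by apply: eq_bigr => l _; rewrite ReM.
rewrite (big_morph _ ImD (erefl : complex.Im (0 : R[i]) = 0)).
by apply: eq_bigr => l _; rewrite ImM.
Qed.

Lemma smooth_on_group_sum (H : set M) (I : Type) (r : seq I) (a : I -> R) (phi : I -> M -> R) :
  (forall l, smooth_on_group H (phi l)) ->
  smooth_on_group H (fun g => \sum_(l <- r) a l * phi l g).
Proof.
move=> sp; elim: r => [|l r IH].
  move=> g _; exists setT, (fun=> 0); split=> //; [exact: openT|exact: (@smooth_cst R M)|].
  by move=> h _ _; rewrite big_nil.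
have := smooth_on_group_lin (a l) 1 (sp l) IH.
have -> : a l *: phi l + 1 *: (fun g => \sum_(l <- r) a l * phi l g) =
  fun g => \sum_(l <- l :: r) a l * phi l g; last by [].
by apply/funext => g; rewrite big_cons scale1r.
Qed.

Lemma smooth_affine (U' : set M) (A B : M) (F : M -> R) : open U' -> smooth_on U' F ->
  smooth_on [set h | U' (A *m h *m B)] (fun h => F (A *m h *m B)).
Proof.
move=> oU' sF.
have cE : continuous (fun h : M => A *m h *m B).
  by apply: continuous_mulmx => [|z]; [exact: continuous_mulmxl|exact: cst_continuous].
apply: (@smooth_comp_mx R M _ _ _ U' (fun h : M => A *m h *m B) F) => //.
  by apply: open_comp => // z _; exact: cE.
move=> p q; apply: smooth_linear.
  by move=> a h h'; rewrite !mulmxDr !mulmxDl -!scalemxAr -!scalemxAl !mxE.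
exact: continuous_coord.
Qed.

Lemma fop_smooth f : (forall k c, smooth_on_group H1 (real_coord f k c)) ->
  forall k c, smooth_on_group H2 (real_coord (fop f) k c).
Proof.
move=> sf k c g Hg.
have [Ut [oUt Utg UtE]] := component_tag_locally_constant (H2L Hg).
set tau := component_tag g in UtE.
pose H' := [set h | H2 h /\ component_tag h = tau].
have s' l : smooth_on_group H' (fun h => real_coord f l c (x tau *m h *m y tau)).
  move=> h [Hh th]; have Hp : H1 (x tau *m h *m y tau) by rewrite -th; exact: ptH.
  have [U [F [oU Uh sF FE]]] := sf l c _ Hp.
  exists [set h | U (x tau *m h *m y tau)], (fun h => F (x tau *m h *m y tau)); split=> //.
  - apply: open_comp => // z _.
    by apply: continuous_mulmx => [|z']; [exact: continuous_mulmxl|exact: cst_continuous].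
  - exact: smooth_affine.
  - by move=> h' Uh' [Hh' th']; apply: FE => //; rewrite -th'; exact: ptH.
have Hg' : H' g by [].
have [U [F [oU Ug sF FE]]] := smooth_on_group_sum (index_enum _) (w tau k) s' Hg'.
exists (U `&` Ut), F; split=> //; first exact: openI.
  by apply: smooth_on_sub sF => z [].
move=> h [Uh Uth] Hh; have th := UtE h Uth (H2L Hh).
by rewrite FE // fop_coord // /fop_pt th.
Qed.

Definition fop_vectors tau (Xs : seq M) := [seq yi tau *m X *m y tau | X <- Xs].

(** Left translations commute with left invariant fields, and right translation
    by y conjugates them. Hence the seminorms of the image are dominated by the
    seminorms of the source. *)
Lemma fop_lie_deriv f (Xs : seq M) g k c : (forall k c, smooth_on_group H1 (real_coord f k c)) ->
  (forall X, X \in Xs -> lie H2 X) -> H2 g ->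
  lie_deriv Xs (real_coord (fop f) k c) g =
  \sum_l w (component_tag g) k l *
     lie_deriv (fop_vectors (component_tag g) Xs) (real_coord f l c) (fop_pt g).
Proof.
move=> sf lX Hg; set tau := component_tag g.
rewrite -(lie_deriv_sum H1M); first last.
- exact: ptH.
- by move=> l; apply: smooth_group_family; exact: sf.
- by move=> Y /mapP [X /lX XL ->]; exact: lieH.
rewrite [fop_pt g]/fop_pt -/tau.
have : component_tag g = tau by [].
clearbody tau.
elim: Xs lX g Hg => [|X Xs IH] lX g Hg tg.
  by rewrite /= fop_coord // /fop_pt tg.
have XL : lie H2 X by apply: lX; rewrite mem_head.
have lX' Y : Y \in Xs -> lie H2 Y by move=> Ys; apply: lX; rewrite in_cons Ys orbT.
rewrite /=; set u := (fun t : R => _); set v := (fun t : R => _).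
suff -> : u = v by [].
apply/funext => t; rewrite /u /v.
rewrite (IH lX' _ (H2M Hg (XL t))); last first.
  by rewrite lorentz_lie_tag //; [exact: H2L|exact: lie_sub XL].
congr (lie_deriv _ _ _).
have yiy : yi tau *m y tau = 1%:M by exact: mulmx1C.
rewrite scalemxAl scalemxAr (expm_conj _ yiy).
by rewrite !mulmxA -(mulmxA _ (y tau)) yyi mulmx1.
Qed.

Lemma fop_compact (K : set M) : compact K -> K `<=` H2 -> compact (fop_pt @` K).
Proof.
move=> cK KH; apply: continuous_compact => //.
apply/subspace_continuousP => g Kg.
have [U [oU Ug UE]] := component_tag_locally_constant (H2L (KH _ Kg)).
set tau := component_tag g in UE.
have cA : continuous (fun h : M => x tau *m h *m y tau).
  by apply: continuous_mulmx => [|z]; [exact: continuous_mulmxl|exact: cst_continuous].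
have : (fun h : M => x tau *m h *m y tau) @ within K (nbhs g) --> fop_pt g.
  by apply: cvg_trans (cA g); apply: cvg_app; exact: cvg_within.
apply: cvg_trans; apply: near_eq_cvg.
have : nbhs g U by exact: open_nbhs_nbhs.
apply: filterS => h Uh Kh.
by rewrite -[RHS]/(fop_pt h) /fop_pt (UE h Uh (H2L (KH _ Kh))).
Qed.

Lemma fop_supp f : (forall g, H2 g -> sphere_pt (fop_pt g) = sphere_pt g) -> supp (fop f) `<=` supp f.
Proof.
move=> pt; apply: closure_subset => _ [g fg <-].
have Hg : H2 g by apply: contrapT => h; apply: fg; exact: fop_out.
exists (fop_pt g); last exact: pt.
move=> /= f0; apply: fg; rewrite fopE // f0.
by apply: extpowP => k; rewrite LE big1 ?ffunE // => l _; rewrite ffunE mulr0.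
Qed.

Variables (r1 : 'M[R]_n.+1 -> 'M[R]_m1) (r2 : 'M[R]_n.+1 -> 'M[R]_m2).
Variables (lam1 lam2 : R[i]) (alpha1 alpha2 : 'Z_2).
Local Notation I := (principal_series H1 r1 i1 lam1 alpha1).
Local Notation J := (principal_series H2 r2 i2 lam2 alpha2).

Lemma ps_section (f : I) : is_section H1 r1 lam1 alpha1 (ps_fun f).
Proof. by case: f => f /=; rewrite inE. Qed.

(** W bounds the coefficients of all the fibre maps together. *)
Lemma fop_continuous (S : I -> J) : (forall f, ps_fun (S f) = fop (ps_fun f)) -> continuous_op S.
Proof.
move=> SE K Xss e [cK KH lX] e0.
pose W : R := \sum_tau \sum_k \sum_l `|w tau k l|.
have W0 : 0 <= W by do 3! (apply: sumr_ge0 => ? _).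
have d0 : 0 < e / (1 + W) by rewrite divr_gt0 // ltr_pwDl.
exists (fop_pt @` K), [seq fop_vectors tau Xs | tau <- index_enum _, Xs <- Xss], (e / (1 + W)); split=> //.
  split; first exact: fop_compact.
    by move=> _ [g Kg <-]; apply: ptH; exact: KH.
  move=> Ys Y /allpairsP [[tau Xs] [_ Xss' ->]] /mapP [X Xs' ->].
  by apply: lieH; exact: lX Xss' Xs'.
move=> f nf g Xs k c Kg Xsin; rewrite SE.
have Hg := KH _ Kg; have [_ sf _] := ps_section f.
rewrite fop_lie_deriv // => [|X XX]; last exact: lX Xsin XX.
set tau := component_tag g.
have le1 : \sum_l `|w tau k l| <= W.
  rewrite /W (bigD1 tau) //= (bigD1 k) //= -addrA lerDl addr_ge0 //.
    by do 2! (apply: sumr_ge0 => ? _).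
  by do 3! (apply: sumr_ge0 => ? _).
apply: (@le_lt_trans _ _ (\sum_l `|w tau k l| * (e / (1 + W)))).
  apply: le_trans (ler_norm_sum _ _ _) _; apply: ler_sum => l _.
  rewrite normrM ler_wpM2l // ltW //; apply: nf; first by exists g.
  by apply/allpairsP; exists (tau, Xs); split=> //; rewrite mem_index_enum.
rewrite -mulr_suml; apply: (@le_lt_trans _ _ (W * (e / (1 + W)))).
  by rewrite ler_wpM2r // ltW.
rewrite mulrA ltr_pdivrMr ?ltr_pwDl // mulrC ltr_pM2l //.
by rewrite ltrDr.
Qed.

(** Only the equivariance under P depends on the operator at hand. *)
Lemma fop_exists :
  (forall (f : M -> V1) g b B t X, is_section H1 r1 lam1 alpha1 f -> H2 g ->
     b = 1 \/ b = -1 -> B *m B^T = 1%:M -> n_plus X -> H2 (man b B t X) ->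
     fop f (g *m man b B t X) = sigma lam2 alpha2 b^-1 (invmx (r2 B)) (- t) (fop f g)) ->
  exists S : I -> J, [/\ forall f, ps_fun (S f) = fop (ps_fun f), linear S & continuous_op S].
Proof.
move=> eq.
have sec f : is_section H1 r1 lam1 alpha1 f -> fop f \in @sections R n.+1 H2 m2 r2 i2 lam2 alpha2.
  move=> hf; rewrite inE; split; [exact: fop_out| |by move=> *; exact: eq].
  by apply: fop_smooth; case: hf.
pose S (f : I) : J := PrincipalSeries (sec _ (ps_section f)).
exists S; split=> //; last exact: fop_continuous.
move=> a f g; apply: val_inj; apply/funext => h /=.
rewrite -[RHS]/(a *: fop (ps_fun f) h + fop (ps_fun g) h) /fop.
by case: asboolP => _; rewrite -?fop_linear_map // scaler0 addr0.
Qed.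

End FibreOp.

(** * Algebra of differential operators between principal series *)

Section PSGeneral.
Variables (R : realType) (n : nat).
Local Notation M := 'M[R]_n.+2.
Variables (H1 H2 : set M) (m1 m2 : nat) (r1 : 'M[R]_n -> 'M[R]_m1) (r2 : 'M[R]_n -> 'M[R]_m2).
Variables (i1 i2 : nat) (lam1 lam2 : R[i]) (alpha1 alpha2 : 'Z_2).
Local Notation I := (principal_series H1 r1 i1 lam1 alpha1).
Local Notation J := (principal_series H2 r2 i2 lam2 alpha2).

Lemma ps_out (f : I) g : ~ H1 g -> f g = 0.
Proof. by case: f => f /=; rewrite inE => -[h _ _]; exact: h. Qed.

Lemma psP (f f' : I) : (forall g, H1 g -> f g = f' g) -> f = f'.
Proof.
move=> e; apply: val_inj; apply/funext => g /=.
have [h|h] := pselect (H1 g); first exact: e.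
by rewrite !ps_out.
Qed.

Lemma ps_lin a (f f' : I) g : (a *: f + f') g = a *: f g + f' g.
Proof. by []. Qed.

Definition local_op (S : I -> J) := forall f, supp (S f) `<=` supp f.
(** Differential operators without equivariance: the star operators are
    equivariant only up to the determinant. *)
Definition local_continuous_op (S : I -> J) := [/\ linear S, continuous_op S & local_op S].

Lemma diff_opsE H (S : I -> J) : diff_ops H S <-> local_continuous_op S /\ equivariant H S.
Proof. by split=> [[[l e c] s]|[[l c s] e]]; split. Qed.

End PSGeneral.

Section PSComp.
Variables (R : realType) (n : nat).
Local Notation M := 'M[R]_n.+2.
Variables (H1 H2 H3 : set M) (m1 m2 m3 : nat).
Variables (r1 : 'M[R]_n -> 'M[R]_m1) (r2 : 'M[R]_n -> 'M[R]_m2) (r3 : 'M[R]_n -> 'M[R]_m3).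
Variables (i1 i2 i3 : nat) (lam1 lam2 lam3 : R[i]) (alpha1 alpha2 alpha3 : 'Z_2).
Local Notation I := (principal_series H1 r1 i1 lam1 alpha1).
Local Notation J := (principal_series H2 r2 i2 lam2 alpha2).
Local Notation K := (principal_series H3 r3 i3 lam3 alpha3).

Lemma linear_comp_op (S : I -> J) (S' : J -> K) : linear S -> linear S' -> linear (S' \o S).
Proof. by move=> lS lS' a f g /=; rewrite lS lS'. Qed.

Lemma continuous_comp_op (S : I -> J) (S' : J -> K) :
  continuous_op S -> continuous_op S' -> continuous_op (S' \o S).
Proof.
move=> cS cS' C Xss e sC e0.
have [C' [Xss' [d [sC' d0 h']]]] := cS' C Xss e sC e0.
have [C'' [Xss'' [d' [sC'' d'0 h'']]]] := cS C' Xss' d sC' d0.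
by exists C'', Xss'', d'; split=> // f nf; apply: h'; exact: h''.
Qed.

Lemma local_continuous_comp (S : I -> J) (S' : J -> K) : local_continuous_op S -> local_continuous_op S' -> local_continuous_op (S' \o S).
Proof.
move=> [lS cS sS] [lS' cS' sS']; split; first exact: linear_comp_op.
  exact: continuous_comp_op.
by move=> f x /sS' /sS.
Qed.

Lemma equivariant_comp H (S : I -> J) (S' : J -> K) :
  equivariant H S -> equivariant H S' -> equivariant H (S' \o S).
Proof. by move=> eS eS' x Hx f f' ff'; apply: eS' => //; exact: eS. Qed.

Lemma diff_ops_comp H (S : I -> J) (S' : J -> K) : diff_ops H S -> diff_ops H S' ->
  diff_ops H (S' \o S).
Proof.
move=> /diff_opsE [gS eS] /diff_opsE [gS' eS']; apply/diff_opsE; split.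
  exact: local_continuous_comp.
exact: equivariant_comp.
Qed.

Hypothesis H2M : forall g h, H2 g -> H2 h -> H2 (g *m h).

(** Real and imaginary parts mix under multiplication by a complex number; this
    accounts for the constant. *)
Lemma near0_lin a (u v : J) C Xss e : seminorm_index H2 C Xss ->
  0 < e -> near0 C Xss e u -> near0 C Xss e v ->
  near0 C Xss ((`|complex.Re a| + `|complex.Im a| + 2) * e) (a *: u + v : J).
Proof.
move=> [cC CH lX] e0 nu nv g Xs k c Cg Xsin.
have [_ su _] : is_section H2 r2 lam2 alpha2 (ps_fun u) by case: (u) => f /=; rewrite inE.
have [_ sv _] : is_section H2 r2 lam2 alpha2 (ps_fun v) by case: (v) => f /=; rewrite inE.
have -> : ps_fun (a *: u + v) = a *: ps_fun u + ps_fun v by [].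
pose phi (l : 'I_3) : M -> R := if l == 0 then real_coord (ps_fun u) k c
  else if l == 1 then real_coord (ps_fun u) k (~~ c) else real_coord (ps_fun v) k c.
pose b (l : 'I_3) : R := if l == 0 then complex.Re a
  else if l == 1 then (if c then - complex.Im a else complex.Im a) else 1.
have -> : real_coord (a *: ps_fun u + ps_fun v) k c = fun g => \sum_l b l * phi l g.
  rewrite real_coord_lin; apply/funext => h; rewrite !big_ord_recl big_ord0 addr0 /b /phi /=.
  by case: (c); rewrite addrA.
have lX' X : X \in Xs -> lie H2 X by exact: lX.
rewrite (lie_deriv_sum H2M) //; last 2 first.
- by move=> l; apply: smooth_group_family; rewrite /phi; case: ifP => _ //; case: ifP.
- exact: CH.
have bd l : `|lie_deriv Xs (phi l) g| <= e.
  by apply: ltW; rewrite /phi; case: ifP => _; [exact: nu|case: ifP => _; [exact: nu|exact: nv]].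
apply: le_lt_trans (ler_norm_sum _ _ _) _.
apply: (@le_lt_trans _ _ (\sum_l `|b l| * e)).
  by apply: ler_sum => l _; rewrite normrM ler_wpM2l.
rewrite -mulr_suml ltr_pM2r // !big_ord_recl big_ord0 /b /= normr1.
by case: (c); rewrite ?normrN; lra.
Qed.

Lemma local_continuous_lin a (S S' : I -> J) : local_continuous_op S -> local_continuous_op S' -> local_continuous_op (fun f => a *: S f + S' f).
Proof.
move=> [lS cS sS] [lS' cS' sS']; split.
- move=> c f g; rewrite lS lS' !scalerDr !scalerA (mulrC a) -!addrA; congr (_ + _).
  by rewrite !addrA; congr (_ + _); rewrite addrC.
- move=> C Xss e sC e0.
  set D := `|complex.Re a| + `|complex.Im a| + 2.
  have D0 : 0 < D by rewrite ltr_wpDl // addr_ge0.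
  have e'0 : 0 < e / D by rewrite divr_gt0.
  have [C1 [X1 [d1 [[c1 CH1 l1] d10 h1]]]] := cS C Xss _ sC e'0.
  have [C2 [X2 [d2 [[c2 CH2 l2] d20 h2]]]] := cS' C Xss _ sC e'0.
  exists (C1 `|` C2), (X1 ++ X2), (Num.min d1 d2); split.
  + split; first exact: compactU.
      by move=> g [/CH1|/CH2].
    by move=> Xs X; rewrite mem_cat => /orP [/l1|/l2]; apply.
  + by rewrite lt_min d10.
  + move=> f nf; have -> : e = D * (e / D) by rewrite mulrC divfK // gt_eqF.
    apply: near0_lin => //; [apply: h1|apply: h2] => g Xs k c Cg Xin.
      have := nf g Xs k c (or_introl Cg); rewrite mem_cat Xin => /(_ erefl).
      by rewrite lt_min => /andP [].
    have := nf g Xs k c (or_intror Cg); rewrite mem_cat Xin orbT => /(_ erefl).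
    by rewrite lt_min => /andP [].
- move=> f x; rewrite /supp => hx.
  have : (closure [set sphere_pt g | g in [set g | S f g <> 0]] `|`
          closure [set sphere_pt g | g in [set g | S' f g <> 0]]) x.
    rewrite -closureU; apply: closure_subset hx => _ [g /= gn <-].
    have [S0|S0] := pselect (S f g = 0); last by left; exists g.
    right; exists g => //= S'0; apply: gn.
    by rewrite -[LHS]/(a *: S f g + S' f g) S0 S'0 scaler0 addr0.
  by case=> [/sS|/sS'].
Qed.

Lemma equivariant_lin H a (S S' : I -> J) : equivariant H S -> equivariant H S' ->
  equivariant H (fun f => a *: S f + S' f).
Proof.
move=> eS eS' x Hx f f' ff'.
have -> : ps_fun (a *: S f' + S' f') = a *: ps_fun (S f') + ps_fun (S' f') by [].
by rewrite (eS _ Hx _ _ ff') (eS' _ Hx _ _ ff').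
Qed.

Lemma diff_ops_lin H a (S S' : I -> J) : diff_ops H S -> diff_ops H S' ->
  diff_ops H (fun f => a *: S f + S' f).
Proof.
move=> /diff_opsE [gS eS] /diff_opsE [gS' eS']; apply/diff_opsE; split.
  exact: local_continuous_lin.
exact: equivariant_lin.
Qed.

End PSComp.

Lemma pm_mul (R : realType) (a b : R) : a = 1 \/ a = -1 -> b = 1 \/ b = -1 ->
  a * b = 1 \/ a * b = -1.
Proof.
by case=> ->; case=> ->; rewrite ?mulr1 ?mulrNN ?mulrN1 ?mulr1 ?opprK ?mul1r; (by left) || (by right).
Qed.

(** * Star operators, translations, restriction and extension *)

Section Operators.
Variables (R : realType) (n m : nat).
Local Notation M := 'M[R]_n.+3.
Local Notation xi := (xi R n.+1).
Variables (F : {set 'I_n.+1}) (r : 'M[R]_n.+1 -> 'M[R]_m) (G : set M).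
Hypotheses (F0 : ord0 \notin F) (GE : G = fixing F).
Hypothesis rM : forall B C, fixing_mx F B -> fixing_mx F C -> r (B *m C) = r B *m r C.
Hypothesis r1 : r 1%:M = 1%:M.
Hypothesis rO : forall B, fixing_mx F B -> r B *m (r B)^T = 1%:M.
Hypothesis rD : forall B, fixing_mx F B -> \det (r B) = \det B.
Implicit Types (g h X : M) (lam : R[i]) (alpha : 'Z_2).
Local Notation G0 := (connected_component G 1%:M).

Lemma group_1 : G 1%:M. Proof. by rewrite GE; exact: fixing_1. Qed.
Lemma group_mul g h : G g -> G h -> G (g *m h). Proof. by rewrite GE; exact: fixing_mul. Qed.
Lemma group_inv g : G g -> G (invmx g). Proof. by rewrite GE; exact: fixing_inv. Qed.
Lemma group_lorentz : G `<=` lorentz n.+1. Proof. by rewrite GE; exact: fixing_lorentz. Qed.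

(** What G and its identity component have in common, so that the operators below
    are constructed for both at once. *)
Record subgroup (H : set M) : Prop := Subgroup {
  sub_mul : forall g h, H g -> H h -> H (g *m h);
  sub_inv : forall g, H g -> H (invmx g);
  sub_1 : H 1%:M;
  sub_group : H `<=` G }.

Lemma subgroup_G : subgroup G.
Proof. by split=> //; [exact: group_mul|exact: group_inv|exact: group_1]. Qed.

Lemma subgroup_G0 : subgroup G0.
Proof.
split.
- exact: component_mul group_1 group_mul.
- exact: (component_inv group_1 group_mul group_inv group_lorentz).
- exact: component_1 group_1.
- exact: component_sub.
Qed.

Lemma sub_lorentz H : subgroup H -> H `<=` lorentz n.+1.
Proof. by move=> sH g /(sub_group sH) /group_lorentz. Qed.

Lemma sub_man H b B t X : subgroup H -> b = 1 \/ b = -1 -> B *m B^T = 1%:M -> n_plus X ->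
  H (man b B t X) -> fixing_mx F B.
Proof. by move=> sH hb BB nX /(sub_group sH); rewrite GE; exact: fixing_man. Qed.

Lemma invmx_r B : fixing_mx F B -> invmx (r B) = (r B)^T.
Proof.
by move=> /rO; exact: invmx_eq.
Qed.

Lemma sub_invl H x g : subgroup H -> H x -> H (invmx x *m g) <-> H g.
Proof.
move=> sH Hx; have [ux _] := lorentz_invE (sub_lorentz sH Hx).
split=> h; last by apply: (sub_mul sH) => //; exact: (sub_inv sH).
by rewrite -(mulKVmx ux g); exact: (sub_mul sH).
Qed.

Lemma sphere_pt_mul g p d : d != 0 -> p *m xi = d *: xi -> sphere_pt (g *m p) = sphere_pt g.
Proof.
move=> d0 pxi; apply/rowP => k; rewrite [LHS]mxE [RHS]mxE /= xi_basis -mulmxA pxi -scalemxAr.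
by move: (g *m xi) => v; rewrite [X in X / _]mxE [X in _ / X]mxE -mulf_div divff // mul1r.
Qed.

Section Twist.
Variables (i i' : nat) (L : extpow R m i -> extpow R m i')
  (w : {ffun 'I_i' -> 'I_m} -> {ffun 'I_i -> 'I_m} -> R).
Hypothesis LE : forall u k, L u k = \sum_l (w k l)%:C * u l.
Hypothesis L_map : forall C u, C *m C^T = 1%:M ->
  L (extpow_map C u) = (\det C)%:C *: extpow_map C (L u).

Lemma twist_linear : linear L.
Proof.
move=> a u v; apply: extpowP => k; rewrite extpow_lin !LE mulr_sumr -big_split /=.
by apply: eq_bigr => l _; rewrite extpow_lin mulrDr mulrCA.
Qed.

(** The twist by det g is forced: right translation by p in P changes star by the
    determinant of its M-part, which is det p. *)
Definition twisted H lam alpha (S : principal_series H r i lam alpha -> principal_series H r i' lam alpha) :=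
  local_continuous_op S /\ forall f g, H g -> S f g = (\det g)%:C *: L (f g).

(** The twist is constant on components, so the operator is given by the fibre
    maps sign * L. *)
Lemma twist_exists H lam alpha : subgroup H -> exists S, @twisted H lam alpha S.
Proof.
move=> sH; have HL := sub_lorentz sH; have HM := sub_mul sH.
pose x (tau : bool * bool) : M := 1%:M.
pose L' (tau : bool * bool) u := (sign_of R tau.2)%:C *: L u.
pose w' (tau : bool * bool) k l := sign_of R tau.2 * w k l.
have LE' tau u k : L' tau u k = \sum_l (w' tau k l)%:C * u l.
  rewrite /L' extpow_scale LE mulr_sumr; apply: eq_bigr => l _.
  by rewrite mulrA -rmorphM.
have xx tau : x tau *m x tau = 1%:M by rewrite mulmx1.
have ptE g : fop_pt x x g = g by rewrite /fop_pt mul1mx mulmx1.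
have pt g : H g -> H (fop_pt x x g) by rewrite ptE.
have lH tau X : lie H X -> lie H (x tau *m X *m x tau) by rewrite mul1mx mulmx1.
have [|S [SE lS cS]] := @fop_exists R n H H m i m i' HL HM HM x x x L' w' LE' xx pt lH r r lam lam alpha alpha.
  move=> f g b B t X [_ _ ef] Hg hb BB nX Hp.
  have hB := sub_man sH hb BB nX Hp.
  rewrite !fopE //; last exact: HM.
  rewrite !ptE /L' -!det_sign_of; try by apply: HL => //; exact: HM.
  have dp : \det (man b B t X) = \det B by exact: man_det.
  rewrite det_mulmx dp (ef g b B t X) //.
  have zz : invmx (r B) *m (invmx (r B))^T = 1%:M.
    by rewrite invmx_r // trmxK; exact: mulmx1C (rO hB).
  have Lz c v : L (c *: v) = c *: L v.
    have := twist_linear c v 0; rewrite !addr0 => ->.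
    rewrite (_ : L 0 = 0) ?addr0 //; apply: extpowP => k.
    by rewrite LE big1 ?ffunE // => l _; rewrite ffunE mulr0.
  rewrite /sigma Lz L_map // extpow_mapZ !scalerA; congr (_ *: _).
  rewrite invmx_r // det_tr rD // rmorphM /=.
  have dB : (\det B)%:C * (\det B)%:C = 1 :> R[i].
    rewrite -rmorphM /= -(rD hB) -{2}det_tr -det_mulmx rO // det1 //.
  move: dB; set d := (\det B)%:C; set c := _ * cexp _; set a := (\det g)%:C => dB.
  by rewrite -[RHS]mulr1 -dB; ring.
exists S; split; last by move=> f g Hg; rewrite SE fopE // ptE /L' -det_sign_of //; exact: HL.
split=> // f; rewrite SE; apply: (fop_supp LE') => g _.
by rewrite ptE.
Qed.

Lemma twisted_translate H lam alpha S (f f' : principal_series H r i lam alpha) x : subgroup H -> @twisted H lam alpha S -> H x ->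
  ps_fun f' = translate x f -> ps_fun (S f') = (\det x)%:C *: translate x (S f).
Proof.
move=> sH [_ SE] Hx ff'; apply/funext => g; rewrite -[RHS]/((\det x)%:C *: ps_fun (S f) (invmx x *m g)).
have [Hg|Hg] := pselect (H g); last first.
  rewrite ps_out // ps_out ?scaler0 // => Hxg; apply: Hg; move: Hxg.
  by move=> /(sub_invl _ sH Hx).
have Hxg : H (invmx x *m g) by exact/(sub_invl _ sH Hx).
rewrite !SE // ff' scalerA -rmorphM /= -det_mulmx mulmxA mulmxV ?mul1mx //.
by have [] := lorentz_invE (sub_lorentz sH Hx).
Qed.

End Twist.

Lemma translate_exists H i lam alpha x : subgroup H -> H x ->
  exists S : principal_series H r i lam alpha -> principal_series H r i lam alpha,
    [/\ forall f, ps_fun (S f) = translate x f, linear S & continuous_op S].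
Proof.
move=> sH Hx; have HL := sub_lorentz sH; have HM := sub_mul sH.
pose x1 (tau : bool * bool) : M := 1%:M.
pose x' (tau : bool * bool) : M := invmx x.
pose L' (tau : bool * bool) (u : extpow R m i) := u.
pose w' (tau : bool * bool) (k l : {ffun 'I_i -> 'I_m}) : R := (k == l)%:R.
have LE' tau u k : L' tau u k = \sum_l (w' tau k l)%:C * u l.
  rewrite (bigD1 k) //= /w' eqxx mul1r big1 ?addr0 // => l /negbTE.
  by rewrite eq_sym => ->; rewrite mul0r.
have xx tau : x1 tau *m x1 tau = 1%:M by rewrite mulmx1.
have ptE g : fop_pt x' x1 g = invmx x *m g by rewrite /fop_pt mulmx1.
have pt g : H g -> H (fop_pt x' x1 g) by rewrite ptE => Hg; exact/(sub_invl _ sH Hx).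
have lH tau X : lie H X -> lie H (x1 tau *m X *m x1 tau) by rewrite mul1mx mulmx1.
have [|S [SE lS cS]] := @fop_exists R n H H m i m i HL HM HM x' x1 x1 L' w' LE' xx pt lH r r lam lam alpha alpha.
  move=> f g b B t X [_ _ ef] Hg hb BB nX Hp.
  rewrite !fopE //; last exact: HM.
  rewrite !ptE /L' mulmxA; apply: ef => //.
  exact/(sub_invl _ sH Hx).
exists S; split=> // f; apply/funext => g; rewrite SE.
have [Hg|Hg] := pselect (H g); first by rewrite fopE // ptE.
by rewrite fop_out // /translate ps_out //; apply: contra_not Hg => /(sub_invl _ sH Hx).
Qed.

Section ResExt.
Variables (i : nat) (lam : R[i]) (alpha : 'Z_2).
Local Notation PG := (principal_series G r i lam alpha).
Local Notation PG0 := (principal_series G0 r i lam 0).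

Let sG := subgroup_G.
Let sG0 := subgroup_G0.

(** The height of an element of P has the sign of b. *)
Lemma component_man b B t X : b = 1 \/ b = -1 -> B *m B^T = 1%:M -> n_plus X ->
  G0 (man b B t X) -> b = 1.
Proof. by rewrite GE => hb BB nX /(fixing0_man hb BB nX) []. Qed.

Lemma res_exists : exists S : PG -> PG0, local_continuous_op S /\ forall f g, G0 g -> S f g = f g.
Proof.
have HL := sub_lorentz sG; have HM := sub_mul sG.
have HL0 := sub_lorentz sG0; have HM0 := sub_mul sG0.
pose x1 (tau : bool * bool) : M := 1%:M.
pose L' (tau : bool * bool) (u : extpow R m i) := u.
pose w' (tau : bool * bool) (k l : {ffun 'I_i -> 'I_m}) : R := (k == l)%:R.
have LE' tau u k : L' tau u k = \sum_l (w' tau k l)%:C * u l.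
  rewrite (bigD1 k) //= /w' eqxx mul1r big1 ?addr0 // => l /negbTE.
  by rewrite eq_sym => ->; rewrite mul0r.
have xx tau : x1 tau *m x1 tau = 1%:M by rewrite mulmx1.
have ptE g : fop_pt x1 x1 g = g by rewrite /fop_pt mul1mx mulmx1.
have pt g : G0 g -> G (fop_pt x1 x1 g) by rewrite ptE; exact: component_sub.
have lH tau X : lie G0 X -> lie G (x1 tau *m X *m x1 tau).
  by rewrite mul1mx mulmx1; apply: lie_sub; exact: component_sub.
have [|S [SE lS cS]] := @fop_exists R n G G0 m i m i HL0 HM HM0 x1 x1 x1 L' w' LE' xx pt lH r r lam lam alpha 0.
  move=> f g b B t X [_ _ ef] Hg hb BB nX Hp.
  rewrite !fopE //; last exact: HM0.
  rewrite !ptE /L' (ef g b B t X) //; try exact: component_sub.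
  by rewrite /sigma (component_man hb BB nX Hp) invr1 !expr1n.
exists S; split; last by move=> f g Hg; rewrite SE fopE // ptE.
split=> // f; rewrite SE; apply: (fop_supp LE') => g _.
by rewrite ptE.
Qed.

(** The value of sigma at the representative of the component, which is an
    involution. *)
Definition ext_map (tau : bool * bool) (u : extpow R m i) : extpow R m i :=
  (sign_of R tau.1)%:C ^+ alpha *: extpow_map (r (sign_mx n (sign_of R tau.2))) u.

Lemma tag_rep_group tau : G (tag_rep R n tau).
Proof. by rewrite GE; apply: fixing_sign => //; exact: sign_of_pm. Qed.

Lemma tag_rep_sq tau : tag_rep R n tau *m tag_rep R n tau = 1%:M.
Proof.
by rewrite /tag_rep diag3_mul sign_mxM -!expr2 !(pm_sqr (sign_of_pm _ _)) sign_mx1 diag3_1.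
Qed.

Lemma tag_rep_component g : G g -> G0 (g *m tag_rep R n (component_tag g)).
Proof.
move=> Gg; rewrite -component_rep_tag; last exact: group_lorentz.
by move: Gg; rewrite GE; exact: component_repP.
Qed.

Lemma fixing_mx_sign a : fixing_mx F (sign_mx n (sign_of R a)).
Proof.
split=> [|q qF]; first by apply: sign_mx_orthogonal; apply: pm_sqr; exact: sign_of_pm.
by rewrite sign_mx_vec //; apply: contraTneq qF => ->.
Qed.

Lemma component_tag_mul g h : G g -> G0 h -> component_tag (g *m h) = component_tag g.
Proof.
move=> Gg Gh; have Gh' := component_sub Gh.
apply: (@tag_rep_inj R n); rewrite -!component_rep_tag; try by apply: group_lorentz => //; exact: group_mul.
by move: Gg Gh; rewrite GE; exact: component_rep_mul.
Qed.

Lemma component_tag_mull g h : G g -> G0 h -> component_tag (h *m g) = component_tag g.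
Proof.
move=> Gg Gh; have [ug _] := lorentz_invE (group_lorentz Gg).
have -> : h *m g = g *m (invmx g *m h *m g) by rewrite !mulmxA mulmxV // mul1mx.
apply: component_tag_mul => //.
exact: (component_conj group_1 group_mul group_inv group_lorentz).
Qed.

(** Each component of G meets P in a representative s, and the value at g of an
    extension has to be sigma (s) f (g s). Equivariance holds because for p in P
    the representatives s of g and s' of g p satisfy s p s' in P, in the identity
    component. *)
Lemma ext_exists : exists S : PG0 -> PG, local_continuous_op S /\
  forall f g, G g -> S f g = ext_map (component_tag g) (f (g *m tag_rep R n (component_tag g))).
Proof.
have HL := sub_lorentz sG; have HM := sub_mul sG.
have HL0 := sub_lorentz sG0; have HM0 := sub_mul sG0.
pose x1 (tau : bool * bool) : M := 1%:M.
pose s := @tag_rep R n.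
pose w' (tau : bool * bool) (k l : {ffun 'I_i -> 'I_m}) : R :=
  sign_of R tau.1 ^+ alpha * \prod_(a < i) r (sign_mx n (sign_of R tau.2)) (k a) (l a).
have LE' tau u k : ext_map tau u k = \sum_l (w' tau k l)%:C * u l.
  rewrite /ext_map extpow_scale extpow_mapE mulr_sumr; apply: eq_bigr => l _.
  by rewrite mulrA /w' rmorphM rmorphXn rmorph_prod.
have ptE g : fop_pt x1 s g = g *m s (component_tag g) by rewrite /fop_pt mul1mx.
have pt g : G g -> G0 (fop_pt x1 s g) by rewrite ptE; exact: tag_rep_component.
have lH tau X : lie G X -> lie G0 (s tau *m X *m s tau).
  move=> lX; apply: (@lie_component _ _ G) => t.
  rewrite scalemxAl scalemxAr expm_conj ?tag_rep_sq //.
  by do 2?apply: group_mul => //; exact: tag_rep_group.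
have [|S [SE lS cS]] := @fop_exists R n G0 G m i m i HL HM0 HM x1 s s ext_map w' LE' tag_rep_sq pt lH r r lam lam 0 alpha.
  move=> f g b B t X [_ _ ef] Gg hb BB nX Gp.
  have hB := sub_man sG hb BB nX Gp.
  have Ggp : G (g *m man b B t X) by exact: HM.
  rewrite !fopE // !ptE.
  move: (tag_rep_component Ggp) (tag_rep_component Gg); rewrite -!/(s _).
  set tau := component_tag g; set tau' := component_tag _ => gp0 g0.
  have [X' nX' cE] := @man_conj R n.+1 b B t X nX _ _ (pm_sqr (sign_of_pm R tau'.1)) (fixing_mx_sign tau'.2).1.
  pose b' := sign_of R tau.1 * (b * sign_of R tau'.1).
  pose B' := sign_mx n (sign_of R tau.2) *m (B *m sign_mx n (sign_of R tau'.2)).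
  have pE : s tau *m man b B t X *m s tau' = man b' B' t X'.
    by rewrite -mulmxA cE man_conjl.
  have gE : g *m man b B t X *m s tau' = g *m s tau *m man b' B' t X'.
    by rewrite -pE !mulmxA -(mulmxA g (s tau)) tag_rep_sq mulmx1.
  have p0 : G0 (man b' B' t X').
    have -> : man b' B' t X' = invmx (g *m s tau) *m (g *m man b B t X *m s tau').
      have [u0 _] := lorentz_invE (HL0 _ g0).
      by rewrite gE mulKmx.
    by apply: HM0 => //; exact: (sub_inv sG0).
  have hb' : b' = 1 \/ b' = -1.
    by apply: pm_mul; [exact: sign_of_pm|apply: pm_mul => //; exact: sign_of_pm].
  have hS := fixing_mx_sign tau.2; have hS' := fixing_mx_sign tau'.2.
  have FM (B1 C1 : 'M[R]_n.+1) : fixing_mx F B1 -> fixing_mx F C1 -> fixing_mx F (B1 *m C1).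
    move=> [B1B B1F] [C1C C1F]; split=> [|q qF]; last by rewrite -mulmxA C1F // B1F.
    by rewrite trmx_mul mulmxA -(mulmxA B1) C1C mulmx1.
  have hB' : fixing_mx F B' by exact: (FM _ _ hS (FM _ _ hB hS')).
  have b'1 := component_man hb' hB'.1 nX' p0.
  rewrite gE (ef _ b' B' t X' g0 hb' hB'.1 nX' p0) b'1 /sigma invr1 expr1n mul1r.
  rewrite /ext_map !extpow_mapZ !scalerA -!extpow_map_comp.
  have -> : r (sign_mx n (sign_of R tau'.2)) *m invmx (r B') = invmx (r B) *m r (sign_mx n (sign_of R tau.2)).
    rewrite !invmx_r // /B' !rM //; last exact: FM.
    rewrite !trmx_mul !mulmxA rO // mul1mx; congr (_ *m _).
    rewrite -invmx_r //; apply: invmx_involution.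
    rewrite -rM // sign_mxM -expr2 pm_sqr ?sign_mx1 //; exact: sign_of_pm.
  rewrite [in RHS]mulrAC; congr ((_ * _) *: _).
  rewrite -!exprMn -!rmorphM /=; congr (_%:C ^+ _).
  move: b'1; rewrite /b'; case: (sign_of_pm R tau.1) => ->; case: (sign_of_pm R tau'.1) => ->; case: hb => ->; rewrite ?invr1 ?invrN1 ?mulr1 ?mulrN1 ?mulN1r ?opprK //.
exists S; split; last by move=> f g Hg; rewrite SE fopE // ptE.
split=> // f; rewrite SE; apply: (fop_supp LE') => g _.
rewrite ptE; apply: (@sphere_pt_mul _ _ (sign_of R (component_tag g).1)); last exact: diag3_xi.
by rewrite /sign_of; case: ifP => _; rewrite ?oppr_eq0 oner_eq0.
Qed.

Variables (Res : PG -> PG0) (Ext : PG0 -> PG).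
Hypothesis ResE : forall f g, G0 g -> Res f g = f g.
Hypothesis ExtE : forall f g, G g ->
  Ext f g = ext_map (component_tag g) (f (g *m tag_rep R n (component_tag g))).

(** The identity component has the trivial representative. *)
Lemma ext_res f : Res (Ext f) = f.
Proof.
apply: psP => g Gg0; have Gg := component_sub Gg0.
rewrite ResE // ExtE // /ext_map.
have t1 : component_tag g = (true, true).
  rewrite -[g]mulmx1; rewrite component_tag_mull // ?group_1 //; last exact: group_1.
  by rewrite /component_tag height_1 det1 ltr01.
by rewrite t1 /tag_rep /sign_of /= sign_mx1 diag3_1 mulmx1 r1 extpow_map1 expr1n scale1r.
Qed.

Lemma n_plus_0 : @n_plus R n.+1 0.
Proof. by split=> [t|]; rewrite ?scaler0 ?expm0 ?mulmx0 ?mul0mx ?subr0 //; exact: lorentz_1. Qed.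

Lemma man_diag3 b (B : 'M[R]_n.+1) : man b B 0 0 = diag3 b B.
Proof. by rewrite /man scale0r !expm0 !mulmx1. Qed.

Lemma res_ext f : Ext (Res f) = f.
Proof.
apply: psP => g Gg; rewrite ExtE // ResE //; last exact: tag_rep_component.
have [_ _ ef] : is_section G r lam alpha (ps_fun f) by case: (f) => h /=; rewrite inE.
set tau := component_tag g.
have := ef g (sign_of R tau.1) (sign_mx n (sign_of R tau.2)) 0 0 Gg (sign_of_pm R _) (fixing_mx_sign _).1 n_plus_0.
rewrite /= -[_ *m _ *m _]/(man (sign_of R tau.1) (sign_mx n (sign_of R tau.2)) 0 0) man_diag3.
move=> /(_ (tag_rep_group tau)); rewrite -/(tag_rep R n tau) => ->.
rewrite /ext_map /sigma extpow_mapZ scalerA -extpow_map_comp.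
have hS := fixing_mx_sign tau.2.
have -> : r (sign_mx n (sign_of R tau.2)) *m invmx (r (sign_mx n (sign_of R tau.2))) = 1%:M.
  by rewrite invmx_r // rO.
rewrite extpow_map1 oppr0 rmorph0 mulr0 /cexp /= expR0 cos0 sin0 mulr1 mulr0 mulr1 -exprMn -rmorphM /=.
by rewrite divff ?rmorph1 ?expr1n ?scale1r //; case: (sign_of_pm R tau.1) => ->; rewrite ?oppr_eq0 oner_eq0.
Qed.

Lemma res_translate x (f f' : PG) : G0 x -> ps_fun f' = translate x f ->
  ps_fun (Res f') = translate x (Res f).
Proof.
move=> Gx ff'; apply/funext => g; rewrite /translate.
have [Gg|Gg] := pselect (G0 g).
  by rewrite !ResE ?ff' //; exact/(sub_invl _ sG0 Gx).
by rewrite !ps_out //; apply: contra_not Gg => /(sub_invl _ sG0 Gx).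
Qed.

Lemma ext_translate x (f f' : PG0) : G0 x -> ps_fun f' = translate x f ->
  ps_fun (Ext f') = translate x (Ext f).
Proof.
move=> Gx ff'; apply/funext => g; rewrite /translate.
have Gx' := component_sub Gx.
have [Gg|Gg] := pselect (G g); last first.
  by rewrite !ps_out //; apply: contra_not Gg => /(sub_invl _ sG Gx').
have Gxg : G (invmx x *m g) by exact/(sub_invl _ sG Gx').
rewrite !ExtE // ff' /translate component_tag_mull ?mulmxA //.
exact: (sub_inv sG0).
Qed.

End ResExt.
End Operators.

(** * Functionals of smooth families of sections *)

Section ComplexExp.
Variable R : realType.
Implicit Types z w : R[i].

Lemma cexpD z w : cexp (z + w) = cexp z * cexp w.
Proof.
case: z w => [a b] [c d]; rewrite /cexp /= expRD cosD sinD.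
apply/eqP; rewrite eq_complex /=; apply/andP; split; apply/eqP; ring.
Qed.

Lemma cexp0 : cexp (0 : R[i]) = 1.
Proof. by rewrite /cexp /= expR0 cos0 sin0 mulr1 mulr0. Qed.

Lemma cexpN z : cexp z * cexp (- z) = 1.
Proof. by rewrite -cexpD subrr cexp0. Qed.

(** Functionals are estimated separately on real and imaginary parts. *)
Definition part (c : bool) (z : R[i]) : R := if c then complex.Re z else complex.Im z.

Lemma partB c z w : part c (z - w) = part c z - part c w.
Proof. by case: c; case: z w => [a b] [a' b']. Qed.

Lemma partZ c (r : R) z : part c (r%:C * z) = r * part c z.
Proof. by case: c; case: z => [a b] /=; rewrite ?mul0r ?subr0 ?addr0 ?add0r. Qed.

Lemma part_eq0 z : (forall c, part c z = 0) -> z = 0.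
Proof. by case: z => [a b] h; have /= -> := h true; have /= -> := h false. Qed.

End ComplexExp.

Section FamilyTaylor.
Variables (R : realType) (n : nat).
Local Notation M := 'M[R]_n.+2.
Variables (H : set M) (m : nat) (r : 'M[R]_n -> 'M[R]_m) (i : nat) (lam : R[i]) (alpha : 'Z_2).
Hypothesis HM : forall g h, H g -> H h -> H (g *m h).
Local Notation I := (principal_series H r i lam alpha).
Implicit Types (u v : I).

Let lieT (Xs : seq M) g k c u : R := lie_deriv Xs (real_coord (ps_fun u) k c) g.

Let lieT_lin Xs g k c (a : R) u v : (forall X, X \in Xs -> lie H X) -> H g ->
  lieT Xs g k c (a%:C *: u + v) = a * lieT Xs g k c u + lieT Xs g k c v.
Proof.
move=> lX Hg; rewrite /lieT.
have su (w : I) : smooth_family H (fun=> real_coord (ps_fun w) k c).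
  by apply: smooth_group_family; case: w => f /=; rewrite inE => -[_ s _]; exact: s.
have := lie_deriv_lin HM a 1 lX (su u) (su v) Hg; rewrite mul1r => <-.
congr (lie_deriv _ _ _); rewrite -[ps_fun _]/(a%:C *: ps_fun u + ps_fun v) real_coord_lin /=.
apply/funext => h; case: (c); rewrite ?oppr0 scale0r addr0 scale1r mul1r //.
Qed.

Let lieT0 Xs g k c : (forall X, X \in Xs -> lie H X) -> H g -> lieT Xs g k c 0 = 0.
Proof.
move=> lX Hg; have := lieT_lin k c (-1) 0 0 lX Hg.
by rewrite scaler0 addr0 mulN1r addNr.
Qed.

Let lieT_Z Xs g k c (a : R) u : (forall X, X \in Xs -> lie H X) -> H g ->
  lieT Xs g k c (a%:C *: u) = a * lieT Xs g k c u.
Proof.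
move=> lX Hg; have := lieT_lin k c a u 0 lX Hg.
by rewrite addr0 lieT0 // addr0.
Qed.

Let lieT_B Xs g k c u v : (forall X, X \in Xs -> lie H X) -> H g ->
  lieT Xs g k c (u - v) = lieT Xs g k c u - lieT Xs g k c v.
Proof.
move=> lX Hg; have := lieT_lin k c (-1) v u lX Hg.
by rewrite rmorphN rmorph1 scaleN1r mulN1r addrC => ->; rewrite addrC.
Qed.

(** Difference operators commute with the derivatives that define the topology and
    annihilate the Taylor polynomial in s, uniformly on compact sets; so
    iter_diff applied to the family, divided by the remainder, stays in a fixed
    neighbourhood of 0, where L is bounded. The family Fs is given for nonzero s
    only, but Phi extends its coordinates smoothly through s = 0. *)
Lemma family_taylor (Fs : R -> I) (Phi : {ffun 'I_i -> 'I_m} -> bool -> R -> M -> R)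
    (L : I -> R) (K : set M) (Xss : seq (seq M)) (d : R) (cs : nat -> R) l :
  (forall k c, smooth_family H (Phi k c)) ->
  (forall k c s g, s != 0 -> H g -> real_coord (ps_fun (Fs s)) k c g = Phi k c s g) ->
  (forall u v, L (u - v) = L u - L v) -> (forall (a : R) u, L (a%:C *: u) = a * L u) ->
  seminorm_index H K Xss -> 0 < d -> (forall u, near0 K Xss d u -> `|L u| < 1) ->
  (forall j, `|cs j| <= 1) -> (forall j, cs j != 0) ->
  exists C, forall s, s != 0 -> `|s| <= 1 -> `|iter_diff *%R cs l (fun s => L (Fs s)) s| <= C * `|s| ^+ l.
Proof.
move=> sP FP LB LZ [cK KH lX] d0 hL cs1 cs0.
pose scI (a : R) (u : I) : I := a%:C *: u.
have bd (t : seq M * {ffun 'I_i -> 'I_m} * bool) : exists C, t.1.1 \in Xss -> forall g s, K g -> s != 0 -> `|s| <= 1 ->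
    `|lieT t.1.1 g t.1.2 t.2 (iter_diff scI cs l Fs s)| <= 2 ^+ l * C * `|s| ^+ l.
  case: t => [[Xs k] c] /=.
  have [XsX|] := boolP (Xs \in Xss); last by exists 0.
  have lXs X : X \in Xs -> lie H X by exact: lX.
  (* The derivatives in the parameter of the derivatives along the group. *)
  pose Psi := fix Psi (j : nat) : R -> M -> R := if j is j'.+1 then
    (fun s g => 'D_1 (fun s => Psi j' s g) s) else (fun s => lie_deriv Xs (Phi k c s)).
  have sPsi j : smooth_family H (Psi j).
    elim: j => [|j IH]; first exact: smooth_family_lie_deriv.
    exact: smooth_family_param.
  have [C hC] := smooth_family_bounded (sPsi l) cK KH.
  exists C => _ g s Kg s0 s1; have Hg := KH _ Kg.
  rewrite (@iter_diff_morph R I R scI *%R cs (lieT Xs g k c)); last 2 first.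
  - by move=> u v; exact: lieT_B.
  - by move=> a u; exact: lieT_Z.
  rewrite (@iter_diff_ext R R *%R cs l [set s | s != 0] _ (fun s => Psi 0%N s g)) //; last 2 first.
  - by move=> j t _ t0 /=; rewrite mulf_neq0.
  - move=> t t0; rewrite /lieT /=; apply: (lie_deriv_ext HM lXs) => // h Hh.
    exact: FP.
  apply: (@iter_diff_taylor R l (fun j s => Psi j s g)) => //.
  - move=> j t; apply: DeriveDef; last by [].
    exact: derivable_family_param.
  - by move=> t t1; exact: hC.
have [Cf hCf] := choice bd.
pose C0 := 1 + \sum_(Xs <- Xss) \sum_k \sum_c `|Cf (Xs, k, c)|.
have S0 : 0 <= \sum_(Xs <- Xss) \sum_k \sum_c `|Cf (Xs, k, c)|.
  by do 3! (apply: sumr_ge0 => ? _).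
have C0pos : 0 < C0 by rewrite ltr_pwDl.
have leC Xs k c : Xs \in Xss -> Cf (Xs, k, c) < C0.
  move=> XsX; apply: le_lt_trans (ler_norm _) _.
  rewrite /C0 (big_rem Xs XsX) /= (bigD1 k) //= (bigD1 c) //=.
  rewrite -!addrA [ltRHS]addrC -!addrA ltrDl.
  apply: ltr_wpDl; first by apply: sumr_ge0.
  apply: ltr_wpDl; first by do 2! (apply: sumr_ge0 => ? _).
  by apply: ltr_wpDl => //; do 3! (apply: sumr_ge0 => ? _).
exists (2 ^+ l * C0 / d) => s s0 s1.
rewrite -(@iter_diff_morph R I R scI *%R cs L l Fs LB LZ).
set u := iter_diff scI cs l Fs s.
have sl : 0 < `|s| ^+ l by rewrite exprn_gt0 // normr_gt0.
set e := 2 ^+ l * C0 * `|s| ^+ l.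
have e0 : 0 < e by rewrite !mulr_gt0 // exprn_gt0.
have : near0 K Xss d (scI (d / e) u).
  move=> g Xs k c Kg XsX; have Hg := KH _ Kg.
  have lXs X : X \in Xs -> lie H X by exact: lX.
  rewrite -/(lieT _ _ _ _ _) lieT_Z // normrM gtr0_norm ?divr_gt0 //.
  rewrite mulrAC ltr_pdivrMr // ltr_pM2l //.
  apply: le_lt_trans (hCf (Xs, k, c) XsX g s Kg s0 s1) _.
  by rewrite /e ltr_pM2r // ltr_pM2l ?exprn_gt0 //; exact: leC.
move=> /hL; rewrite LZ normrM gtr0_norm ?divr_gt0 // => h.
have -> : 2 ^+ l * C0 / d * `|s| ^+ l = e / d by rewrite /e mulrAC.
rewrite ler_pdivlMr //; apply: ltW; move: h.
by rewrite mulrAC ltr_pdivrMr // mul1r mulrC.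
Qed.

End FamilyTaylor.

(** * Dilations of the big cell *)

Section SmoothMatrices.
Variables (R : realType) (V : normedModType R) (U : set V).
Hypothesis oU : open U.

Definition smooth_mx m k (A : V -> 'M[R]_(m, k)) := forall p q, smooth U (fun x => A x p q).

Lemma smooth_mx_cst m k (A : 'M[R]_(m, k)) : smooth_mx (fun=> A).
Proof. by move=> p q; exact: smooth_cst. Qed.

Lemma smooth_mx_add m k (A B : V -> 'M[R]_(m, k)) :
  smooth_mx A -> smooth_mx B -> smooth_mx (fun x => A x + B x).
Proof. by move=> sA sB p q; under eq_fun do rewrite mxE; exact: smooth_add. Qed.

Lemma smooth_mx_scale m k (c : V -> R) (A : V -> 'M[R]_(m, k)) :
  smooth U c -> smooth_mx A -> smooth_mx (fun x => c x *: A x).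
Proof. by move=> sc sA p q; under eq_fun do rewrite mxE; exact: smooth_mul. Qed.

Lemma smooth_mx_opp m k (A : V -> 'M[R]_(m, k)) : smooth_mx A -> smooth_mx (fun x => - A x).
Proof.
move=> sA; under eq_fun do rewrite -scaleN1r.
by apply: smooth_mx_scale => //; exact: smooth_cst.
Qed.

Lemma smooth_mx_mul m k l (A : V -> 'M[R]_(m, k)) (B : V -> 'M[R]_(k, l)) :
  smooth_mx A -> smooth_mx B -> smooth_mx (fun x => A x *m B x).
Proof.
move=> sA sB p q; under eq_fun do rewrite mxE.
by apply: smooth_sum => // j; exact: smooth_mul.
Qed.

Lemma smooth_mx_tr m k (A : V -> 'M[R]_(m, k)) : smooth_mx A -> smooth_mx (fun x => (A x)^T).
Proof. by move=> sA p q; under eq_fun do rewrite mxE; exact: sA. Qed.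

Lemma open_smooth_preimage m k (A : V -> 'M[R]_(m, k)) (W : set 'M[R]_(m, k)) :
  smooth_mx A -> open W -> open [set x | U x /\ W (A x)].
Proof.
move=> sA oW; rewrite openE => x [Ux Wx].
have cA : A y @[y --> x] --> A x.
  apply: (@cvg_mx R _ (nbhs x) _) => p q.
  by apply: differentiable_continuous; exact: smooth_diff (sA p q) Ux.
apply: filterI; first exact: open_nbhs_nbhs.
by apply: cA; exact: open_nbhs_nbhs.
Qed.

End SmoothMatrices.

Section Contraction.
Variables (R : realType) (n : nat).
Local Notation M := 'M[R]_n.+3.
Local Notation RM := (R * M)%type.
Local Notation xi := (xi R n.+1).
Local Notation eta := (eta R n.+1).
Local Notation io := (iota_mx R n.+1).
Local Notation J := (J R n.+1).
Local Notation boost := (boost n.+1).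
Local Notation H := (lorentz n.+1 : set M).
Implicit Types (g h X : M) (s t : R).

(** The function whose zeros are the complement of the big cell N_- P. *)
Definition cell g : R := (xi^T *m (g *m xi)) ord0 ord0.
(** The parameter v with g in nm v * P. *)
Definition cell_pt g : 'cV[R]_n.+1 := - (cell g)^-1 *: (io^T *m (g *m xi)).

(** Dilation by s in the chart v |-> nm v * P of the big cell. It is defined for
    s = 0 as well, where it contracts the cell to its origin. *)
Definition dilate s g : M := nm ((s - 1) *: cell_pt g) *m g.

Lemma nmE v : nm v = 1%:M + eta *m v^T *m io^T - io *m v *m xi^T
  - 2^-1 *: (eta *m (v^T *m v) *m xi^T) :> M.
Proof.
rewrite nm_def npE !mulmxBr !mulmxBl mulmxDr mulmxDl mulmx1 JJ -scalemxAr -scalemxAl.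
by rewrite !mulmxA J_xi J_io -!mulmxA ioJ etaJ.
Qed.

Lemma smooth_nm (V : normedModType R) (U : set V) (v : V -> 'cV[R]_n.+1) : open U ->
  smooth_mx U v -> smooth_mx U (fun x => nm (v x) : M).
Proof.
move=> oU sv; under eq_fun do rewrite nmE.
have c m k (A : 'M[R]_(m, k)) := @smooth_mx_cst R V U m k A.
have svT := smooth_mx_tr sv.
apply: smooth_mx_add => //; last first.
  apply: smooth_mx_opp => //; apply: smooth_mx_scale => //; first exact: smooth_cst.
  by do 3? [apply: smooth_mx_mul => //].
apply: smooth_mx_add => //; last first.
  by apply: smooth_mx_opp => //; do 2? [apply: smooth_mx_mul => //].
apply: smooth_mx_add => //.
by do 2? [apply: smooth_mx_mul => //].
Qed.

Lemma continuous_cell : continuous cell.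
Proof.
apply: continuous_coord; apply: continuous_mulmx => [x|]; first exact: cst_continuous.
by apply: continuous_mulmx => x; [exact: cvg_id|exact: cst_continuous].
Qed.

Let U1 : set RM := [set x | cell x.2 != 0 /\ height x.2 != 0].

Let oU1 : open U1.
Proof.
have o1 (f : M -> R) : continuous f -> open [set x : RM | f x.2 != 0].
  move=> cf; have -> : [set x : RM | f x.2 != 0] = [set x : RM | f x.2 < 0] `|` [set x : RM | f x.2 > 0].
    apply/seteqP; split=> x /=; first by case: ltgtP => // h _; [left|right].
    by case=> h; [rewrite lt_eqF|rewrite gt_eqF].
  have cf2 : continuous (fun x : RM => f x.2).
    by move=> x; apply: continuous_comp; [exact: cvg_snd|exact: cf].
  apply: openU.
    by apply: (@open_comp _ _ (fun x : RM => f x.2) [set y | y < 0]); [move=> x _; exact: cf2|exact: open_lt].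
  by apply: (@open_comp _ _ (fun x : RM => f x.2) [set y | 0 < y]); [move=> x _; exact: cf2|exact: open_gt].
by apply: openI; apply: o1; [exact: continuous_cell|exact: continuous_height].
Qed.

Let sxi : smooth_mx U1 (fun x : RM => x.2 *m xi).
Proof.
apply: smooth_mx_mul => //; last exact: smooth_mx_cst.
by move=> p q; exact: (@smooth_snd R n.+1 _ p q).
Qed.

Lemma smooth_dilate : smooth_mx U1 (fun x : RM => dilate x.1 x.2).
Proof.
apply: smooth_mx_mul => //; last by move=> p q; exact: (@smooth_snd R n.+1 _ p q).
apply: (smooth_nm (v := fun x : RM => (x.1 - 1) *: cell_pt x.2)) => //.
apply: smooth_mx_scale => //.
  by apply: smooth_sub_fun => //; [exact: (@smooth_fst R n.+1)|exact: smooth_cst].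
apply: smooth_mx_scale => //.
  under eq_fun do rewrite -mulN1r.
  apply: smooth_mul => //; first exact: smooth_cst.
  apply: smooth_inv => //; first by move=> x [].
  by apply: (smooth_mx_mul (U := U1)) => //; exact: smooth_mx_cst.
by apply: smooth_mx_mul => //; exact: smooth_mx_cst.
Qed.

Lemma dilate_lorentz s g : H g -> H (dilate s g).
Proof. by move=> lg; apply: lorentz_mul => //; exact: lorentz_nm. Qed.

Lemma dilate_cell g : H g -> cell g != 0 -> nm (- cell_pt g) *m g *m xi = (cell g / 2) *: xi.
Proof. by move=> lg c0; rewrite /cell_pt scaleNr opprK; exact: bruhat. Qed.

(** The first coordinate of the point of the sphere: 1 at the origin of the cell
    and -1 at its complement. *)
Definition pole g : R := sphere_pt g ord0 ord0.

Lemma poleE g : pole g = (g *m xi) ord0 ord0 / height g.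
Proof.
rewrite /pole mxE /= xi_basis; congr ((_ *m _) _ _ / _); exact: val_inj.
Qed.

Lemma cell_pole g : height g != 0 -> cell g = height g * (1 + pole g).
Proof.
move=> h0; rewrite poleE mulrDr mulr1 mulrCA divff // mulr1 /cell -xi_basis linearD /=.
by rewrite mulmxDl !trmx_delta -!rowE mxE addrC; congr (_ + _); rewrite mxE // xi_basis.
Qed.

Lemma continuous_pole g : height g != 0 -> continuous_at g pole.
Proof.
move=> h0; have -> : pole = (fun g => (g *m xi) ord0 ord0 / height g) by apply/funext => h; exact: poleE.
have c1 : continuous (fun g : M => (g *m xi) ord0 ord0).
  by apply: continuous_coord; apply: continuous_mulmx => x; [exact: cvg_id|exact: cst_continuous].
exact: (cvgM (c1 g) (cvgV h0 (@continuous_height R n g))).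
Qed.

Variable psi : R -> R.
Hypotheses (spsi : smooth setT psi) (psi0 : forall x, x <= 0 -> psi x = 0).

Lemma smooth_cutoff (V : normedModType R) (U : set V) (e : V -> M) : open U ->
  smooth_mx U e -> (forall x, U x -> height (e x) != 0) -> smooth U (fun x => psi (pole (e x))).
Proof.
move=> oU se Uh.
have sx : smooth_mx U (fun x => e x *m xi) by apply: smooth_mx_mul => //; exact: smooth_mx_cst.
apply: (@smooth_comp_real R _ U setT (fun x => pole (e x))) => //.
under eq_fun do rewrite poleE.
apply: (smooth_mul (F := fun x => (e x *m xi) ord0 ord0) (G := fun x => (height (e x))^-1)) => //.
by apply: (smooth_inv (F := fun x => height (e x))) => //; exact: (sx ord_max ord0).
Qed.

Section Sections.
Variables (i : nat) (lam : R[i]) (alpha : 'Z_2).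
Local Notation I := (principal_series H id i lam alpha).
Implicit Types f : I.

(** The cutoff vanishes near the complement of the cell, where the dilation is
    singular; the product is therefore smooth in s and g on all of the group. *)
Definition contraction f k c s g : R := psi (pole g) * real_coord (ps_fun f) k c (dilate s g).

Lemma smooth_contraction f k c : smooth_family H (contraction f k c).
Proof.
move=> s g lg; have h0 := height_neq0 lg.
have [_ sf _] : is_section H id lam alpha (ps_fun f) by case: (f) => u /=; rewrite inE.
have [c0|c0] := eqVneq (cell g) 0.
  have p1 : pole g = -1.
    by move/eqP: c0; rewrite cell_pole // mulf_eq0 (negbTE h0) /= addrC addr_eq0 => /eqP.
  exists [set x : RM | height x.2 != 0 /\ pole x.2 < 0], (fun=> 0); split.
  - rewrite openE => x [hx px].
    have hn : \near x, height x.2 != 0.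
      have : {for x, continuous (fun x : RM => height x.2)}.
        by apply: continuous_comp; [exact: cvg_snd|exact: continuous_height].
      by move=> /(_ [set y | y != 0]); apply; apply: open_nbhs_nbhs; split=> //; exact: open_neq.
    have pn : \near x, pole x.2 < 0.
      have : {for x, continuous (fun x : RM => pole x.2)}.
        by apply: continuous_comp; [exact: cvg_snd|exact: continuous_pole].
      by move=> /(_ [set y | y < 0]); apply; apply: open_nbhs_nbhs; split=> //; exact: open_lt.
    by apply: filterS2 hn pn.
  - by split=> //=; rewrite p1 ltrN10.
  - exact: smooth_cst.
  - by move=> x [_ px] _; rewrite /contraction psi0 ?mul0r // ltW.
have [U [F [oU Ug sF FE]]] := sf k c _ (dilate_lorentz s lg).
exists [set x : RM | U1 x /\ U (dilate x.1 x.2)],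
  (fun x : RM => psi (pole x.2) * F (dilate x.1 x.2)).
have oW := open_smooth_preimage oU1 smooth_dilate oU.
split=> //.
- apply: smooth_mul => //; first (apply: (smooth_cutoff (e := fun x : RM => x.2)) => //;
    [by move=> p q; exact: (@smooth_snd R n.+1 _ p q)|by move=> x [[]]]).
  apply: (@smooth_comp_mx R _ _ _ _ U (fun x : RM => dilate x.1 x.2)) => //.
    by move=> x [].
  by move=> p q; apply: smooth_sub (smooth_dilate p q) => x [].
- move=> x [_ Ux] lx; rewrite /contraction FE //; exact: dilate_lorentz.
Qed.

(** In N_- P, multiplication on the left by the inverse of m a, for m a in M A,
    conjugates the N_- part, which is the dilation, and multiplies the P part by
    an element of M A, which acts on the fibre by a scalar. *)
Lemma dilate_translate f b t g : b = 1 \/ b = -1 -> H g -> cell g != 0 ->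
  ps_fun f (dilate (b * expR t) g) =
  (b%:C ^+ alpha * cexp (- (lam * t%:C))) *: ps_fun f (invmx (diag3 b 1%:M *m boost t) *m g).
Proof.
move=> hb lg c0; have b2 := pm_sqr hb; have bb : b * b = 1 by rewrite -expr2.
have [_ _ ef] : is_section H id lam alpha (ps_fun f) by case: (f) => u /=; rewrite inE.
have [y yE] : exists y, y = cell_pt g by eexists.
have dc := dilate_cell lg c0; rewrite -yE in dc.
have lp : H (nm (- y) *m g) by apply: lorentz_mul => //; exact: lorentz_nm.
have [b0 [B [t0 [v [hb0 BB dE pE]]]]] := lorentz_parabolic lp dc.
have nX := n_plus_Xp v.
have gE : g = nm y *m man b0 B t0 (Xp v).
  by rewrite man_np -pE mulmxA -nm_add subrr nm_0 mul1mx.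
have VE : invmx (diag3 b 1%:M *m boost t) = boost (- t) *m diag3 b 1%:M.
  apply: invmx_eq; rewrite !mulmxA -(mulmxA (diag3 b 1%:M)) -boost_add subrr boost_0 mulmx1.
  by rewrite diag3_mul mulmx1 bb diag3_1.
pose z := (b * expR t) *: y.
have P2 : boost (- t) *m (diag3 b 1%:M *m man b0 B t0 (Xp v)) = man (b * b0) B (- t + t0) (Xp v).
  by rewrite man_conjl mul1mx man_boostl.
have [p pdef] : exists p, p = man b0 B t0 (Xp v) by eexists.
rewrite -pdef in P2 gE.
have E1 : dilate (b * expR t) g = nm z *m p.
  have nA v' w' : nm v' *m (nm w' *m p) = nm (v' + w') *m p by rewrite mulmxA -nm_add.
  rewrite /dilate -yE [in LHS]gE nA; congr (nm _ *m _).
  by rewrite scalerBl scale1r subrK.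
have E2 : boost (- t) *m diag3 b 1%:M *m g = nm z *m man (b * b0) B (- t + t0) (Xp v).
  rewrite -P2 gE; move: (diag3 b 1%:M) (@diag3_nm R n.+1 b y b2) => D DE.
  rewrite mulmxA -(mulmxA _ D) DE mulmxA boost_nm scalerA (mulrC (expR t)) -/z.
  by rewrite !mulmxA.
have hbb0 := pm_mul hb hb0.
have lz : H (nm z) by exact: lorentz_nm.
rewrite VE E1 E2 pdef.
have -> := ef (nm z) b0 B t0 (Xp v) lz hb0 BB nX (man_lorentz t0 hb0 BB nX).
have -> := ef (nm z) (b * b0) B (- t + t0) (Xp v) lz hbb0 BB nX (man_lorentz (- t + t0) hbb0 BB nX).
rewrite /sigma scalerA; congr (_ *: _).
have -> : lam * (- (- t + t0))%:C = lam * t%:C + lam * (- t0)%:C.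
  by rewrite opprD opprK rmorphD mulrDr.
rewrite cexpD.
have bV : (b%:C ^+ alpha * ((b * b0)^-1)%:C ^+ alpha) = (b0^-1)%:C ^+ alpha :> R[i].
  rewrite -exprMn -rmorphM; congr (_%:C ^+ _).
  by rewrite invfM mulrA divff ?mul1r //; case: hb => ->; rewrite ?oppr_eq0 oner_eq0.
have cV := cexpN (lam * t%:C).
rewrite -bV; move: cV; set e1 := cexp (lam * t%:C); set e2 := cexp (- _); set e3 := cexp _.
move=> e12; transitivity ((b%:C ^+ alpha * ((b * b0)^-1)%:C ^+ alpha) * e3 * (e1 * e2)).
  by rewrite e12 mulr1.
by ring.
Qed.

Definition cut (f : M -> extpow R n.+1 i) g := (psi (pole g))%:C *: f g.

Lemma real_coord_cut (f : M -> extpow R n.+1 i) k c g :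
  real_coord (cut f) k c g = psi (pole g) * real_coord f k c g.
Proof.
rewrite /real_coord; case: c; rewrite extpow_scale.
  exact: (partZ true).
exact: (partZ false).
Qed.

(** The cutoff is a function on the sphere, so equivariance under P is kept. *)
Lemma cut_section f : cut (ps_fun f) \in @sections R n.+1 H n.+1 id i lam alpha.
Proof.
have [f0 sf ef] : is_section H id lam alpha (ps_fun f) by case: (f) => u /=; rewrite inE.
rewrite inE; split.
- by move=> g Hg; rewrite /cut f0 // scaler0.
- move=> k c g lg; have [U [F [oU Ug sF FE]]] := sf k c g lg.
  have oh : open [set h : M | height h != 0].
    rewrite openE => h h0; have := @continuous_height R n h.
    by move=> /(_ [set y | y != 0]); apply; apply: open_nbhs_nbhs; split=> //; exact: open_neq.
  exists (U `&` [set h | height h != 0]), (fun h => psi (pole h) * F h); split.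
  - exact: openI.
  - by split=> //; exact: height_neq0.
  - apply: (@smooth_mul R M); first exact: openI.
      apply: (smooth_cutoff (e := fun h : M => h)); first exact: openI.
        by move=> p q; exact: (@smooth_coord R n.+1).
      by move=> h [].
    by apply: (@smooth_sub R M) sF => h [].
  - by move=> h [Uh _] lh; rewrite FE // real_coord_cut.
- move=> g b B t X lg hb BB nX p Hp; rewrite /cut ef //.
  have -> : pole (g *m p) = pole g.
    rewrite /pole (_ : sphere_pt (g *m p) = sphere_pt g) //; apply: (@sphere_pt_mul R n g _ (b * expR t)).
      by rewrite mulf_neq0 ?(gt_eqF (expR_gt0 _)) //; case: hb => ->; rewrite ?oppr_eq0 ?oner_eq0.
    exact: man_xi.
  by rewrite /sigma extpow_mapZ !scalerA mulrC.
Qed.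

Definition cut_ps f : I := PrincipalSeries (cut_section f).

End Sections.
End Contraction.

(** * Homogeneity and the natural number nu - lambda *)

Section Decay.
Variable R : realType.

Lemma expR_decay (w C x : R) : 0 < x -> (forall y, 0 <= y -> `|w| <= C * expR (- (x * y))) -> w = 0.
Proof.
move=> x0 h; apply/eqP/negPn/negP => w0.
have wp : 0 < `|w| by rewrite normr_gt0.
have C0 : 0 <= C by have := h 0 (lexx _); rewrite mulr0 oppr0 expR0 mulr1; apply: le_trans.
have y0 : 0 <= C / (x * `|w|) by rewrite divr_ge0 // mulr_ge0 // ltW.
have := h _ y0; rewrite expRN.
have -> : x * (C / (x * `|w|)) = C / `|w| by field; rewrite !gt_eqF.
have e0 := expR_gt0 (C / `|w|).
rewrite ler_pdivlMr // leNgt => /negP; apply.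
apply: (@lt_le_trans _ _ (`|w| * (1 + C / `|w|))).
  by rewrite mulrDr mulr1 mulrCA divff ?gt_eqF // mulr1 ltrDr.
by rewrite ler_pM2l //; exact: expR_ge1Dx.
Qed.

(** A quantity of order s ^ c cannot be O (s ^ m) for m greater than Re c. *)
Lemma cexp_decay (c W : R[i]) (C : R) m : complex.Re c < m%:R ->
  (forall s p, 0 < s -> s <= 1 -> `|part p (cexp (c * (ln s)%:C) * W)| <= C * s ^+ m) -> W = 0.
Proof.
move=> cm h; apply: part_eq0 => p.
apply: (@expR_decay _ (2 * C) (m%:R - complex.Re c)); first by rewrite subr_gt0.
move=> y y0; set s := expR (- y).
have s0 : 0 < s by exact: expR_gt0.
have s1 : s <= 1 by rewrite -expR0 ler_expR oppr_le0.
have ls : ln s = - y by rewrite expRK.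
have sm : s ^+ m = expR (- (m%:R * y)) by rewrite -expRM_natl mulrN.
have b1 := h s true s0 s1; have b2 := h s false s0 s1.
have WE : W = cexp (- (c * (ln s)%:C)) * (cexp (c * (ln s)%:C) * W).
  by rewrite mulrA [cexp (- _) * _]mulrC cexpN mul1r.
have bd (z w : R[i]) : `|part p (cexp z * w)| <= expR (complex.Re z) * (`|part true w| + `|part false w|).
  case: z w => [a b] [a' b'].
  have eb := expR_gt0 a.
  have cb : `|cos b| <= 1 by rewrite ler_norml cos_geN1 cos_le1.
  have sb : `|sin b| <= 1 by rewrite ler_norml sin_geN1 sin_le1.
  rewrite /cexp /=; case: p => /=.
    have -> : expR a * cos b * a' - expR a * sin b * b' = expR a * (cos b * a' - sin b * b') by ring.
    rewrite normrM gtr0_norm // ler_pM2l //; apply: le_trans (ler_normB _ _) _.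
    by rewrite !normrM; apply: lerD; rewrite ler_piMl.
  have -> : expR a * cos b * b' + expR a * sin b * a' = expR a * (sin b * a' + cos b * b') by ring.
  rewrite normrM gtr0_norm // ler_pM2l //; apply: le_trans (ler_normD _ _) _.
  by rewrite !normrM; apply: lerD; rewrite ler_piMl.
rewrite {1}WE; apply: le_trans (bd _ _) _.
have -> : complex.Re (- (c * (ln s)%:C)) = complex.Re c * y.
  by rewrite ls; case: (c) => u v /=; ring.
have -> : 2 * C * expR (- ((m%:R - complex.Re c) * y)) = expR (complex.Re c * y) * (C * s ^+ m + C * s ^+ m).
  rewrite sm (_ : - ((m%:R - complex.Re c) * y) = complex.Re c * y + - (m%:R * y)); last by ring.
  by rewrite expRD; ring.
by rewrite ler_pM2l ?expR_gt0 //; exact: lerD.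
Qed.

(** The modulus of q ^ c determines Re c for every q < 1, and a suitable q detects
    whether c is real. *)
Lemma cexp_nat_test (c : R[i]) : exists q : R, [/\ 0 < q, q < 1 &
  forall j : nat, cexp (c * (ln q)%:C) = (q ^+ j)%:C -> c = j%:R].
Proof.
case: c => a b; have [b0|b0] := eqVneq b 0.
  exists 2^-1; split=> //; first by rewrite invf_lt1 // ltr1n.
  move=> j; rewrite b0 /cexp /= !mulr0 !mul0r subr0 addr0 sin0 cos0 mulr1 mulr0.
  case=> /(congr1 (@ln R)); rewrite expRK lnXn // -[RHS]mulr_natl.
  have l2 : ln 2^-1 != 0 :> R.
    by rewrite lnV ?posrE // oppr_eq0 gt_eqF // ln_gt0 // ltr1n.
  by move=> /(mulIf l2) ->; rewrite -[RHS](rmorph_nat (real_complex R)).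
(* With this q the phase of q ^ c is -1, so that q ^ c is a negative real. *)
exists (expR (- (pi / `|b|))).
have bp : 0 < `|b| by rewrite normr_gt0.
split; first exact: expR_gt0.
  by rewrite -expR0 ltr_expR oppr_lt0 divr_gt0 // pi_gt0.
move=> j; rewrite expRK /cexp /=.
have -> : cos (a * 0 + b * - (pi / `|b|)) = -1.
  rewrite mulr0 add0r; case: (ltgtP b 0) b0 => // hb _.
    rewrite ltr0_norm // (_ : b * _ = pi) ?cospi //.
    by field; rewrite lt_eqF.
  rewrite gtr0_norm // (_ : b * _ = - pi) ?cosN ?cospi //.
  by field; rewrite gt_eqF.
case=> e _; have := expR_gt0 (a * - (pi / `|b|) - b * 0).
have : 0 < expR (- (pi / `|b|)) ^+ j by rewrite exprn_gt0 // expR_gt0.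
by rewrite -e mulrN1 oppr_gt0 => h /(lt_trans h); rewrite ltxx.
Qed.

End Decay.

Section Key.
Variables (R : realType) (n : nat).
Local Notation M := 'M[R]_n.+4.
Local Notation H := (@lorentz R n.+2).
Local Notation H' := (@lorentz_stab R n.+2).
Local Notation H0' := (@lorentz_stab0 R n.+2).
Local Notation boost := (boost n.+2).
Local Notation last_set := (finset.set1 (ord_max : 'I_n.+2)).
Implicit Types (x g : M).

Let GE := lorentz_fixing R n.+1.
Let GE' := lorentz_stab_fixing R n.+1.

Lemma ord0_set0 : ord0 \notin (finset.set0 : {set 'I_n.+2}).
Proof. by rewrite finset.in_set0. Qed.
Lemma ord0_last : ord0 \notin last_set.
Proof. by rewrite finset.in_set1. Qed.

Let sH := subgroup_G GE.
Let sH' := subgroup_G GE'.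
Let sH0' := subgroup_G0 GE'.

Lemma stab_lorentz : H' `<=` H. Proof. by move=> g []. Qed.
Lemma stab0_stab : H0' `<=` H'. Proof. exact: component_sub. Qed.

Lemma stab0_boost t : H0' (boost t).
Proof. by rewrite /lorentz_stab0 GE'; exact: fixing0_boost. Qed.

Lemma stab_diag3 b : b = 1 \/ b = -1 -> H' (diag3 b 1%:M).
Proof.
move=> hb; rewrite GE'; apply: fixing_diag3; first exact: pm_sqr.
by split=> [|q _]; rewrite ?trmx1 ?mulmx1 // mul1mx.
Qed.

Variables (i j : nat) (lam nu : R[i]) (alpha beta : 'Z_2).
Local Notation I := (I_ n.+2 i lam alpha).
Local Notation J := (J_ n.+2 j nu beta).
Variable T : I -> J.
Hypothesis dT : diff_ops H0' T.

Let linT : linear T. Proof. by case: dT => [[]]. Qed.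
Let eqT : equivariant H0' T. Proof. by case: dT => [[]]. Qed.
Let conT : continuous_op T. Proof. by case: dT => [[]]. Qed.
Let locT f : supp (T f) `<=` supp f. Proof. by case: dT => _; apply. Qed.

Lemma translate_in (f : I) x : H x -> exists f' : I, ps_fun f' = translate x f.
Proof.
move=> Hx; have [S [SE _ _]] := @translate_exists R n.+1 _ _ id _ GE H i lam alpha x sH Hx.
by exists (S f).
Qed.

Lemma translateM m d (f : M -> extpow R m d) x y : H x -> H y ->
  translate (x *m y) f = translate x (translate y f).
Proof.
move=> Hx Hy; apply/funext => g; rewrite /translate invmx_mul ?mulmxA //.
  by have [] := lorentz_invE Hx.
by have [] := lorentz_invE Hy.
Qed.

Let secJ (f : J) : is_section H' (@lead R n.+2) nu beta (ps_fun f).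
Proof. by case: f => u /=; rewrite inE. Qed.

Let invlead1 : invmx (@lead R n.+2 1%:M) = 1%:M.
Proof. by rewrite lead_1 invmx1. Qed.

Lemma sectionJ_ma (f : J) g b t : H' g -> b = 1 \/ b = -1 ->
  f (g *m (diag3 b 1%:M *m boost t)) = (b%:C ^+ beta * cexp (- (nu * t%:C))) *: f g.
Proof.
move=> Hg hb; have [_ _ ef] := secJ f.
have := ef g b 1%:M t 0 Hg hb; rewrite trmx1 mulmx1 => /(_ erefl (n_plus_0 R n.+1)) /=.
rewrite expm0 mulmx1 expm_H0 => ->; last first.
  by apply: (sub_mul sH'); [exact: stab_diag3|apply: stab0_stab; exact: stab0_boost].
have bV : b^-1 = b by case: hb => ->; rewrite ?invr1 // invrN1.
by rewrite /sigma invlead1 extpow_map1 rmorphN mulrN bV.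
Qed.

Lemma sectionJ_sign (u : J) h tau : H' h -> u (h *m tag_rep R n.+1 tau) =
  sigma nu beta (sign_of R tau.1)^-1 (invmx (lead (sign_mx n.+1 (sign_of R tau.2)))) (- 0) (u h).
Proof.
move=> Hh; have [_ _ ef] := secJ u.
have pE : diag3 (sign_of R tau.1) (sign_mx n.+1 (sign_of R tau.2)) *m expm (0 *: H0 R n.+2) *m expm 0 =
    tag_rep R n.+1 tau.
  by rewrite scale0r !expm0 !mulmx1.
have := ef h (sign_of R tau.1) (sign_mx n.+1 (sign_of R tau.2)) 0 0
    Hh (sign_of_pm R _) (fixing_mx_sign R ord0_last _).1 (n_plus_0 R n.+1).
cbv zeta; rewrite pE; apply; exact: (tag_rep_group ord0_last GE').
Qed.

Section Functional.
Variable k0 : {ffun 'I_j -> 'I_n.+1}.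

(** A differential operator is determined, up to translations, by the functionals
    that evaluate at the base point. *)
Definition value_at_1 (f : I) : R[i] := extpow_val (T f 1%:M) k0.
Local Notation L := value_at_1.

Lemma value_lin a f f' : L (a *: f + f') = a * L f + L f'.
Proof. by rewrite /L linT ps_lin extpow_lin. Qed.

Lemma value0 : L 0 = 0.
Proof. by have := value_lin (-1) 0 0; rewrite scaler0 addr0 mulN1r addNr. Qed.

Lemma valueZ a f : L (a *: f) = a * L f.
Proof. by have := value_lin a f 0; rewrite addr0 value0 addr0. Qed.

Lemma valueB f f' : L (f - f') = L f - L f'.
Proof. by have := value_lin (-1) f' f; rewrite scaleN1r mulN1r addrC => ->; rewrite addrC. Qed.

(** Evaluation at the base point is bounded by the seminorm without derivatives
    on a single point. *)
Lemma value_continuous c : exists K Xss d, [/\ seminorm_index H K Xss, 0 < d &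
  forall f : I, near0 K Xss d f -> `|part c (L f)| < 1].
Proof.
have s1 : seminorm_index H' [set (1%:M : M)] [:: [::]].
  split; first exact: compact_set1.
    by move=> _ ->; exact: (sub_1 sH').
  by move=> Xs X; rewrite inE => /eqP ->.
have [K [Xss [d [sK d0 h]]]] := conT s1 ltr01.
exists K, Xss, d; split=> // f /h /(_ 1%:M [::] k0 c erefl); rewrite inE => /(_ erefl) /=.
by rewrite /real_coord /part; case: (c).
Qed.

(** A acts on the fibre at its fixed point, the base point, by a character. *)
Lemma value_boost (f f' : I) t : ps_fun f' = translate (boost t) f ->
  L f' = cexp (nu * t%:C) * L f.
Proof.
move=> ff'; rewrite /L (eqT (stab0_boost t) ff') /translate mulmx1.
have VE : invmx (boost t) = 1%:M *m (diag3 1 1%:M *m boost (- t)).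
  by rewrite mul1mx diag3_1 mul1mx; apply: invmx_eq; rewrite -boost_add subrr boost_0.
rewrite VE sectionJ_ma; [|exact: (sub_1 sH')|by left].
by rewrite extpow_scale expr1n mul1r rmorphN mulrN opprK.
Qed.

Variables (psi : R -> R).
Hypotheses (spsi : smooth setT psi) (psi0 : forall x : R, x <= 0 -> psi x = 0)
  (psi1 : forall x : R, 2^-1 <= x -> psi x = 1).

Lemma pole_1 : pole (1%:M : M) = 1.
Proof.
rewrite poleE height_1 divr1 mul1mx -xi_basis.
by rewrite /basis_vec !mxE !eqxx /= addr0.
Qed.

(** By locality only the values near the base point matter. *)
Lemma value_cut f : L (cut_ps spsi f) = L f.
Proof.
apply/eqP; rewrite -subr_eq0 -valueB; apply/eqP.
set u := _ - _; rewrite /L.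
suff -> : T u 1%:M = 0 by rewrite ffunE.
apply: contrapT => Tu.
have : supp (T u) (sphere_pt (1%:M : M)) by apply: subset_closure; exists 1%:M.
move=> /locT.
have cl : closed [set w : 'rV[R]_n.+3 | w ord0 ord0 <= 2^-1].
  apply: (@closed_comp _ _ (fun w : 'rV[R]_n.+3 => w ord0 ord0) [set y | y <= 2^-1]); last exact: closed_le.
  by move=> w _; exact: coord_continuous.
have sub : [set sphere_pt g | g in [set g | u g <> 0]] `<=` [set w : 'rV[R]_n.+3 | w ord0 ord0 <= 2^-1].
  move=> _ [g gu <-] /=; rewrite leNgt; apply/negP => hg; apply: gu.
  rewrite -[LHS]/((psi (pole g))%:C *: ps_fun f g - ps_fun f g).
  by rewrite psi1 ?scale1r ?subrr // ltW.
move=> /(closure_subset sub); rewrite -(closure_id _).1 // => /=.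
rewrite -/(pole _) pole_1; apply/negP; rewrite -ltNge invf_lt1 //.
by rewrite ltr1n.
Qed.

Variables (f fm : I).
Hypothesis fmE : ps_fun fm = translate (diag3 (-1) 1%:M) f.

(* For s <> 0 the family consists of the translates of f by diag (sgn s, 1, sgn s)
   and the boost of parameter ln |s|, normalized and cut off. *)
Let sgb (s : R) : R := if 0 < s then 1 else -1.
Let sgbP s : sgb s = 1 \/ sgb s = -1. Proof. by rewrite /sgb; case: ifP; [left|right]. Qed.
Let xs (s : R) : M := diag3 (sgb s) 1%:M *m boost (ln `|s|).
Let Hxs s : H (xs s).
Proof.
apply: lorentz_mul; last exact: lorentz_boost.
by apply: stab_lorentz; exact: stab_diag3.
Qed.
Let tr_fam : {h : R -> I | forall s, ps_fun (h s) = translate (xs s) f}.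
Proof.
apply: cid; have [h hE] := choice (fun s => translate_in f (Hxs s)).
by exists h.
Qed.
Let coef (s : R) : R[i] := (sgb s)%:C ^+ alpha * cexp (- (lam * (ln `|s|)%:C)).
Let Fs (s : R) : I := cut_ps spsi (coef s *: sval tr_fam s).

Let Fs_contraction k c s g : s != 0 -> H g ->
  real_coord (ps_fun (Fs s)) k c g = contraction psi f k c s g.
Proof.
move=> s0 Hg; rewrite /= real_coord_cut /contraction.
have [c0|c0] := eqVneq (cell g) 0.
  have h0 := height_neq0 Hg.
  have p1 : pole g = -1.
    by move/eqP: c0; rewrite cell_pole // mulf_eq0 (negbTE h0) /= addrC addr_eq0 => /eqP.
  by rewrite p1 psi0 ?mul0r // lerN10.
congr (_ * _); rewrite /real_coord.
have sE : s = sgb s * expR (ln `|s|).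
  rewrite lnK ?posrE ?normr_gt0 // /sgb; case: (ltgtP 0 s) s0 => // h _.
    by rewrite gtr0_norm // mul1r.
  by rewrite ltr0_norm // mulN1r opprK.
have E : ps_fun (coef s *: sval tr_fam s) g = ps_fun f (dilate s g).
  have D := @dilate_translate R n.+1 i lam alpha f (sgb s) (ln `|s|) g (sgbP s) Hg c0.
  rewrite -sE in D; apply: etrans (esym D).
  have e := congr1 (fun F => F g) (svalP tr_fam s).
  exact: (congr1 (fun v => coef s *: v) e).
by case: (c); [exact: (congr1 (fun v => complex.Re (extpow_val v k)) E)|exact: (congr1 (fun v => complex.Im (extpow_val v k)) E)].
Qed.

Let value_pos s : 0 < s -> L (Fs s) = cexp ((nu - lam) * (ln s)%:C) * L f.
Proof.
move=> s0; rewrite value_cut valueZ.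
have xE : xs s = boost (ln s) by rewrite /xs /sgb s0 diag3_1 mul1mx gtr0_norm.
rewrite (@value_boost f _ (ln s)); last by rewrite -xE (svalP tr_fam s).
rewrite /coef /sgb s0 expr1n mul1r gtr0_norm // mulrA -cexpD.
by congr (cexp _ * _); ring.
Qed.

Let value_neg s : 0 < s -> L (Fs (- s)) = cexp ((nu - lam) * (ln s)%:C) * ((-1) ^+ alpha * L fm).
Proof.
move=> s0; rewrite value_cut valueZ.
have sN : sgb (- s) = -1 by rewrite /sgb oppr_gt0 ltNge ltW.
have xE : xs (- s) = boost (ln s) *m diag3 (-1) 1%:M by rewrite /xs sN diag3_boost normrN gtr0_norm.
rewrite (@value_boost fm _ (ln s)); last first.
  rewrite (svalP tr_fam (- s)) xE fmE translateM //; first exact: lorentz_boost.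
  by apply: stab_lorentz; apply: stab_diag3; right.
rewrite /coef sN normrN gtr0_norm // rmorphN rmorph1.
set a := (-1) ^+ alpha; set z := L fm.
have -> : (nu - lam) * (ln s)%:C = - (lam * (ln s)%:C) + nu * (ln s)%:C by ring.
by rewrite cexpD; ring.
Qed.

Let taylor_bound_value (cs : nat -> R) l p :
  (forall j, `|cs j| <= 1) -> (forall j, cs j != 0) ->
  exists C, forall s, 0 < s -> s <= 1 ->
    `|part p (iter_diff (fun (r : R) z => r%:C * z) cs l (fun s => L (Fs s)) s)| <= C * s ^+ l.
Proof.
move=> c1 c0; have [K [Xss [d [sK d0 h]]]] := value_continuous p.
have sP k c := smooth_contraction spsi psi0 f k c.
have LB u v : part p (L (u - v)) = part p (L u) - part p (L v) by rewrite valueB partB.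
have LZ (a : R) u : part p (L (a%:C *: u)) = a * part p (L u) by rewrite valueZ partZ.
have [C hC] := family_taylor (sub_mul sH) l sP Fs_contraction LB LZ sK d0 h c1 c0.
exists C => s s0 s1; have := hC s; rewrite gt_eqF // gtr0_norm // => /(_ isT s1).
by rewrite (@iter_diff_morph R R[i] R _ *%R cs (part p)) //; [exact: partB|exact: partZ].
Qed.

(** L (Fs s) equals s ^ (nu - lam) L f for s > 0. The difference operators with
    factor q multiply it by the product of the q ^ (nu - lam) - q ^ j, and they
    make it O (s ^ m) for m beyond Re (nu - lam); so one of the factors vanishes. *)
Lemma value_nat : L f != 0 -> exists k : nat, nu - lam = k%:R.
Proof.
move=> L0; set c := nu - lam.
pose m := Num.bound `|complex.Re c|.
have cm : complex.Re c < m%:R by apply: le_lt_trans (ler_norm _) _; exact: archi_boundP.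
have [q [q0 q1 qt]] := cexp_nat_test c.
have [c1 c0] : (forall j : nat, `|q| <= 1) /\ (forall j : nat, q != 0).
  by split=> _; [rewrite gtr0_norm // ltW|rewrite gt_eqF].
have [C1 h1] := taylor_bound_value (cs := fun=> q) m true c1 c0.
have [C2 h2] := taylor_bound_value (cs := fun=> q) m false c1 c0.
set kap := cexp (c * (ln q)%:C).
have hq s : 0 < s -> L (Fs (q * s)) = kap * L (Fs s).
  move=> s0; rewrite !value_pos ?mulr_gt0 // lnM ?posrE // rmorphD mulrDr cexpD.
  by rewrite mulrA.
have : (\prod_(j < m) (kap - (q ^+ j)%:C)) * L f = 0.
  apply: (@cexp_decay _ c _ (Num.max C1 C2) m cm) => s p s0 s1.
  have -> : cexp (c * (ln s)%:C) * ((\prod_(j < m) (kap - (q ^+ j)%:C)) * L f) =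
     iter_diff (fun (r : R) z => r%:C * z) (fun=> q) m (fun s => L (Fs s)) s.
    by rewrite (@iter_diff_eigen _ _ q kap m _ q0 (fun _ _ => erefl) hq s s0) value_pos //; ring.
  have sm : 0 <= s ^+ m by rewrite exprn_ge0 // ltW.
  case: p; [apply: le_trans (h1 s s0 s1) _|apply: le_trans (h2 s s0 s1) _];
    by rewrite ler_wpM2r // le_max lexx ?orbT.
move/eqP; rewrite mulf_eq0 (negbTE L0) orbF => /prodf_eq0 [j' _].
by rewrite subr_eq0 => /eqP /qt cj; exists j'.
Qed.

(** For nu - lam = k the function L (Fs s) is a multiple of s ^ k on each half
    line. It is smooth at s = 0, so the two multiples agree up to the sign
    (-1) ^ k. *)
Lemma value_parity k : nu - lam = k%:R -> L fm = (-1) ^+ (alpha + k)%N * L f.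
Proof.
move=> ck.
pose q : R := 2^-1.
have q0 : 0 < q by rewrite invr_gt0.
have q1 : q < 1 by rewrite invf_lt1 // ltr1n.
(* The difference of index k comes first and compares the values at s and - s;
   the result, h below, is a multiple of s ^ k, on which the differences of
   index l < k act by the nonzero scalars q ^ k - q ^ l. *)
pose cs (l : nat) : R := if l == k then -1 else q.
have c1 l : `|cs l| <= 1 by rewrite /cs; case: ifP => _; rewrite ?normrN ?normr1 // gtr0_norm // ltW.
have c0 l : cs l != 0 by rewrite /cs; case: ifP => _; rewrite ?oppr_eq0 ?oner_eq0 // gt_eqF.
have [C1 h1] := taylor_bound_value k.+1 true c1 c0.
have [C2 h2] := taylor_bound_value k.+1 false c1 c0.
set W := (-1) ^+ alpha * L fm - (-1) ^+ k * L f.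
pose kap : R[i] := (q ^+ k)%:C.
have cn (s : R) : 0 < s -> cexp (k%:R * (ln s)%:C) = (s ^+ k)%:C.
  move=> s0; rewrite -(rmorph_nat (real_complex R)) -rmorphM /cexp /= cos0 sin0 mulr1 mulr0.
  by rewrite mulr_natl -lnXn // lnK // posrE exprn_gt0.
pose h s := L (Fs (cs k * s)) - (cs k ^+ k)%:C * L (Fs s).
have hE s : 0 < s -> h s = cexp ((nu - lam) * (ln s)%:C) * W.
  move=> s0; rewrite /h /cs eqxx mulN1r value_neg // value_pos // rmorphXn rmorphN rmorph1 /W.
  by ring.
have hq s : 0 < s -> h (q * s) = kap * h s.
  move=> s0; rewrite !hE ?mulr_gt0 // ck !cn ?mulr_gt0 // exprMn rmorphM.
  by rewrite /kap; ring.
have csq l : (l < k)%N -> cs l = q by rewrite /cs => lk; rewrite ltn_eqF.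
have P0 : \prod_(l < k) (kap - (q ^+ l)%:C) != 0.
  apply/prodf_neq0 => l _; rewrite /kap subr_eq0; apply/eqP => -[] /eqP.
  by rewrite lt_eqF // ltr_iXn2l.
have : (\prod_(l < k) (kap - (q ^+ l)%:C)) * W = 0.
  apply: (@cexp_decay _ (nu - lam) _ (Num.max C1 C2) k.+1).
    by rewrite ck -(rmorph_nat (real_complex R)) /= ltr_nat.
  move=> s p s0 s1.
  have -> : cexp ((nu - lam) * (ln s)%:C) * ((\prod_(l < k) (kap - (q ^+ l)%:C)) * W) =
     iter_diff (fun (r : R) z => r%:C * z) cs k.+1 (fun s => L (Fs s)) s.
    by rewrite [RHS](@iter_diff_eigen _ cs q kap k h q0 csq hq s s0) hE //; ring.
  have sm : 0 <= s ^+ k.+1 by rewrite exprn_ge0 // ltW.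
  case: p; [apply: le_trans (h1 s s0 s1) _|apply: le_trans (h2 s s0 s1) _];
    by rewrite ler_wpM2r // le_max lexx ?orbT.
move/eqP; rewrite mulf_eq0 (negbTE P0) /= subr_eq0 => /eqP E.
have sq : (-1) ^+ alpha * (-1) ^+ alpha = 1 :> R[i] by rewrite -expr2 sqrr_sign.
by rewrite exprD -mulrA -E mulrA sq mul1r.
Qed.

End Functional.

Let psi_exists : {psi : R -> R | [/\ smooth setT psi, forall x : R, x <= 0 -> psi x = 0 &
  forall x : R, 2^-1 <= x -> psi x = 1]}.
Proof. by apply: cid; apply: exists_smooth_step; rewrite invr_gt0. Qed.

(** Translation by the identity component and the action of M on the fibres move
    any point to the base point. *)
Lemma value_nonzero (f : I) g : T f g <> 0 -> exists x f', [/\ H0' x, ps_fun f' = translate x f & T f' 1%:M <> 0].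
Proof.
move=> Tg; have Hg : H' g by apply: contrapT => h; apply: Tg; exact: ps_out.
set s := tag_rep R n.+1 (component_tag g).
have gs0 : H0' (g *m s) by exact: (tag_rep_component ord0_last GE' Hg).
have Hx : H0' (invmx (g *m s)) by exact: (sub_inv sH0').
have [f' f'E] := translate_in f (stab_lorentz (stab0_stab Hx)).
exists (invmx (g *m s)), f'; split=> //.
rewrite (eqT Hx f'E) /translate invmxK mulmx1 => T0; apply: Tg.
have ss : s *m s = 1%:M by exact: tag_rep_sq.
have -> : g = g *m s *m s by rewrite -mulmxA ss mulmx1.
rewrite sectionJ_sign; last exact: stab0_stab.
rewrite T0 /sigma; have := extpow_mapZ (invmx (lead (sign_mx n.+1 (sign_of R (component_tag g).2)))) 0 (0 : extpow R n.+1 j).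
by rewrite scaler0 scale0r => ->; rewrite scaler0.
Qed.

Lemma diff_op_nat (f : I) : T f <> 0 -> exists k : nat, nu - lam = k%:R.
Proof.
move=> Tf; have [g Tg] : exists g, T f g <> 0.
  apply: contrapT => h; apply: Tf; apply: psP => g _.
  by apply: contrapT => Tg; apply: h; exists g.
have [x [f' [_ _ T1]]] := value_nonzero Tg.
have [k0 k0n] : exists k0, extpow_val (T f' 1%:M) k0 != 0.
  apply: contrapT => h; apply: T1; apply: extpowP => k; rewrite ffunE.
  by apply/eqP/negPn/negP => hk; apply: h; exists k.
have [psi [spsi psi0 psi1]] := psi_exists.
have [fm fmE] := translate_in f' (stab_lorentz (@stab_diag3 (-1) (or_intror erefl))).
exact: (value_nat spsi psi0 psi1 k0n).
Qed.

(** At the base point this is the parity of the values; other points are reached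
    by translation with the identity component, which diag3 (-1) 1 normalizes,
    and then by the action of P. *)
Lemma diff_op_parity k (f fm : I) : nu - lam = k%:R -> beta = alpha + k%:R ->
  ps_fun fm = translate (diag3 (-1) 1%:M) f ->
  ps_fun (T fm) = translate (diag3 (-1) 1%:M) (T f).
Proof.
move=> ck bE.
set mm : M := diag3 (-1) 1%:M.
have Hm : H' mm by apply: stab_diag3; right.
have mm1 : mm *m mm = 1%:M by rewrite /mm diag3_mul mulrNN !mulmx1 mulr1 diag3_1.
have mV : invmx mm = mm by exact: invmx_involution.
have [psi [spsi psi0 psi1]] := psi_exists.
have sgnE : (-1) ^+ (alpha + k)%N = (-1) ^+ beta :> R[i].
  rewrite bE -signr_odd -[RHS]signr_odd; congr (_ ^+ _).
  by rewrite /= val_Zp_nat // odd_mod // !oddD odd_mod.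
have at1 (u um : I) : ps_fun um = translate mm u -> T um 1%:M = translate mm (T u) 1%:M.
  move=> umE; rewrite /translate mV mulmx1.
  have -> : mm = 1%:M *m (mm *m boost 0) by rewrite boost_0 mulmx1 mul1mx.
  rewrite sectionJ_ma; [|exact: (sub_1 sH')|by right].
  apply: extpowP => k0; rewrite extpow_scale mulr0 oppr0 cexp0 mulr1 rmorphN rmorph1 -sgnE.
  exact: (@value_parity k0 psi spsi psi0 psi1 u um umE k ck).
move=> fmE; apply/funext => g.
have [Hg|Hg] := pselect (H' g); last first.
  rewrite /translate !ps_out // => Hmg; apply: Hg.
  exact: (sub_invl GE' g sH' Hm).1.
have on0 x : H0' x -> T fm x = translate mm (T f) x.
  move=> x0; have Hx := stab0_stab x0; have lx := stab_lorentz Hx.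
  have xV : H0' (invmx x) by exact: (sub_inv sH0').
  have [ux _] := lorentz_invE lx.
  pose x' := invmx mm *m invmx x *m mm.
  have x'0 : H0' x'.
    apply: (component_conj (group_1 GE') (@group_mul _ _ _ _ GE') (@group_inv _ _ _ _ GE')) => //.
    exact: group_lorentz GE'.
  have lm := stab_lorentz Hm.
  have lx' := stab_lorentz (stab0_stab x'0).
  have lxV := stab_lorentz (stab0_stab xV).
  have [u uE] := translate_in f lx'.
  have [um umE] := translate_in u lm.
  have e1 : mm *m x' = invmx x *m mm.
    by rewrite /x' mV !mulmxA mm1 mul1mx.
  have umE' : ps_fun um = translate (invmx x) fm.
    by rewrite umE uE fmE -!translateM // e1.
  have := congr1 (fun F => F 1%:M) (eqT xV umE'); rewrite /translate invmxK mulmx1 => <-.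
  rewrite (at1 _ _ umE) (eqT x'0 uE) -translateM // e1 translateM //.
  by rewrite /translate invmxK mulmx1.
set s := tag_rep R n.+1 (component_tag g).
have gs0 : H0' (g *m s) by exact: (tag_rep_component ord0_last GE' Hg).
have ss : s *m s = 1%:M by exact: tag_rep_sq.
have -> : g = g *m s *m s by rewrite -mulmxA ss mulmx1.
have Hgs := stab0_stab gs0.
have Hmgs : H' (invmx mm *m (g *m s)) by apply: (sub_mul sH') => //; exact: (sub_inv sH').
have e1 := sectionJ_sign (T fm) (component_tag g) Hgs.
have e2 := sectionJ_sign (T f) (component_tag g) Hmgs.
by apply: etrans e1 _; rewrite on0 //; apply: etrans (esym e2) _; rewrite /translate !mulmxA.
Qed.

End Key.

(** * Isomorphisms between spaces of differential operators *)

Section EquivAt.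
Variables (R : realType) (n : nat).
Local Notation M := 'M[R]_n.+2.
Variables (H1 H2 : set M) (m1 m2 : nat) (r1 : 'M[R]_n -> 'M[R]_m1) (r2 : 'M[R]_n -> 'M[R]_m2).
Variables (i1 i2 : nat) (lam1 lam2 : R[i]) (alpha1 alpha2 : 'Z_2).
Local Notation I := (principal_series H1 r1 i1 lam1 alpha1).
Local Notation J := (principal_series H2 r2 i2 lam2 alpha2).
Implicit Types (x : M) (c : R[i]).

(** The star operators commute with translations only up to the scalar det x. *)
Definition equiv_at c x (T : I -> J) : Prop :=
  forall f f' : I, ps_fun f' = translate x f -> ps_fun (T f') = c *: translate x (T f).

(** Equivariance is stated for pairs of sections that are translates of each
    other; composition needs the existence of the translate. *)
Definition translatable x := forall f : I, exists f' : I, ps_fun f' = translate x f.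

Lemma equivariantE H (T : I -> J) : equivariant H T <-> forall x, H x -> equiv_at 1 x T.
Proof.
by split=> h x Hx f f' ff'; [rewrite scale1r|rewrite -[RHS]scale1r]; exact: h ff'.
Qed.

Lemma linear0_op (T : I -> J) : linear T -> T 0 = 0.
Proof. by move=> lT; have := lT (-1) 0 0; rewrite scaler0 addr0 scaleN1r addNr. Qed.

Lemma linearZ_op (T : I -> J) c f : linear T -> T (c *: f) = c *: T f.
Proof. by move=> lT; have := lT c f 0; rewrite addr0 linear0_op // addr0. Qed.

Lemma linearD_op (T : I -> J) f f' : linear T -> T (f + f') = T f + T f'.
Proof. by move=> lT; have := lT 1 f f'; rewrite !scale1r. Qed.

Lemma linearN_op (T : I -> J) f : linear T -> T (- f) = - T f.
Proof. by move=> lT; rewrite -scaleN1r linearZ_op // scaleN1r. Qed.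

End EquivAt.

Section EquivComp.
Variables (R : realType) (n : nat).
Local Notation M := 'M[R]_n.+2.
Variables (H1 H2 H3 : set M) (m1 m2 m3 : nat).
Variables (r1 : 'M[R]_n -> 'M[R]_m1) (r2 : 'M[R]_n -> 'M[R]_m2) (r3 : 'M[R]_n -> 'M[R]_m3).
Variables (i1 i2 i3 : nat) (lam1 lam2 lam3 : R[i]) (alpha1 alpha2 alpha3 : 'Z_2).
Local Notation I := (principal_series H1 r1 i1 lam1 alpha1).
Local Notation J := (principal_series H2 r2 i2 lam2 alpha2).
Local Notation K := (principal_series H3 r3 i3 lam3 alpha3).
Implicit Types (x : M) (c : R[i]).

Lemma equiv_at_comp c c' x (T : I -> J) (S : J -> K) : linear S ->
  translatable H2 r2 i2 lam2 alpha2 x ->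
  equiv_at c x T -> equiv_at c' x S -> equiv_at (c * c') x (S \o T).
Proof.
move=> lS tr eT eS f f' ff'.
have [y yE] := tr (T f).
have -> : (S \o T) f' = c *: S y.
  rewrite -(linearZ_op _ _ lS) /=; congr (S _); apply: val_inj.
  by rewrite /= (eT _ _ ff') -yE.
rewrite -[LHS]/(c *: ps_fun (S y)) (eS _ _ yE).
by rewrite scalerA.
Qed.

Lemma equiv_at_mul x y (T : I -> J) : x \in unitmx -> y \in unitmx ->
  translatable H1 r1 i1 lam1 alpha1 y ->
  equiv_at 1 x T -> equiv_at 1 y T -> equiv_at 1 (x *m y) T.
Proof.
move=> ux uy tr ex ey f f' ff'.
have VM := invmx_mul ux uy.
have [u uE] := tr f.
have fu : ps_fun f' = translate x u.
  by rewrite ff' uE; apply/funext => g; rewrite /translate VM mulmxA.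
rewrite (ex _ _ fu) (ey _ _ uE) !scale1r.
by apply/funext => g; rewrite /translate VM mulmxA.
Qed.

Lemma equiv_at_1 (T : I -> J) : equiv_at 1 1%:M T.
Proof.
have t1 m (f : M -> extpow R m i1) : translate 1%:M f = f.
  by apply/funext => g; rewrite /translate invmx1 mul1mx.
have t2 m (f : M -> extpow R m i2) : translate 1%:M f = f.
  by apply/funext => g; rewrite /translate invmx1 mul1mx.
move=> f f'; rewrite t1 t2 scale1r => e; congr (ps_fun (T _)); exact: val_inj.
Qed.

End EquivComp.

Section LinBij.
Variables (K : pzRingType) (U V : lmodType K) (A : set U) (B : set V) (Phi : U -> V) (Psi : V -> U).

Lemma lin_bij_inverse : (forall x, A x -> B (Phi x)) -> (forall y, B y -> A (Psi y)) ->
  (forall x, A x -> Psi (Phi x) = x) -> (forall y, B y -> Phi (Psi y) = y) ->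
  (forall a x y, Phi (a *: x + y) = a *: Phi x + Phi y) -> lin_bij A B Phi.
Proof.
move=> AB BA PsiK PhiK lin; split; last by move=> *; exact: lin.
split.
- by move=> x /AB.
- by move=> x y; rewrite !inE => Ax Ay e; rewrite -(PsiK x Ax) e PsiK.
- by move=> y By; exists (Psi y); [exact: BA|exact: PhiK].
Qed.

End LinBij.

Section StarPair.
Variables (R : realType) (n m : nat) (F : {set 'I_n.+1}) (r : 'M[R]_n.+1 -> 'M[R]_m) (G : set 'M[R]_n.+3).
Hypothesis (GE : G = fixing F).
Hypothesis rO : forall B, fixing_mx F B -> r B *m (r B)^T = 1%:M.
Hypothesis rD : forall B, fixing_mx F B -> \det (r B) = \det B.
Variables (i i' : nat) (e : (i + i' = m)%N) (H : set 'M[R]_n.+3) (lam : R[i]) (alpha : 'Z_2).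
Hypothesis sH : subgroup G H.
Local Notation I := (principal_series H r i lam alpha).
Local Notation I' := (principal_series H r i' lam alpha).

(** The twists of the two operators multiply to (det g) ^ 2 = 1, so that they are
    inverse to each other along with the fibre maps. *)
Lemma star_pair : exists (S : I -> I') (S' : I' -> I),
  [/\ local_continuous_op S, local_continuous_op S', cancel S S', cancel S' S &
   (forall x, H x -> equiv_at (\det x)%:C x S /\ equiv_at (\det x)%:C x S')].
Proof.
have w1 (u : extpow R m i) k := starE e u k; have w2 (u : extpow R m i') k := starinvE e u k.
have [S tS] := @twist_exists R n m F r G GE rO rD i i' (star e) (fun p k => star_coef R e k p) w1
  (fun C u CC => star_map e u CC) H lam alpha sH.
have [S' tS'] := @twist_exists R n m F r G GE rO rD i' i (starinv e) (fun k p => starinv_coef R e k p) w2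
  (fun C u CC => starinv_map e u CC) H lam alpha sH.
have [gS SE] := tS; have [gS' SE'] := tS'.
have dd g : H g -> (\det g)%:C * (\det g)%:C = 1 :> R[i].
  move=> Hg; rewrite -rmorphM /=; case: (lorentz_det (sub_lorentz GE sH Hg)) => ->.
    by rewrite mulr1.
  by rewrite mulrNN mulr1.
have lS (c : R[i]) u : star e (c *: u) = c *: star e u.
  have := @star_linear R i i' m e (-1) 0 0; rewrite scaler0 addr0 scaleN1r addNr => s0.
  by have := @star_linear R i i' m e c u 0; rewrite addr0 s0 addr0.
have lS' (c : R[i]) u : starinv e (c *: u) = c *: starinv e u.
  have := @starinv_linear R i i' m e (-1) 0 0; rewrite scaler0 addr0 scaleN1r addNr => s0.
  by have := @starinv_linear R i i' m e c u 0; rewrite addr0 s0 addr0.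
exists S, S'; split=> //.
- by move=> f; apply: psP => g Hg; rewrite SE' // SE // lS' starK scalerA dd // scale1r.
- by move=> f; apply: psP => g Hg; rewrite SE // SE' // lS starinvK scalerA dd // scale1r.
- move=> x Hx; split=> f f' ff'.
    exact: (twisted_translate GE sH tS Hx ff').
  exact: (twisted_translate GE sH tS' Hx ff').
Qed.

End StarPair.

Section Assembly.
Variables (R : realType) (n : nat).
Local Notation N := n.+2.
Local Notation M := 'M[R]_N.+2.
Local Notation H := (@lorentz R N).
Local Notation H0 := (@lorentz0 R N).
Local Notation H' := (@lorentz_stab R N).
Local Notation H0' := (@lorentz_stab0 R N).
Implicit Types (x g : M) (lam nu : R[i]) (alpha beta : 'Z_2).

Let GE := lorentz_fixing R n.+1.
Let GE' := lorentz_stab_fixing R n.+1.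
Let F0 := ord0_set0 n.
Let F0' := ord0_last n.
Let sH := subgroup_G GE.
Let sH0 := subgroup_G0 GE.
Let sH' := subgroup_G GE'.
Let sH0' := subgroup_G0 GE'.

Let idM (B C : 'M[R]_N) : fixing_mx finset.set0 B -> fixing_mx finset.set0 C -> id (B *m C) = id B *m id C.
Proof. by []. Qed.
Let idO (B : 'M[R]_N) : fixing_mx finset.set0 B -> id B *m (id B)^T = 1%:M.
Proof. by case. Qed.
Let idD (B : 'M[R]_N) : fixing_mx finset.set0 B -> \det (id B) = \det B.
Proof. by []. Qed.
Local Notation last_set := (finset.set1 (ord_max : 'I_N)).
Let leadM (B C : 'M[R]_N) : fixing_mx last_set B -> fixing_mx last_set C -> lead (B *m C) = lead B *m lead C.
Proof. by move=> hB _; exact: lead_mul. Qed.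

Lemma stab0_lorentz0 : H0' `<=` H0.
Proof.
apply: connected_component_max; first exact: (sub_1 sH0').
  by move=> g /stab0_stab /stab_lorentz.
exact: component_connected.
Qed.

Lemma stab0_det x : H0' x -> \det x = 1.
Proof. by rewrite /lorentz_stab0 GE' => /(fixing0_det). Qed.

Lemma lorentz0_det x : H0 x -> \det x = 1.
Proof. by rewrite /lorentz0 GE => /(fixing0_det). Qed.

Lemma star_I (P : set M) i (hi : (i <= N)%N) lam alpha : subgroup H P ->
  exists (S : principal_series P id i lam alpha -> principal_series P id (N - i)%N lam alpha) S',
  [/\ local_continuous_op S, local_continuous_op S', cancel S S', cancel S' S &
   (forall x, P x -> equiv_at (\det x)%:C x S /\ equiv_at (\det x)%:C x S')].
Proof. by move=> sP; exact: (star_pair GE idO idD (subnKC hi) lam alpha sP). Qed.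

Lemma star_J (P : set M) j (hj : (j <= N.-1)%N) nu beta : subgroup H' P ->
  exists (S : principal_series P (@lead R N) j nu beta -> principal_series P (@lead R N) (N.-1 - j)%N nu beta) S',
  [/\ local_continuous_op S, local_continuous_op S', cancel S S', cancel S' S &
   (forall x, P x -> equiv_at (\det x)%:C x S /\ equiv_at (\det x)%:C x S')].
Proof.
move=> sP; exact: (star_pair GE' (@lead_orthogonal R N.-1) (@lead_det R N.-1) (subnKC hj) nu beta sP).
Qed.

Lemma equiv_det1 (P : set M) (P1 P2 : set M) m1 (r1 : 'M[R]_N -> 'M[R]_m1) i1 lam1 alpha1
    m2 (r2 : 'M[R]_N -> 'M[R]_m2) i2 lam2 alpha2
    (S : principal_series P1 r1 i1 lam1 alpha1 -> principal_series P2 r2 i2 lam2 alpha2) (Q : set M) :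
  (forall x, P x -> equiv_at (\det x)%:C x S) -> Q `<=` P -> (forall x, Q x -> \det x = 1) -> equivariant Q S.
Proof.
move=> eS QP Qd; apply/equivariantE => x Qx; have := eS x (QP _ Qx).
by rewrite Qd.
Qed.

Section Part1.
Variables (i j : nat) (lam nu : R[i]).
Hypotheses (hi : (i <= N)%N) (hj : (j <= N.-1)%N).
Local Notation i' := (N - i)%N.
Local Notation j' := (N.-1 - j)%N.

(** On the identity components det = 1, and the star operators intertwine. *)
Lemma star_bijections : exists (S : I0 N i lam -> I0 N i' lam) (Sinv : I0 N i' lam -> I0 N i lam)
             (S' : J0 N j nu -> J0 N j' nu) (S'inv : J0 N j' nu -> J0 N j nu),
        [/\ rep_iso H0 S Sinv,
            rep_iso H0' S' S'inv,
            lin_bij (Diff_SO0 N i lam j nu) (Diff_SO0 N i' lam j nu)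
              (fun T => T \o Sinv),
            lin_bij (Diff_SO0 N i' lam j nu) (Diff_SO0 N i lam j' nu)
              (fun T => S' \o T \o S)
          & lin_bij (Diff_SO0 N i lam j' nu) (Diff_SO0 N i' lam j' nu)
              (fun T => T \o Sinv)].
Proof.
have [S [Si [gS gSi SK SiK eS]]] := star_I hi lam 0 sH0.
have [S' [S'i [gS' gS'i S'K S'iK eS']]] := star_J hj nu 0 sH0'.
have qS : equivariant H0 S by apply: (equiv_det1 (P := H0)) => // x; [case/eS|exact: lorentz0_det].
have qSi : equivariant H0 Si by apply: (equiv_det1 (P := H0)) => // x; [case/eS|exact: lorentz0_det].
have qS' : equivariant H0' S' by apply: (equiv_det1 (P := H0')) => // x; [case/eS'|exact: stab0_det].
have qS'i : equivariant H0' S'i by apply: (equiv_det1 (P := H0')) => // x; [case/eS'|exact: stab0_det].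
have dS : diff_ops H0' S.
  by apply/diff_opsE; split=> // x /stab0_lorentz0; exact: qS.
have dSi : diff_ops H0' Si.
  by apply/diff_opsE; split=> // x /stab0_lorentz0; exact: qSi.
have dS' : diff_ops H0' S' by apply/diff_opsE.
have dS'i : diff_ops H0' S'i by apply/diff_opsE.
have [lS cS _] := gS; have [lSi cSi _] := gSi; have [lS' cS' _] := gS'; have [lS'i cS'i _] := gS'i.
exists S, Si, S', S'i; split=> //.
- apply: (lin_bij_inverse (Psi := fun T => T \o S)).
  + by move=> T dT; exact: diff_ops_comp.
  + by move=> T dT; exact: diff_ops_comp.
  + by move=> T _; apply/funext => f /=; rewrite SK.
  + by move=> T _; apply/funext => f /=; rewrite SiK.
  + by [].
- apply: (lin_bij_inverse (Psi := fun T => S'i \o T \o Si)).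
  + by move=> T dT; apply: diff_ops_comp => //; exact: diff_ops_comp.
  + by move=> T dT; apply: diff_ops_comp => //; exact: diff_ops_comp.
  + by move=> T _; apply/funext => f /=; rewrite S'K SiK.
  + by move=> T _; apply/funext => f /=; rewrite S'iK SK.
  + by move=> a T1 T2; apply/funext => f; exact: (lS' a (T1 (S f)) (T2 (S f))).
- apply: (lin_bij_inverse (Psi := fun T => T \o S)).
  + by move=> T dT; exact: diff_ops_comp.
  + by move=> T dT; exact: diff_ops_comp.
  + by move=> T _; apply/funext => f /=; rewrite SK.
  + by move=> T _; apply/funext => f /=; rewrite SiK.
  + by [].
Qed.

End Part1.

(** Identifies Diff_SO0 with the operators between I_alpha and J_beta that
    commute with the identity component of the subgroup only, for any parities. *)
Lemma res_ext_I i lam alpha : exists (Res : I_ N i lam alpha -> I0 N i lam) (Ext : I0 N i lam -> I_ N i lam alpha),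
  [/\ diff_ops H0' Res, diff_ops H0' Ext, cancel Res Ext & cancel Ext Res].
Proof.
have [Res [gR RE]] := @res_exists R n.+1 _ _ id _ GE i lam alpha.
have [Ext [gE EE]] := @ext_exists R n.+1 _ _ id _ F0 GE idM (erefl _) idO i lam alpha.
exists Res, Ext; split.
- apply/diff_opsE; split=> // x /stab0_lorentz0 Hx f f'; exact: (res_translate GE RE Hx).
- apply/diff_opsE; split=> // x /stab0_lorentz0 Hx f f'; exact: (ext_translate F0 GE EE Hx).
- by move=> f; apply: (res_ext F0 GE _ RE EE) => //.
- by move=> f; apply: (ext_res F0 GE _ RE EE) => //.
Qed.

Lemma res_ext_J j nu beta : exists (Res : J_ N j nu beta -> J0 N j nu) (Ext : J0 N j nu -> J_ N j nu beta),
  [/\ diff_ops H0' Res, diff_ops H0' Ext, cancel Res Ext & cancel Ext Res].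
Proof.
have [Res [gR RE]] := @res_exists R n.+1 _ _ (@lead R N) _ GE' j nu beta.
have [Ext [gE EE]] := @ext_exists R n.+1 _ _ (@lead R N) _ F0' GE' leadM (lead_1 R N.-1) (@lead_orthogonal R N.-1) j nu beta.
exists Res, Ext; split.
- apply/diff_opsE; split=> // x Hx f f'; exact: (res_translate GE' RE Hx).
- apply/diff_opsE; split=> // x Hx f f'; exact: (ext_translate F0' GE' EE Hx).
- by move=> f; apply: (res_ext F0' GE' _ RE EE) => //; exact: lead_orthogonal.
- by move=> f; apply: (ext_res F0' GE' _ RE EE) => //; exact: lead_1.
Qed.

Lemma Diff_SO0_nat i j lam nu : (exists2 T, Diff_SO0 N i lam j nu T & T <> 0) ->
  exists k : nat, nu - lam = k%:R.
Proof.
move=> [T dT T0].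
have [ResI [ExtI [dRI dEI RIK EIK]]] := res_ext_I i lam 0.
have [ResJ [ExtJ [dRJ dEJ RJK EJK]]] := res_ext_J j nu 0.
have dTT : diff_ops H0' (ExtJ \o T \o ResI).
  by apply: diff_ops_comp => //; exact: diff_ops_comp.
have [f Tf] : exists f, T f <> 0.
  by apply: contrapT => h; apply: T0; apply/funext => f; apply: contrapT => h'; apply: h; exists f.
apply: (diff_op_nat dTT (f := ExtI f)) => /= e; apply: Tf.
have lR : linear ResJ by case: dRJ => [[]].
by rewrite EIK in e; rewrite -(EJK (T f)) e linear0_op.
Qed.

(** The reflection diag (1, -1, 1, ..., 1). Together with diag3 (-1) 1 it
    represents all the components of O(n,1). *)
Definition rho : M := diag3 1 (sign_mx n.+1 (-1)).

Lemma rho_rho : rho *m rho = 1%:M.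
Proof. by rewrite /rho diag3_mul sign_mxM mulrNN !mulr1 sign_mx1 diag3_1. Qed.

Lemma rho_inv : invmx rho = rho. Proof. exact: invmx_involution rho_rho. Qed.

Lemma rho_stab : H' rho.
Proof. by rewrite GE'; apply: (fixing_sign F0'); [left|right]. Qed.

Lemma rho_det : \det rho = -1.
Proof. by rewrite /rho diag3_det sign_mx_det expr1n mul1r. Qed.

Lemma stab0_rho x : H0' x -> H0' (rho *m x *m rho).
Proof.
move=> Hx; rewrite -{1}rho_inv.
exact: (component_conj (group_1 GE') (@group_mul _ _ _ _ GE') (@group_inv _ _ _ _ GE') (group_lorentz GE') rho_stab Hx).
Qed.

(** The action of rho on the sphere, as the coordinate of index 1 there is the
    first middle coordinate. *)
Definition sphere_reflection (w : 'rV[R]_N.+1) : 'rV[R]_N.+1 :=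
  w *m diag_mx (\row_p (if p == lift ord0 ord0 then -1 else 1)).

Lemma sphere_reflectionK : involutive sphere_reflection.
Proof.
move=> w; rewrite /sphere_reflection -mulmxA mulmx_diag (_ : \row_p _ = const_mx 1) ?diag_const_mx ?mulmx1 //.
by apply/rowP => p; rewrite !mxE; case: ifP; rewrite ?mulrNN mulr1.
Qed.

Lemma sphere_reflection_continuous : continuous sphere_reflection.
Proof. by apply: continuous_mulmx => w; [exact: cvg_id|exact: cst_continuous]. Qed.

Lemma rho_entry (v : 'cV[R]_N.+2) p : (rho *m v) p ord0 = (if p == mid ord0 then - v p ord0 else v p ord0).
Proof.
have -> : rho = 1%:M - 2 *: (basis_vec R (mid ord0) *m (basis_vec R (mid ord0))^T).
  rewrite /rho -reflection_e0 /reflection.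
  have -> : nsq (@unit_vec R n.+1 ord0) = 1 by rewrite /nsq unit_vec_tr !mxE eqxx mulr1n.
  rewrite divr1 -[RHS](_ : 2^-1 *: (xi R N *m (xi R N)^T + eta R N *m (eta R N)^T) +
    iota_mx R N *m (1%:M - 2 *: (unit_vec R ord0 *m (unit_vec R ord0)^T)) *m (iota_mx R N)^T = _).
    by rewrite diag3E mul1r.
  rewrite mulmxBr mulmxBl mulmx1 addrA resolution; congr (_ - _).
  by rewrite -scalemxAr -scalemxAl -io_unit_vec trmx_mul !mulmxA.
rewrite mulmxBl mul1mx -scalemxAl -mulmxA /basis_vec trmx_delta -rowE !mxE big_ord1 !mxE eqxx andbT.
case: eqP => [->|_] /=; last by rewrite mul0r mulr0 subr0.
by rewrite mul1r; ring.
Qed.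

Lemma sphere_pt_rho g : sphere_pt (rho *m g) = sphere_reflection (sphere_pt g).
Proof.
apply/rowP => p; rewrite [LHS]mxE /sphere_reflection mul_mx_diag [RHS]mxE [X in _ = X * _]mxE [X in _ = _ * X]mxE /=.
rewrite -!mulmxA !rho_entry.
have -> : (ord_max == mid ord0 :> 'I_N.+2) = false by rewrite eq_sym mid_neqmax.
have -> : (widen_ord (leqnSn N.+1) p == mid ord0 :> 'I_N.+2) = (p == lift ord0 ord0).
  by rewrite -!val_eqE.
by case: ifP => _; rewrite ?mulrN1 ?mulr1 ?mulNr.
Qed.

Lemma supp_rho m i (f : M -> extpow R m i) w :
  supp (translate rho f) w -> supp f (sphere_reflection w).
Proof.
move=> sw B Bw.
have : nbhs w (sphere_reflection @^-1` B) by exact: sphere_reflection_continuous Bw.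
move=> /sw [_ [[g /= gn <-] Bg]].
exists (sphere_reflection (sphere_pt g)); split=> //.
rewrite -sphere_pt_rho; exists (rho *m g) => //=.
by move: gn; rewrite /translate rho_inv.
Qed.

Section RhoOp.
Variables (P : set M) (m : nat) (F : {set 'I_N}) (r : 'M[R]_N -> 'M[R]_m) (i : nat) (lam : R[i]) (alpha : 'Z_2).
Hypotheses (PE : P = fixing F) (Prho : P rho).
Local Notation I := (principal_series P r i lam alpha).

Lemma rho_op : exists S : I -> I, [/\ forall f, ps_fun (S f) = translate rho f, linear S, continuous_op S & involutive S].
Proof.
have [S [SE lS cS]] := @translate_exists R n.+1 m F r P PE P i lam alpha rho (subgroup_G PE) Prho.
exists S; split=> // f; apply: psP => g Pg.
apply: etrans (congr1 (fun u => u g) (SE (S f))) _.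
apply: etrans (congr1 (fun u => u (invmx rho *m g)) (SE f)) _.
by rewrite /translate rho_inv mulmxA rho_rho mul1mx.
Qed.

Lemma translatable_group x : P x -> translatable P r i lam alpha x.
Proof.
move=> Px f; have [S [SE _ _]] := @translate_exists R n.+1 m F r P PE P i lam alpha x (subgroup_G PE) Px.
by exists (S f).
Qed.

End RhoOp.

Section Part2.
Variables (i j : nat) (lam nu : R[i]) (alpha beta : 'Z_2) (k : nat).
Hypotheses (ck : nu - lam = k%:R) (bE : beta = alpha + k%:R).
Local Notation I := (I_ N i lam alpha).
Local Notation J := (J_ N j nu beta).

(** Modulo its identity component O(n,1) is generated by rho and diag3 (-1) 1, and
    by parity an operator commuting with the identity component commutes with
    the latter as soon as beta = alpha + k. *)
Lemma diff_ops_full (T : I -> J) : diff_ops H0' T -> equiv_at 1 rho T -> diff_ops H' T.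
Proof.
move=> dT eR; have [gT eT] := (diff_opsE H0' T).1 dT.
apply/diff_opsE; split=> //; apply/equivariantE => x Hx.
have tr y : H' y -> translatable H id i lam alpha y.
  by move=> /stab_lorentz Hy; exact: (translatable_group GE).
have un y : H' y -> y \in unitmx by move=> /stab_lorentz /lorentz_invE [].
set tau := component_tag x.
have x0 : H0' (x *m tag_rep R n.+1 tau) by exact: (tag_rep_component F0' GE' Hx).
have -> : x = x *m tag_rep R n.+1 tau *m (diag3 (sign_of R tau.1) 1%:M *m diag3 1 (sign_mx n.+1 (sign_of R tau.2))).
  rewrite diag3_mul mulr1 mul1mx -/(tag_rep _ _ _) -mulmxA tag_rep_sq mulmx1 //.
have h1 : H' (diag3 (sign_of R tau.1) 1%:M) by apply: stab_diag3; exact: sign_of_pm.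
have h2 : H' (diag3 1 (sign_mx n.+1 (sign_of R tau.2))).
  by rewrite GE'; apply: (fixing_sign F0'); [left|exact: sign_of_pm].
apply: equiv_at_mul; [exact: un (stab0_stab x0)| |exact: tr (sub_mul sH' h1 h2)| |].
- exact: un (sub_mul sH' h1 h2).
- by move/equivariantE: eT; exact.
apply: equiv_at_mul; [exact: un|exact: un|exact: tr| |].
- rewrite /sign_of; case: ifP => _; first by rewrite diag3_1; exact: equiv_at_1.
  by move=> f f' ff'; rewrite scale1r; exact: (diff_op_parity dT ck bE ff').
- rewrite /sign_of; case: ifP => _ //; first by rewrite sign_mx1 diag3_1; exact: equiv_at_1.
Qed.

End Part2.

Section Part2b.
Variables (i j : nat) (lam nu : R[i]) (alpha : 'Z_2) (k : nat).
Hypotheses (hi : (i <= N)%N) (hj : (j <= N.-1)%N) (ck : nu - lam = k%:R).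
Local Notation beta := (alpha + k%:R).
Local Notation i' := (N - i)%N.
Local Notation j' := (N.-1 - j)%N.
Local Notation I := (I_ N i lam alpha).
Local Notation I' := (I_ N i' lam alpha).
Local Notation J := (J_ N j nu beta).

(** One star operator on each side: both anticommute with elements of determinant
    -1, so the composite intertwines. *)
Lemma Diff_O_star_bijection : lin_iso
  (Diff_O N i lam alpha j nu beta `*` Diff_O N i' lam alpha j nu beta)
  (Diff_O N i lam alpha j nu beta `*` Diff_O N i lam alpha j' nu beta).
Proof.
have [S [Si [gS gSi SK SiK eS]]] := star_I hi lam alpha sH.
have [S' [S'i [gS' gS'i S'K S'iK eS']]] := star_J hj nu beta sH'.
have [lS cS _] := gS; have [lSi cSi _] := gSi; have [lS' cS' _] := gS'; have [lS'i cS'i _] := gS'i.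
have trJ x : H' x -> translatable H' (@lead R N) j nu beta x by move=> Hx; exact: (translatable_group GE').
have trJ' x : H' x -> translatable H' (@lead R N) j' nu beta x by move=> Hx; exact: (translatable_group GE').
have trI x : H' x -> translatable H id i lam alpha x by move=> /stab_lorentz Hx; exact: (translatable_group GE).
have trI' x : H' x -> translatable H id i' lam alpha x by move=> /stab_lorentz Hx; exact: (translatable_group GE).
have dd x : H' x -> (\det x)%:C * (\det x)%:C = 1 :> R[i].
  move=> /stab_lorentz Hx; rewrite -rmorphM /=; case: (lorentz_det Hx) => ->.
    by rewrite mulr1.
  by rewrite mulrNN mulr1.
exists (fun p => (p.1, S' \o p.2 \o S)).
apply: (lin_bij_inverse (Psi := fun p => (p.1, S'i \o p.2 \o Si))).
- move=> [T1 T2] [/= d1 d2]; split=> //=; apply/diff_opsE.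
  have [g2 e2] := (diff_opsE _ _).1 d2; have [l2 _ _] := g2.
  split; first by apply: local_continuous_comp => //; exact: local_continuous_comp.
  apply/equivariantE => x Hx; rewrite -(dd x Hx).
  have e2x := (equivariantE _ _).1 e2 x Hx.
  have ST := equiv_at_comp l2 (trI' x Hx) (eS x (stab_lorentz Hx)).1 e2x.
  by have := equiv_at_comp lS' (trJ x Hx) ST (eS' x Hx).1; rewrite mulr1.
- move=> [T1 T2] [/= d1 d2]; split=> //=; apply/diff_opsE.
  have [g2 e2] := (diff_opsE _ _).1 d2; have [l2 _ _] := g2.
  split; first by apply: local_continuous_comp => //; exact: local_continuous_comp.
  apply/equivariantE => x Hx; rewrite -(dd x Hx).
  have e2x := (equivariantE _ _).1 e2 x Hx.
  have ST := equiv_at_comp l2 (trI x Hx) (eS x (stab_lorentz Hx)).2 e2x.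
  by have := equiv_at_comp lS'i (trJ' x Hx) ST (eS' x Hx).2; rewrite mulr1.
- by move=> [T1 T2] _ /=; congr pair; apply/funext => f /=; rewrite S'K SiK.
- by move=> [T1 T2] _ /=; congr pair; apply/funext => f /=; rewrite S'iK SK.
- move=> a [T1 T2] [U1 U2]; congr pair; apply/funext => f.
  exact: (lS' a (T2 (S f)) (U2 (S f))).
Qed.

Lemma half_linear (V : lmodType R[i]) (a c : R[i]) (x y z w : V) :
  c *: (a *: x + y + (a *: z + w)) = a *: (c *: (x + z)) + c *: (y + w).
Proof.
rewrite addrACA -[a *: x + _]scalerDr [LHS]scalerDr !scalerA; congr (_ *: _ + _).
exact: mulrC.
Qed.

(** After extension to the full groups, conjugation by rho is an involution of
    the space of operators. The even ones are the O(n,1)-intertwining operators.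
    The odd ones become intertwining on I (n - i) after composition with the
    star operator, which anticommutes with rho. *)
Lemma Diff_SO0_decomposition : lin_iso (Diff_SO0 N i lam j nu)
  (Diff_O N i lam alpha j nu beta `*` Diff_O N i' lam alpha j nu beta).
Proof.
have [S [Si [gS gSi SK SiK eS]]] := star_I hi lam alpha sH.
have [lS cS _] := gS; have [lSi cSi _] := gSi.
have [ResI [ExtI [dRI dEI RIK EIK]]] := res_ext_I i lam alpha.
have [ResJ [ExtJ [dRJ dEJ RJK EJK]]] := res_ext_J j nu beta.
have lRJ : linear ResJ by case: dRJ => [[]].
have lEJ : linear ExtJ by case: dEJ => [[]].
have [rI [rIE lrI crI rIK]] := @rho_op H N finset.set0 id i lam alpha GE (stab_lorentz rho_stab).
have [rI' [rI'E lrI' crI' rI'K]] := @rho_op H N finset.set0 id i' lam alpha GE (stab_lorentz rho_stab).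
have [rJ [rJE lrJ crJ rJK]] := @rho_op H' N.-1 _ (@lead R N) j nu beta GE' rho_stab.
have dS : diff_ops H0' S.
  apply/diff_opsE; split=> //; apply: (equiv_det1 (P := H)) => //.
  - by move=> x /eS [].
  - by move=> x /stab0_stab /stab_lorentz.
  - exact: stab0_det.
have dSi : diff_ops H0' Si.
  apply/diff_opsE; split=> //; apply: (equiv_det1 (P := H)) => //.
  - by move=> x /eS [].
  - by move=> x /stab0_stab /stab_lorentz.
  - exact: stab0_det.
have rS f : S (rI f) = - rI' (S f).
  apply: val_inj => /=; have := (eS rho (stab_lorentz rho_stab)).1 f (rI f) (rIE f).
  by rewrite rho_det rmorphN rmorph1 scaleN1r => ->; rewrite -rI'E.
have rSi f : Si (rI' f) = - rI (Si f).
  apply: val_inj => /=; have := (eS rho (stab_lorentz rho_stab)).2 f (rI' f) (rI'E f).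
  by rewrite rho_det rmorphN rmorph1 scaleN1r => ->; rewrite -rIE.
have conj (T : I -> J) : diff_ops H0' T -> diff_ops H0' (rJ \o T \o rI).
  move=> [[lT eT cT] sT]; split; first split.
  - by apply: linear_comp_op => //; exact: linear_comp_op.
  - move=> x Hx f f' ff'; rewrite /= !rJE.
    have Hx' := stab0_rho Hx.
    have ux : x \in unitmx by have [] := lorentz_invE (stab_lorentz (stab0_stab Hx)).
    have xV : invmx (rho *m x *m rho) = rho *m invmx x *m rho.
      apply: invmx_eq.
      by rewrite !mulmxA -(mulmxA _ rho rho) rho_rho mulmx1 mulmxK // rho_rho.
    have E : ps_fun (rI f') = translate (rho *m x *m rho) (rI f).
      rewrite !rIE ff'; apply/funext => g; rewrite /translate xV rho_inv !mulmxA rho_rho mul1mx.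
      by [].
    rewrite (eT _ Hx' _ _ E); apply/funext => g; rewrite /translate xV rho_inv !mulmxA -(mulmxA _ rho rho).
    by rewrite rho_rho mulmx1.
  - by apply: continuous_comp_op => //; exact: continuous_comp_op.
  - move=> f w; rewrite /= rJE => /supp_rho /sT; rewrite rIE => /supp_rho.
    by rewrite sphere_reflectionK.
(* The operator T between sections over the full groups, and its two parts. *)
pose lift T : I -> J := ExtJ \o T \o ResI.
have dlift T : Diff_SO0 N i lam j nu T -> diff_ops H0' (lift T).
  by move=> dT; apply: diff_ops_comp => //; exact: diff_ops_comp.
pose even (T : I -> J) : I -> J := fun f => 2^-1 *: (T f + rJ (T (rI f))).
pose odd (T : I -> J) : I -> J := fun f => 2^-1 *: (T f - rJ (T (rI f))).
have half_ops (T U : I -> J) : diff_ops H0' T -> diff_ops H0' U ->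
    diff_ops H0' (fun f => 2^-1 *: (T f + U f)).
  move=> dT dU.
  have -> : (fun f => 2^-1 *: (T f + U f)) = (fun f => (2^-1 : R[i]) *: T f + ((2^-1 - 1) *: U f + U f)).
    by apply/funext => f; rewrite scalerDr; congr (_ + _); rewrite scalerBl scale1r subrK.
  by apply: (diff_ops_lin (sub_mul sH')) => //; exact: (diff_ops_lin (sub_mul sH')).
have deven T : diff_ops H0' T -> diff_ops H0' (even T).
  by move=> dT; apply: half_ops => //; exact: conj.
have dodd T : diff_ops H0' T -> diff_ops H0' (odd T).
  move=> dT; apply: (half_ops T (fun f => - (rJ (T (rI f))))) => //.
  have -> : (fun f => - rJ (T (rI f))) = (fun f => (-2 : R[i]) *: (rJ \o T \o rI) f + (rJ \o T \o rI) f).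
    by apply/funext => f /=; rewrite -{3}[rJ _]scale1r -scalerDl (_ : -2 + 1 = -1) ?scaleN1r //; ring.
  by apply: (diff_ops_lin (sub_mul sH')); exact: conj.
have lN (T : J -> J) f : linear T -> T (- f) = - T f by move=> lT; exact: linearN_op.
have rhoeven T f : even T (rI f) = rJ (even T f).
  rewrite /even (linearZ_op _ _ lrJ) (linearD_op _ _ lrJ) rIK rJK.
  by congr (_ *: _); exact: addrC.
have rhoodd T f : odd T (rI f) = - rJ (odd T f).
  rewrite /odd (linearZ_op _ _ lrJ) (linearD_op _ _ lrJ) (lN _ _ lrJ) rIK rJK.
  by rewrite -scalerN opprD opprK; congr (_ *: _); exact: addrC.
have eqv (i1 : nat) (T : I_ N i1 lam alpha -> J) (r1 : I_ N i1 lam alpha -> I_ N i1 lam alpha) :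
   (forall f, ps_fun (r1 f) = translate rho f) -> (forall f, T (r1 f) = rJ (T f)) -> equiv_at 1 rho T.
  move=> r1E Tr f f' ff'; rewrite scale1r -rJE -Tr; congr (ps_fun (T _)).
  by apply: val_inj => /=; rewrite ff' r1E.
have rhoO (i1 : nat) (T : I_ N i1 lam alpha -> J) (r1 : I_ N i1 lam alpha -> I_ N i1 lam alpha) f :
   (forall f, ps_fun (r1 f) = translate rho f) -> diff_ops H' T -> T (r1 f) = rJ (T f).
  move=> r1E [[_ eT _] _]; apply: val_inj; rewrite /= rJE.
  exact: (eT _ rho_stab _ _ (r1E f)).
have h2 (u : J) : 2^-1 *: (u + u) = u.
  have -> : u + u = (2 : R[i]) *: u by rewrite -[2]/(1 + 1) scalerDl scale1r.
  by rewrite scalerA mulVf ?scale1r // pnatr_eq0.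
have h3 a (x y z w : J) :
    2^-1 *: (a *: x + y + (a *: z + w)) = a *: (2^-1 *: (x + z)) + 2^-1 *: (y + w).
  exact: half_linear.
pose Phi T := (even (lift T), odd (lift T) \o Si).
pose Psi (p : (I -> J) * (I' -> J)) := ResJ \o (fun f => 1 *: p.1 f + (p.2 \o S) f) \o ExtI.
have sub0 (i1 : nat) (T : I_ N i1 lam alpha -> J) : diff_ops H' T -> diff_ops H0' T.
  move=> /diff_opsE [gT eT]; apply/diff_opsE; split=> // x /stab0_stab; exact: eT.
exists Phi; apply: (lin_bij_inverse (Psi := Psi)).
- move=> T dT; split=> /=.
    apply: (diff_ops_full ck erefl); first by apply: deven; exact: dlift.
    exact: (eqv _ _ _ rIE (rhoeven _)).
  apply: (diff_ops_full ck erefl); first by apply: diff_ops_comp => //; apply: dodd; exact: dlift.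
  apply: (eqv _ _ _ rI'E) => f /=.
  have [[lo _ _] _] := dodd _ (dlift _ dT).
  by rewrite rSi (linearN_op _ lo) rhoodd opprK.
- move=> [A B] [/= dA dB]; apply: diff_ops_comp => //; apply: diff_ops_comp => //.
  apply: (diff_ops_lin (sub_mul sH')); first exact: sub0.
  by apply: diff_ops_comp => //; exact: sub0.
- move=> T dT; apply/funext => f; rewrite /Psi /Phi /= scale1r SK /even /odd -scalerDr addrACA subrr addr0.
  by rewrite h2 /lift /= EJK EIK.
- move=> [A B] [/= dA dB].
  have liftE : lift (Psi (A, B)) = fun f => A f + B (S f).
    by apply/funext => f; rewrite /lift /Psi /= RJK RIK scale1r.
  have [[lA _ _] _] := dA; have [[lB _ _] _] := dB.
  have cA f : rJ (A (rI f)) = A f by rewrite (rhoO _ _ _ _ rIE dA) rJK.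
  have cB f : rJ (B (S (rI f))) = - B (S f).
    by rewrite rS (linearN_op _ lB) (lN _ _ lrJ) (rhoO _ _ _ _ rI'E dB) rJK.
  rewrite /Phi liftE; congr pair; apply/funext => f.
    by rewrite /even (linearD_op _ _ lrJ) cA cB addrACA subrr addr0 h2.
  by rewrite /= /odd (linearD_op _ _ lrJ) cA cB SiK opprD opprK addrACA subrr add0r h2.
- move=> a T U; congr pair; apply/funext => f; rewrite /= /even /odd /lift /=.
  + rewrite -[X in ExtJ X](erefl (a *: T (ResI f) + U (ResI f))) lEJ.
    rewrite -[X in rJ (ExtJ X)](erefl (a *: T (ResI (rI f)) + U (ResI (rI f)))) lEJ lrJ.
    exact: h3.
  + rewrite -[X in ExtJ X](erefl (a *: T (ResI (Si f)) + U (ResI (Si f)))) lEJ.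
    rewrite -[X in rJ (ExtJ X)](erefl (a *: T (ResI (rI (Si f))) + U (ResI (rI (Si f))))) lEJ lrJ.
    by rewrite opprD -scalerN; exact: h3.
Qed.

End Part2b.

End Assembly.

Theorem theorem2p10 (R : realType) (n i j : nat) (lam nu : R[i])
    (hn : (2 <= n)%N) (hi : (i <= n)%N) (hj : (j <= n.-1)%N) :
  let i' := (n - i)%N in
  let j' := (n.-1 - j)%N in
  [/\ exists (S : I0 n i lam -> I0 n i' lam) (Sinv : I0 n i' lam -> I0 n i lam)
             (S' : J0 n j nu -> J0 n j' nu) (S'inv : J0 n j' nu -> J0 n j nu),
        [/\ rep_iso (lorentz0 n) S Sinv,
            rep_iso (lorentz_stab0 n) S' S'inv,
            lin_bij (Diff_SO0 n i lam j nu) (Diff_SO0 n i' lam j nu)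
              (fun T => T \o Sinv),
            lin_bij (Diff_SO0 n i' lam j nu) (Diff_SO0 n i lam j' nu)
              (fun T => S' \o T \o S)
          & lin_bij (Diff_SO0 n i lam j' nu) (Diff_SO0 n i' lam j' nu)
              (fun T => T \o Sinv)],
      (exists2 T, Diff_SO0 n i lam j nu T & T <> 0) ->
        exists k : nat, nu - lam = k%:R
    & forall k : nat, nu - lam = k%:R ->
      forall alpha : 'Z_2, let beta := alpha + k%:R in
        lin_iso (Diff_SO0 n i lam j nu)
          (Diff_O n i lam alpha j nu beta `*` Diff_O n i' lam alpha j nu beta)
        /\
        lin_iso
          (Diff_O n i lam alpha j nu beta `*` Diff_O n i' lam alpha j nu beta)
          (Diff_O n i lam alpha j nu beta `*` Diff_O n i lam alpha j' nu beta)].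
Proof.
case: n hn hi hj => [|[|n]] // _ hi hj i' j'; split.
- exact: star_bijections.
- exact: Diff_SO0_nat.
- by move=> k ck alpha beta; split; [exact: Diff_SO0_decomposition|exact: Diff_O_star_bijection].
Qed.
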